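(* Let $d\ge1$, $1\leq p<\infty$, $\kappa>0$, $r\geq1$ an integer, $s<r$, $\gamma\in(0,d]$ and $\beta=2^{\gamma-d}$. Let $f$ be a $B^s_{pp}$-random variable with wavelet density $\beta$, with associated random tree $T$ and random set $\tau\subset[0,1]^d$, all as defined in the context. Then: (i) for all $t<s-\frac{\gamma}{p}$, $f$ takes values in $B^t_{pp}$ almost surely; (ii) almost surely on the event $G=\{\omega\in\Omega : \tau\neq\emptyset\}$, $f\notin B^{s-\gamma/p}_{pp}$; (iii) $\mathrm{singsupp}_r(f)=\tau$ almost surely.
   Context: Wavelets. Let $D=[0,1]^d$ and $\mathcal{L}=\{1,\dots,2^d-1\}$. Let $\phi$ and $\Psi^\ell$, $\ell\in\mathcal{L}$, be compactly supported $C^r$ functions (father and mother wavelets) generating an $r$-regular orthonormal wavelet basis (multiresolution analysis) of $L^2(\mathbb{R}^d)$ (e.g. Daubechies wavelets of sufficiently high order), and put $\psi^\ell_{j,k}(x)=2^{jd/2}\Psi^\ell(2^jx-k)$ for $j\ge0$, $k\in\mathbb{Z}^d$, $\ell\in\mathcal{L}$, and $\phi_k(x)=\phi(x-k)$. Besov spaces. $B^t_{pp}=B^t_{pp}(\mathbb{R}^d)$ is the usual Besov space; as throughout the paper, its norm is used through the equivalent wavelet expression: for $f=\sum_k f_{-1,k}\phi_k+\sum_{j\geq0,k,\ell}f^\ell_{j,k}\psi^\ell_{j,k}$, $$\|f\|_{B^t_{pp}}\simeq\Big(\sum_{j=-1}^\infty 2^{jp(t+\frac d2-\frac dp)}\|\mathbf{f}_j\|_{\ell^p}^p\Big)^{1/p},$$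 where $\|\mathbf{f}_j\|_{\ell^p}^p=\sum_{k,\ell}|f^\ell_{j,k}|^p$ for $j\geq 0$ and $\|\mathbf{f}_{-1}\|_{\ell^p}^p=\sum_k|f_{-1,k}|^p$. Random tree $T$. Nodes are pairs $(j,k)$ with $j\in\{0,1,2,\dots\}$ and $k\in\mathbb{Z}^d$. Write $[k/2]=([k_1/2],\dots,[k_d/2])$, where $[\cdot]$ is the integer part (floor). Let $t_{j,k}$ be independent random variables uniformly distributed on $[0,1]$. The random tree $T$ is built recursively: the root node $(0,0)$ always belongs to $T$ and is its only node at level $0$; once all nodes of $T$ at level $j$ have been determined, $(j+1,l)\in T$ if and only if $(j,[l/2])\in T$ and $t_{j+1,l}<\beta$. Random set $\tau$. For $j\geq0$ and $k\in\{0,\dots,2^j-1\}^d$ let $Q_{j,k}=\{y\in[0,1]^d:[2^jy]=k\}$ (componentwise integer part), $R_j=\{k:(j,k)\in T\}$ and $\tau=\bigcap_{j=1}^\infty\bigcup_{k\in R_j}\overline{Q}_{j,k}$. Random function $f$. Let $X^\ell_{j,k}$ (over all $\ell,j,k$) be i.i.d. real random variables with probability density proportional to $\exp(-\frac{1}{2\kappa^p}|x|^p)$, independent of $T$. The $B^s_{pp}$-random variable with wavelet density $\beta$ is $$f=\sum_{(j,k)\in T,\ \ell\in\mathcal{L}}h_jX^\ell_{j,k}\psi^\ell_{j,k},\qquad h_j=2^{-j(s+\frac d2-\frac dp)},$$ the series being understood as a generalised function; Besov membership refers to the whole series through its wavelet coefficients. Singular support. $\mathrm{singsupp}_r(f)$,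 the $C^r$-singular support of $f$, is the set of points $x\in D$ having no open neighbourhood on which $f$ is a $C^r$ function. *)

(* Defs.v *)
From HB Require Import structures.
From mathcomp Require Import all_boot all_order all_algebra.
From mathcomp Require Import all_classical all_reals all_analysis.
Set Implicit Arguments.
Unset Strict Implicit.
Unset Printing Implicit Defensive.
Import Order.TTheory GRing.Theory Num.Theory.
Import numFieldNormedType.Exports.
Local Open Scope classical_set_scope.
Local Open Scope ring_scope.

(* R^d is represented by the row vectors 'rV[R]_d, which carry the topology and
   the normed space structure of the library. They are equipped here with the
   product (= Borel) sigma-algebra and the d-dimensional Lebesgue measure. *)

Definition rV_display : measure_display. Proof. exact. Qed.

Section RowMeasurable.
Context (R : realType) (d : nat).

Let coord : 'I_d -> 'rV[R]_d -> R := fun i x => x ord0 i.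

Let rV0 : g_sigma_preimage coord set0.
Proof. exact: sigma_algebra0. Qed.

Let rVC A : g_sigma_preimage coord A -> g_sigma_preimage coord (~` A).
Proof. exact: sigma_algebraC. Qed.

Let rV_bigcup (F : _^nat) : (forall i, g_sigma_preimage coord (F i)) ->
  g_sigma_preimage coord (\bigcup_i (F i)).
Proof. exact: sigma_algebra_bigcup. Qed.

HB.instance Definition _ := @isMeasurable.Build rV_display
  'rV[R]_d (g_sigma_preimage coord) rV0 rVC rV_bigcup.
End RowMeasurable.

Lemma measurable_rV_coord (R : realType) d (i : 'I_d) :
  measurable_fun [set: 'rV[R]_d] (fun x => x ord0 i).
Proof.
move=> _ Y mY; rewrite setTI; apply: sub_sigma_algebra => /=.
rewrite -bigcup_seq/=; exists i => /=; first by rewrite mem_index_enum.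
by exists Y => //; rewrite setTI.
Qed.

Lemma measurable_fun_rVP (R : realType) d disp (T : measurableType disp)
    (f : T -> 'rV[R]_d) :
  (forall i, measurable_fun setT (fun x => f x ord0 i)) -> measurable_fun setT f.
Proof.
move=> mf; apply: (@measurability _ _ _ _ _ _
  (\big[setU/set0]_(i < d)
    preimage_set_system setT (fun x : 'rV[R]_d => x ord0 i) measurable)) => //.
move=> _ [B + <-]; rewrite -bigcup_seq => -[i _ [C mC <-]].
by rewrite !setTI; have := mf i measurableT C mC; rewrite setTI.
Qed.

Definition rVcons (R : realType) d (xy : R * 'rV[R]_d) : 'rV[R]_d.+1 :=
  row_mx (const_mx xy.1 : 'M[R]_1) xy.2.

Lemma measurable_rVcons (R : realType) d : measurable_fun setT (@rVcons R d).
Proof.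
apply: (@measurable_fun_rVP R (1 + d)) => i.
have [j ->|j ->] := split_ordP i.
  rewrite (_ : (fun _ => _) = fst); first exact: measurable_fst.
  by apply/funext => -[x y]; rewrite /rVcons row_mxEl mxE.
rewrite (_ : (fun _ => _) = (fun y : 'rV[R]_d => y ord0 j) \o snd).
  exact: measurableT_comp (measurable_rV_coord j) measurable_snd.
by apply/funext => -[x y]; rewrite /rVcons row_mxEr.
Qed.

Lemma measurable_rVuncons (R : realType) d :
  measurable_fun setT (fun v : 'rV[R]_(1 + d) => (v ord0 ord0, rsubmx v)).
Proof.
apply/measurable_fun_pair; first exact: measurable_rV_coord.
apply: measurable_fun_rVP => i.
rewrite (_ : (fun _ => _) = (fun v : 'rV[R]_(1 + d) => v ord0 (rshift 1 i))).
  exact: measurable_rV_coord.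
by apply/funext => v; rewrite mxE.
Qed.

(* Lebesgue measure on R^d: the d-fold product of the Lebesgue measure on R. *)
Fixpoint lebesgue_rV (R : realType) (d : nat) : set 'rV[R]_d -> \bar R :=
  match d return set 'rV[R]_d -> \bar R with
  | 0 => @dirac _ 'rV[R]_0 0 R
  | n.+1 => fun A => (\int[lebesgue_measure]_x
      lebesgue_rV [set y : 'rV[R]_n | A (rVcons (x, y))])%E
  end.

Lemma lebesgue_rV_measure (R : realType) d :
  exists m : {sigma_finite_measure set 'rV[R]_d -> \bar R},
    m = @lebesgue_rV R d :> (set _ -> _).
Proof.
elim: d => [|d [m mE]].
  by exists [the sigma_finite_measure _ _ of @dirac _ 'rV[R]_0 0 R].
pose l : {sigma_finite_measure set (measurableTypeR R) -> \bar R} :=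
  @lebesgue_measure R.
pose m' := product_measure1 l m.
have m'_sf : sigma_finite setT m'.
  have /sigma_finiteP[F [TF ndF Foo]] := sigma_finiteT l.
  have /sigma_finiteP[G [TG ndG Goo]] := sigma_finiteT m.
  exists (fun n => F n `*` G n).
    rewrite -setXTT TF TG predeqE => -[x y]; split.
      move=> [/= [n _ Fnx] [k _ Gky]]; exists (maxn n k) => //; split.
      - by move: x Fnx; exact/subsetPset/ndF/leq_maxl.
      - by move: y Gky; exact/subsetPset/ndG/leq_maxr.
    by move=> [n _ []/= ? ?]; split; exists n.
  move=> k; have [? ?] := Foo k; have [? ?] := Goo k.
  split; first exact: measurableX.
  by rewrite /m' product_measure1E// lte_mul_pinfty// ge0_fin_numE.
pose M : {measure set 'rV[R]_d.+1 -> \bar R} :=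
  measure_function_pushforward__canonical__measure_function_Measure m'
    (@measurable_rVcons R d).
have ME A : M A = lebesgue_rV A.
  rewrite /M /pushforward /m' /product_measure1 /=; apply: eq_integral => x _.
  by rewrite -mE /xsection /=; congr (m _); apply/funext => y; rewrite /= inE.
have Msf : sigma_finite setT M.
  have [F TF mF] := m'_sf.
  exists (fun n => (fun v : 'rV[R]_(1 + d) => (v ord0 ord0, rsubmx v)) @^-1` F n).
    by rewrite -preimage_bigcup -TF preimage_setT.
  move=> n; have [mFn Fnoo] := mF n; split.
    by rewrite -[X in measurable X]setTI; exact: measurable_rVuncons.
  rewrite [M _](_ : _ = m' (F n))//=; congr (m' _).
  apply/funext => -[x y]; rewrite /preimage /rVcons /= row_mxKr.
  by rewrite mxE; case: splitP => // j _; rewrite mxE.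
clearbody M.
pose C1 := isSFinite.Build _ _ _ M (sfinite_measure_sigma_finite Msf).
pose C2 := isSigmaFinite.Build _ _ _ M Msf.
pose MS := HB.pack_for {sigma_finite_measure set 'rV[R]_d.+1 -> \bar R}
  (Measure.sort M) C1 C2.
by exists MS; apply/funext => A; exact: ME.
Qed.

Section LebesgueRV.
Context (R : realType) (d : nat).
Local Notation mu := (@lebesgue_rV R d).

Let mu0 : mu set0 = 0%E.
Proof. by have [m <-] := lebesgue_rV_measure R d; exact: measure0. Qed.

Let mu_ge0 A : (0 <= mu A)%E.
Proof. by have [m <-] := lebesgue_rV_measure R d; exact: measure_ge0. Qed.

Let mu_sigma_additive : semi_sigma_additive mu.
Proof.
by have [m <-] := lebesgue_rV_measure R d; exact: measure_semi_sigma_additive.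
Qed.

HB.instance Definition _ := isMeasure.Build _ _ _ mu mu0 mu_ge0 mu_sigma_additive.

Let mu_sigma_finite : sigma_finite setT mu.
Proof. by have [m <-] := lebesgue_rV_measure R d; exact: sigma_finiteT. Qed.

HB.instance Definition _ := Measure_isSigmaFinite.Build _ _ _ mu mu_sigma_finite.
End LebesgueRV.

Section Wavelets.
Context (R : realType) (d : nat).
Local Notation E := 'rV[R]_d.
Local Notation Zd := 'rV[int]_d.
Local Notation L := 'I_(2 ^ d - 1).
Local Notation mu := (@lebesgue_rV R d).

(* C^n on an open set U: all partial derivatives of order at most n exist and
   are continuous at every point of U (values outside U are irrelevant). *)
Fixpoint Cn (n : nat) (U : set E) (f : E -> R) : Prop :=
  (forall x, U x -> {for x, continuous f}) /\
  match n with
  | 0 => True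
  | m.+1 => forall i : 'I_d,
      (forall x, U x -> derivable f x (delta_mx ord0 i)) /\
      Cn m U (fun x => 'D_(delta_mx ord0 i) f x)
  end.

Definition compactly_supported_in (U : set E) (f : E -> R) : Prop :=
  exists K : set E, [/\ compact K, K `<=` U & forall x, ~ K x -> f x = 0].

Definition test_function (U : set E) (f : E -> R) : Prop :=
  (forall n, Cn n setT f) /\ compactly_supported_in U f.

Definition L2 : set (E -> R) := [set f | f \in Lfun mu 2%:E].

Definition L2_dist (f g : E -> R) : \bar R := 'N[mu]_2%:E[EFin \o (f \- g)].

Definition dotL2 (f g : E -> R) : R := \int[mu]_x (f x * g x).

Section Families.
Context (I : eqType).
Implicit Type e : I -> E -> R.

Definition orthonormal_family e : Prop :=
  (forall i, L2 (e i)) /\ forall i j, dotL2 (e i) (e j) = (i == j)%:R.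

Definition closed_span e : set (E -> R) :=
  [set f | L2 f /\ forall eps : R, 0 < eps ->
     exists (s : seq I) (c : I -> R),
       (L2_dist f (fun x => \sum_(i <- s) c i * e i x)%R < eps%:E)%E].

Definition orthonormal_basis e : Prop :=
  orthonormal_family e /\ closed_span e = L2.

End Families.

Definition intv (k : Zd) : E := map_mx intr k.

Section MRA.
Context (phi : E -> R) (Psi : L -> E -> R).

Definition father (k : Zd) (x : E) : R := phi (x - intv k).

Definition mother (j : nat) (k : Zd) (l : L) (x : E) : R :=
  2 `^ (j%:R * d%:R / 2) * Psi l (2 ^+ j *: x - intv k).

(* The approximation spaces V_j, j in Z, of the multiresolution analysis
   generated by phi. *)
Definition V_ (j : int) : set (E -> R) :=
  closed_span (fun (k : Zd) x => phi ((2 : R) ^ j *: x - intv k)).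

Definition generates_mra : Prop :=
  [/\ orthonormal_family father,
      forall j : int, V_ j `<=` V_ (j + 1),
      forall f, (forall j : int, V_ j f) -> {ae mu, forall x, f x = 0}
    & forall f, L2 f -> forall eps : R, 0 < eps ->
        exists j g, V_ j g /\ (L2_dist f g < eps%:E)%E].

Definition wavelet_index : Type := (Zd + nat * Zd * L)%type.

Definition wavelet_system (i : wavelet_index) : E -> R :=
  match i with
  | inl k => father k
  | inr (j, k, l) => mother j k l
  end.

(* phi and Psi^l are real-valued compactly supported C^r functions, phi is the
   scaling function of a multiresolution analysis, the Psi^l lie in V_1, and
   the wavelet system is an orthonormal basis of L^2(R^d). It follows that the
   integer translates of the Psi^l form an orthonormal basis of the orthogonal
   complement of V_0 in V_1. *)
Definition wavelet_basis (r : nat) : Prop :=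
  [/\ Cn r setT phi /\ compactly_supported_in setT phi,
      forall l, Cn r setT (Psi l) /\ compactly_supported_in setT (Psi l),
      generates_mra,
      forall l, V_ 1 (Psi l)
    & orthonormal_basis wavelet_system].

(* A (formal) wavelet series, given by its coefficients f_{-1,k} and
   f^l_{j,k}. *)
Record wseries := WSeries {
  coef_father : Zd -> R ;
  coef_mother : nat -> Zd -> L -> R
}.

(* The sum of all the terms of level < J. Since phi and Psi^l are compactly
   supported, at every point x only finitely many k contribute. *)
Definition partial_sum (F : wseries) (J : nat) (x : E) : R :=
  (\sum_(k \in [set: Zd]) coef_father F k * father k x) +
  \sum_(j < J) \sum_(k \in [set: Zd])
    \sum_(l : L) coef_mother F j k l * mother j k l x.

(* The generalised function defined by the series F is a C^r function on U: on
   the test functions supported in U the series converges to a C^r function, in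
   the sense of distributions. For negative regularity the whole series need
   not converge as a distribution on R^d (the wavelets having only r vanishing
   moments), hence convergence is only required on U. *)
Definition is_Cr_on (r : nat) (F : wseries) (U : set E) : Prop :=
  exists g : E -> R, Cn r U g /\
    forall theta, test_function U theta ->
      (fun J => \int[mu]_x (partial_sum F J x * theta x)) @ \oo -->
      \int[mu]_x (g x * theta x).

Definition unit_cube : set E := [set x | forall i, 0 <= x ord0 i <= 1].

Definition singsupp (r : nat) (F : wseries) : set E :=
  [set x | unit_cube x /\
     ~ exists U : set E, [/\ open U, U x & is_Cr_on r F U]].

End MRA.

Definition besov_weight (t p j : R) : \bar R :=
  (2 `^ (j * p * (t + d%:R / 2 - d%:R / p)))%:E.

Definition besov_norm (t p : R) (F : wseries) : \bar R :=
  ((besov_weight t p (-1) *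
      (\esum_(k in [set: Zd]) (`|coef_father F k| `^ p)%:E)
    + \sum_(0 <= j <oo) (besov_weight t p j%:R *
        (\esum_(k in [set: Zd]) \sum_(l : L) (`|coef_mother F j k l| `^ p)%:E)))
   `^ p^-1)%E.

Definition besov_space (t p : R) : set wseries :=
  [set F | (besov_norm t p F < +oo)%E].

End Wavelets.

Section RandomTree.
Context (R : realType) (d : nat).
Local Notation E := 'rV[R]_d.
Local Notation Zd := 'rV[int]_d.
Local Notation L := 'I_(2 ^ d - 1).

(* [k/2]; %/ by 2 on int rounds towards -oo. *)
Definition parent (k : Zd) : Zd := \row_i (k ord0 i %/ 2)%Z.

Fixpoint level (beta : R) (t : nat -> Zd -> R) (j : nat) : set Zd :=
  match j with
  | 0 => [set 0]
  | j'.+1 => [set k | level beta t j' (parent k) /\ t j'.+1 k < beta]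
  end.

Definition tree (beta : R) (t : nat -> Zd -> R) : set (nat * Zd) :=
  [set n | level beta t n.1 n.2].

Definition Q (j : nat) (k : Zd) : set E :=
  [set y | unit_cube y /\ forall i, Num.floor (2 ^+ j * y ord0 i) = k ord0 i].

Definition tau (T : set (nat * Zd)) : set E :=
  \bigcap_(j in [set j | (1 <= j)%N]) \bigcup_(k in [set k | T (j, k)])
    closure (Q j k).

Definition random_wseries (s p : R) (T : set (nat * Zd))
    (X : nat -> Zd -> L -> R) : wseries R d :=
  WSeries (fun=> 0)
    (fun j k l => if `[< T (j, k) >]
       then 2 `^ (- (j%:R * (s + d%:R / 2 - d%:R / p))) * X j k l else 0).

End RandomTree.
Arguments tau R {d} T.

Section Probability.
Context (R : realType) (disp : measure_display) (Omega : measurableType disp).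
Context (P : probability Omega R).

(* Mutual independence: the product rule over every finite subfamily. *)
Definition mutually_independent (I : eqType) (Y : I -> {RV P >-> R}) : Prop :=
  forall (s : seq I) (A : I -> set R), uniq s -> (forall i, measurable (A i)) ->
    (P (\bigcap_(i in [set` s]) (Y i @^-1` A i)) =
     \prod_(i <- s) P (Y i @^-1` A i))%E.

Definition independent_generated (G H : set (set Omega)) : Prop :=
  forall A B, <<s G >> A -> <<s H >> B -> (P (A `&` B) = P A * P B)%E.

(* The random inputs: (t_{j,k}) i.i.d. uniform on [0,1]; (X^l_{j,k}) i.i.d. with
   density c exp(-|x|^p / (2 kappa^p)); (X^l_{j,k}) independent of the tree. *)
Definition random_inputs (d : nat) (beta kappa p : R)
    (t : nat -> 'rV[int]_d -> {RV P >-> R})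
    (X : nat -> 'rV[int]_d -> 'I_(2 ^ d - 1) -> {RV P >-> R}) : Prop :=
  [/\ mutually_independent (fun n : nat * 'rV[int]_d => t n.1 n.2)
      /\ (forall j k A, measurable A ->
           distribution P (t j k) A = uniform_prob (@ltr01 R) A),
      mutually_independent
        (fun n : nat * 'rV[int]_d * 'I_(2 ^ d - 1) => X n.1.1 n.1.2 n.2),
      exists c : R, forall j k l A, measurable A ->
        distribution P (X j k l) A =
        (\int[lebesgue_measure]_(x in A)
           (c * expR (- (2 * kappa `^ p)^-1 * `|x| `^ p))%:E)%E
    & independent_generated
        [set B | exists n, B = [set w | tree beta (fun j k => t j k w) n]]
        [set B | exists j k l A, measurable A /\ B = X j k l @^-1` A]].

End Probability.

(* Main.v *)
Require Import Defs.
From HB Require Import structures.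
From mathcomp Require Import all_boot all_order all_algebra.
From mathcomp Require Import all_classical all_reals all_analysis.
From mathcomp Require Import measurable_realfun.
From mathcomp Require Import ring lra zify.
Set Implicit Arguments.
Unset Strict Implicit.
Unset Printing Implicit Defensive.
Import Order.TTheory GRing.Theory Num.Theory.
Import numFieldNormedType.Exports.
Local Open Scope classical_set_scope.
Local Open Scope ring_scope.

(** Write m = 2^d beta = 2^gamma > 1. The numbers of nodes at the successive
    levels of T form a Galton-Watson process whose offspring law is binomial with
    parameters 2^d and beta, of mean m. Through the wavelet expression of the norm,
    f belongs to the Besov space of exponent t0 when the sum over j of
    2^(jp(t0 - s)) S_j is finite, S_j being the sum of |X|^p over the nodes of
    level j (besov_spaceP).

    (i) The expectation of S_j is a constant times m^j, because X has a finite
    p-th moment and the tree is independent of the coefficients. For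
    t0 < s - gamma/p the expectations of the terms are therefore those of a
    convergent geometric series (ae_besov).

    (ii) At t0 = s - gamma/p the weight of level j is m^-j, so finiteness would
    make m^-n M_n tend to 0, where M_n is the number of nodes of level n that are
    marked by a coefficient larger than some v > 0. On survival this has
    probability 0, which is read off the generating function g of the offspring law
    instead of a martingale limit. Averaging out the marks, of probability rho,
    gives E (1 - a)^M_n = g^n(1 - a rho) (thinning, marked_gf). The inequality
    1 / (1 - g(1 - y)) <= 1 + 1 / (m y), once iterated, keeps
    g^(n-i)(1 - rho m^-(n-i)) below some 1 - delta with delta independent of n
    (iter_genf_gap). By Markov's inequality the event that m^-(n-i) M_n is small
    has probability at most g^i(1 - delta) up to a small error, and it contains
    the extinction at level i, of probability g^i(0). As the two orbits of g merge
    (iter_genf_merge), its intersection with survival has arbitrarily small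
    probability, uniformly in n (prob_few_surviving).

    (iii) Near a point outside tau only finitely many terms of the series are
    active, whence one inclusion (singsupp_subset_tau). For the other one, let f be
    of class C^r near a point x of tau, and test f against the r-th difference, in
    the first coordinate and with step 2^-j, of a bump of size 2^-j placed at a
    node k of T near x. Translation invariance moves the differences to the other
    factor, so on a C^r function they produce a factor 2^(-jr) (Rintegral_probe_Cn),
    while the wavelet of the node itself contributes its random coefficient times a
    number of order at least 2^(-j(s - d/p)), in the same units
    (pairing_lower_bound). That coefficient has a bounded density and is independent
    of everything else, so the whole pairing is as small as C^r regularity requires
    with probability O(2^(-j(r - s + d/p))) (anticoncentration). For each large j
    there is a node of T near x; applying this to the first such node avoids a sum
    over the nodes (prob_first_small), and the probability tends to 0 because s < r.
    A neighbourhood of x and a constant are chosen among countably many, so almost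
    surely no point of tau is regular (ae_tau_subset_singsupp). *)

(** * Calculus on row vectors *)

Section Calculus.
Context (R : realType) (d : nat).
Local Notation E := 'rV[R]_d.
Implicit Types (U V : set E) (f g : E -> R) (n : nat).

(** Restricting to a line reduces directional derivatives on row vectors to
    derivatives on R, where the chain rule and the mean value theorem live. *)
Lemma is_derive_line_at f (x v : E) (s : R) df :
  is_derive (s *: v + x) v f df <->
  is_derive (s : R) 1 (fun h : R => f (h *: v + x)) df.
Proof.
have E0 : (fun h : R => h^-1 *: ((f \o shift (s *: v + x)) (h *: v) - f (s *: v + x))) =
    (fun h : R => h^-1 *: (((fun h : R => f (h *: v + x)) \o shift s) (h *: 1)
      - f (s *: v + x))).
  by apply/funext => h /=; rewrite [_%:A]mulr1 scalerDl addrA.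
have H1 : derivable f (s *: v + x) v = derivable (fun h : R => f (h *: v + x)) s 1.
  by rewrite /derivable E0.
have H2 : 'D_v f (s *: v + x) = 'D_1 (fun h : R => f (h *: v + x)) s.
  by rewrite /derive E0.
split=> -[d1 d2]; split.
- by rewrite -H1.
- by rewrite -H2.
- by rewrite H1.
- by rewrite H2.
Qed.

Lemma is_derive_line f x v df :
  is_derive x v f df <-> is_derive (0 : R) 1 (fun h : R => f (h *: v + x)) df.
Proof. by have := is_derive_line_at f x v 0 df; rewrite scale0r add0r. Qed.

Lemma is_derive_comp_line (F : R -> R) f x v a b :
  is_derive (f x) 1 F a -> is_derive x v f b ->
  is_derive x v (F \o f) (a * b).
Proof.
move=> Fa /is_derive_line fb; apply/is_derive_line.
apply: (@is_derive1_comp _ F (fun h : R => f (h *: v + x))).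
by rewrite scale0r add0r.
Qed.

Lemma is_derive_affine f (a : R) (b x v : E) df :
  is_derive (a *: x + b) v f df ->
  is_derive x v (fun y => f (a *: y + b)) (a * df).
Proof.
move=> /is_derive_line fdf; apply/is_derive_line.
have -> : (fun h : R => f (a *: (h *: v + x) + b)) =
  (fun h => f (h *: v + (a *: x + b))) \o (fun h => a * h).
  by apply/funext => h /=; rewrite scalerDr scalerA addrA.
rewrite mulrC; apply: is_derive1_comp; first by rewrite mulr0.
have -> : (fun h : R => a * h) = a \*: id by [].
by apply: is_derive_eq; rewrite /GRing.scale /= mulr1.
Qed.

Lemma Cn_continuous n U f : Cn n U f -> forall x, U x -> {for x, continuous f}.
Proof. by case: n => [|n] []. Qed.

Lemma CnW n U f : Cn n.+1 U f -> Cn n U f.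
Proof.
elim: n f => [|n IHn] f [cf Df]; split=> // i.
by have [? Di] := Df i; split => //; exact: IHn.
Qed.

Lemma CnS n U V f : V `<=` U -> Cn n U f -> Cn n V f.
Proof.
move=> VU; elim: n f => [|n IHn] f [cf Df]; split=> //.
- by move=> x /VU; exact: cf.
- by move=> x /VU; exact: cf.
- move=> i; have [df Di] := Df i; split; first by move=> x /VU; exact: df.
  exact: IHn.
Qed.

(** Since U is open, the values on U determine the germ at each of its points,
    hence all the derivatives. *)
Lemma eq_Cn n U f g : open U -> (forall x, U x -> f x = g x) ->
  Cn n U f -> Cn n U g.
Proof.
move=> oU.
have nfg f' g' : (forall x, U x -> f' x = g' x) ->
    forall x, U x -> {near x, f' =1 g'}.
  move=> fg' x Ux; apply: (@filterS _ (nbhs x) _ U); first exact: fg'.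
  exact: open_nbhs_nbhs.
have cfg f' g' : (forall x, U x -> f' x = g' x) ->
    forall x, U x -> {for x, continuous f'} -> {for x, continuous g'}.
  move=> fg' x Ux cf'; rewrite /prop_for /continuous_at -fg'//.
  apply: cvg_trans cf'; exact: (@near_eq_cvg _ _ (nbhs x) (nbhs_filter x)
    _ _ (nfg _ _ fg' _ Ux)).
elim: n f g => [|n IHn] f g fg [cf Df].
  by split=> // x Ux; apply: cfg fg _ Ux (cf _ Ux).
split=> [x Ux|i]; first by apply: cfg fg _ Ux (cf _ Ux).
have [df Di] := Df i; split => [x Ux|].
  exact: near_eq_derivable (nfg _ _ fg _ Ux) (df _ Ux).
by apply: IHn Di => x Ux; apply: near_eq_derive; exact: (nfg _ _ fg).
Qed.

Lemma Cn_cst n U (c : R) : open U -> Cn n U (fun=> c).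
Proof.
move=> oU; elim: n c => [|n IHn] c; split=> //; do ?by move=> x _; exact: cst_continuous.
move=> i; split; first by move=> x _; exact: derivable_cst.
by apply: eq_Cn (IHn 0) => // x _; rewrite derive_cst.
Qed.

Lemma CnD n U f g : open U -> Cn n U f -> Cn n U g ->
  Cn n U (fun x => f x + g x).
Proof.
move=> oU; elim: n f g => [|n IHn] f g [cf Df] [cg Dg]; split=> //;
  do ?by move=> x Ux; exact: continuousD (cf _ Ux) (cg _ Ux).
move=> i; have [df Dif] := Df i; have [dg Dig] := Dg i; split.
  by move=> x Ux; apply: derivableD; [exact: df|exact: dg].
apply: eq_Cn (IHn _ _ Dif Dig) => // x Ux.
by rewrite -deriveD//; [exact: df|exact: dg].
Qed.

Lemma CnM n U f g : open U -> Cn n U f -> Cn n U g ->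
  Cn n U (fun x => f x * g x).
Proof.
move=> oU; elim: n f g => [|n IHn] f g Cf Cg; have [cf Df] := Cf; have [cg Dg] := Cg;
  split=> //; do ?by move=> x Ux; exact: continuousM (cf _ Ux) (cg _ Ux).
move=> i; have [df Dif] := Df i; have [dg Dig] := Dg i; split.
  by move=> x Ux; apply: derivableM; [exact: df|exact: dg].
have := CnD oU (IHn _ _ (CnW Cf) Dig) (IHn _ _ (CnW Cg) Dif).
by apply: eq_Cn => // x Ux; rewrite -deriveM//; [exact: df|exact: dg].
Qed.

Lemma Cn_sum n U (I : Type) (s : seq I) (f : I -> E -> R) : open U ->
  (forall i, Cn n U (f i)) -> Cn n U (fun x => \sum_(i <- s) f i x).
Proof.
move=> oU Cf; elim: s => [|i s IHs].
  by apply: eq_Cn (Cn_cst n 0 oU) => // x _; rewrite big_nil.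
by apply: eq_Cn (CnD oU (Cf i) IHs) => // x _; rewrite big_cons.
Qed.

Lemma continuous_affine (a : R) (b : E) : continuous (fun x : E => a *: x + b).
Proof.
by move=> x; apply: (@continuousD _ _ _ ( *:%R a)); [exact: scaler_continuous|exact: cst_continuous].
Qed.

Lemma Cn_affine n f (a : R) (b : E) : Cn n setT f ->
  Cn n setT (fun x => f (a *: x + b)).
Proof.
elim: n f => [|n IHn] f [cf Df]; split=> //;
  do ?by move=> x Ux; apply: (@continuous_comp _ _ _ (fun x : E => a *: x + b));
    [exact: continuous_affine|exact: cf].
move=> i; have [df Di] := Df i.
have D x : is_derive x (delta_mx ord0 i) (fun y => f (a *: y + b))
    (a * 'D_(delta_mx ord0 i) f (a *: x + b)).
  by apply: is_derive_affine; apply/derivableP; exact: df.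
split=> [x _|]; first exact: (@ex_derive _ _ _ _ _ _ _ (D x)).
have := CnM openT (Cn_cst n a openT) (IHn _ Di).
by apply: eq_Cn => [|x _]; [exact: openT|rewrite (@derive_val _ _ _ _ _ _ _ (D x))].
Qed.

Lemma Cn_coord n (i : 'I_d) : Cn n setT (fun x : E => x ord0 i).
Proof.
have c : forall x : E, setT x -> {for x, continuous (fun x : E => x ord0 i)}.
  by move=> x _; exact: coord_continuous.
case: n => [|n]; split=> // k.
have D x : is_derive x (delta_mx ord0 k) (fun x : E => x ord0 i) (k == i)%:R.
  apply/is_derive_line.
  have -> : (fun h : R => (h *: delta_mx ord0 k + x) ord0 i) =
     ((k == i)%:R \*: (id : R -> R)) + cst (x ord0 i).
    by apply/funext => h; rewrite !mxE /= [RHS]/= eq_sym /GRing.add /= mulrC.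
  by apply: is_derive_eq; rewrite addr0 /GRing.scale /= mulr1.
split=> [x _|]; first exact: (@ex_derive _ _ _ _ _ _ _ (D x)).
apply: eq_Cn (Cn_cst n (k == i)%:R openT) => [|x _]; first exact: openT.
by rewrite (@derive_val _ _ _ _ _ _ _ (D x)).
Qed.

End Calculus.

(** * A smooth bump *)

Section Bump.
Context (R : realType).

(** For p = 1 this is the classical function exp(-1/x), flat at 0. Polynomials in
    1/x are allowed as factors because the family is then stable under
    differentiation, and smoothness follows by induction on the order. *)
Definition flat (p : {poly R}) (x : R) : R :=
  if 0 < x then p.[x^-1] * expR (- x^-1) else 0.

(** Each monomial y^i is at most i! times a term of the exponential series. *)
Lemma horner_expRN_bounded (p : {poly R}) :
  exists2 C : R, 0 <= C & forall y, 0 <= y -> `|p.[y]| <= C * expR y.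
Proof.
exists (\sum_(i < size p) `|p`_i| * i`!%:R).
  by apply: sumr_ge0 => i _; rewrite mulr_ge0.
move=> y y0; rewrite horner_coef mulr_suml; apply: le_trans (ler_norm_sum _ _ _) _.
apply: ler_sum => i _; rewrite normrM -mulrA ler_wpM2l// normrX ger0_norm//.
case: (nat_of_ord i) => [|n].
  by rewrite expr0 fact0 mul1r -expR0 ler_expR.
rewrite -ler_pdivrMl ?ltr0n ?fact_gt0// mulrC.
by apply: le_trans (expR_ge1Dxn n y0); rewrite lerDr.
Qed.

(** One more factor 1/x is absorbed by the polynomial, which leaves a factor x. *)
Lemma flat_small (p : {poly R}) :
  exists2 C : R, 0 <= C & forall x : R, `|flat p x| <= C * `|x|.
Proof.
have [C C0 HC] := horner_expRN_bounded ('X * p); exists C => // x.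
rewrite /flat; case: ltP => [x0|_]; last by rewrite normr0 mulr_ge0.
have := HC x^-1; rewrite invr_ge0 ltW// => /(_ isT).
rewrite hornerM hornerX [X in X <= _ -> _]normrM [X in X * _ <= _ -> _]normfV (ger0_norm (ltW x0)) expRN => H.
rewrite normrM normfV (ger0_norm (expR_ge0 _)) .
by rewrite ler_pdivrMr ?expR_gt0// mulrAC mulrC -ler_pdivrMl.
Qed.

(** Away from 0 this is the product rule. At 0 the difference quotient of the
    function built on p is the function built on X p, which tends to 0. *)
Lemma is_derive_flat (p : {poly R}) (x : R) :
  is_derive x 1 (flat p) (flat ('X^2 * (p - p^`())) x).
Proof.
have [x0|x0|->] := ltgtP x 0.
- apply: (@near_eq_is_derive _ _ _ (cst 0)).
    near=> y; rewrite /flat ltNge ltW//; near: y; exact: lt_nbhsl.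
  by rewrite /flat ltNge ltW//; exact: is_derive_cst.
- apply: (@near_eq_is_derive _ _ _ ((horner p \o (fun x : R => x^-1)) * (expR \o (fun x : R => - x^-1)))).
    near=> y; rewrite /flat ifT//; near: y; exact: lt_nbhsr.
  have dV : is_derive x 1 (fun x : R => x^-1) (- x ^- 2).
    have := @is_deriveV _ id x 1 1 (lt0r_neq0 x0).
    by rewrite /GRing.scale /= mulr1 => /(_ (is_derive_id _ _)).
  have d1 : is_derive x 1 (horner p \o (fun x : R => x^-1)) (p^`().[x^-1] * - x ^- 2).
    apply: is_derive1_comp.
  have d2 : is_derive x 1 (expR \o (fun x : R => - x^-1)) (expR (- x^-1) * x ^- 2).
    apply: is_derive1_comp.
    by have := is_deriveN dV; rewrite opprK.
  apply: (is_derive_eq (is_deriveM d1 d2)).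
  rewrite /flat x0 !hornerE exprVn.
  transitivity (p.[x^-1] * (expR (- x^-1) / x ^+ 2) +
    expR (- x^-1) * (p^`().[x^-1] * - x ^- 2)); [by []|ring].
- have [C C0 HC] := flat_small ('X * p).
  have f0 q : flat q 0 = 0 by rewrite /flat ltxx.
  have L : (fun h : R => h^-1 *: ((flat p \o shift 0) (h *: 1) - flat p 0)) @ 0^' --> (0 : R).
    have -> : (fun h : R => h^-1 *: ((flat p \o shift 0) (h *: 1) - flat p 0)) = flat ('X * p).
      apply/funext => h /=; rewrite f0 subr0 addr0 [_%:A]mulr1 /flat.
      case: ifP => [h0|_]; last by rewrite scaler0.
      by rewrite hornerM hornerX -mulrA.
    by apply: (@cvg_to_0_linear R _ C 1) => // r _; exact: HC.
  rewrite f0; split; first by apply/cvg_ex; exists 0.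
  exact: cvg_lim L.
Unshelve. all: by end_near. Qed.

Lemma flat1_gt0 x : (0 < flat 1 x) = (0 < x).
Proof.
by rewrite /flat; case: ifP => //; rewrite ?ltxx// hornerE mul1r expR_gt0.
Qed.

Lemma Cn_flat d n (p : {poly R}) (f : 'rV[R]_d -> R) :
  (forall n, Cn n setT f) -> Cn n setT (fun x => flat p (f x)).
Proof.
move=> Cf; elim: n p => [|n IHn] p.
  split=> // x _; apply: continuous_comp (Cn_continuous (Cf 0) I) _.
  by apply/differentiable_continuous/derivable1_diffP; have [] := is_derive_flat p (f x).
have D x i : is_derive x (delta_mx ord0 i) (flat p \o f)
   (flat ('X^2 * (p - p^`())) (f x) * 'D_(delta_mx ord0 i) f x).
  apply: is_derive_comp_line; first exact: is_derive_flat.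
  by apply/derivableP; have [_ /(_ i) [+ _]] := Cf 1%N; exact.
split=> [|i]; first exact: (Cn_continuous (IHn p)).
split=> [x _|]; first exact: (@ex_derive _ _ _ _ _ _ _ (D x i)).
have [_ /(_ i) [_ CDf]] := Cf n.+1.
have := CnM openT (IHn ('X^2 * (p - p^`()))) CDf.
by apply: eq_Cn => [|x _]; [exact: openT|rewrite (@derive_val _ _ _ _ _ _ _ (D x i))].
Qed.

End Bump.

(** * Finite differences *)

Section Differences.
Context (R : realType) (d : nat).
Local Notation E := 'rV[R]_d.
Implicit Types (f g : E -> R) (e v w x y : E).

Definition fdiff w f x := f (x + w) - f x.

Lemma fdiffn_affine n w f (a : R) (b : E) x :
  iter n (fdiff w) (fun y => f (a *: y + b)) x =
  iter n (fdiff (a *: w)) f (a *: x + b).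
Proof.
elim: n x => [|n IHn] x //=.
by rewrite /fdiff !IHn scalerDr addrAC.
Qed.

Lemma Cn_fdiffn m n w f : Cn m setT f -> Cn m setT (iter n (fdiff w) f).
Proof.
move=> Cf; elim: n => [|n IHn] //.
have C1 := Cn_affine 1 w IHn.
have C2 := CnM openT (Cn_cst m (-1) openT) IHn.
apply: eq_Cn (CnD openT C1 C2); first exact: openT.
by move=> x _ /=; rewrite /fdiff scale1r mulN1r.
Qed.

Lemma fdiffn_eq0 n w f (A : set E) x :
  (forall k, (k <= n)%N -> ~ A (x + k%:R *: w)) ->
  (forall y, f y != 0 -> A y) -> iter n (fdiff w) f x = 0.
Proof.
move=> + fA; elim: n x => [|n IHn] x xA /=.
  apply/eqP/negPn/negP => /fA.
  by have := xA 0%N (leqnn _); rewrite scale0r addr0.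
rewrite /fdiff !IHn ?subrr// => k kn.
- by apply: xA; exact: leqW.
- by rewrite -addrA -{1}[w]scale1r -scalerDl nat1r; apply: (xA k.+1).
Qed.

(** Differences commute with derivatives; differentiability is only asked at the
    finitely many points that the difference involves. *)
Lemma is_derive_fdiffn n e w f y :
  (forall k, (k <= n)%N -> derivable f (y + k%:R *: w) e) ->
  is_derive y e (iter n (fdiff w) f) (iter n (fdiff w) (fun x => 'D_e f x) y).
Proof.
elim: n y => [|n IHn] y df /=.
  by apply: derivableP; have := df 0%N (leqnn _); rewrite scale0r addr0.
have d0 : is_derive y e (iter n (fdiff w) f) (iter n (fdiff w) (fun x => 'D_e f x) y).
  by apply: IHn => k kn; apply: df; exact: leqW.
have d1 : is_derive y e (fun x => iter n (fdiff w) f (1 *: x + w))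
    (1 * iter n (fdiff w) (fun x => 'D_e f x) (1 *: y + w)).
  apply: is_derive_affine; apply: IHn => k kn; rewrite scale1r.
  rewrite -addrA -[X in y + (X + _)]scale1r -scalerDl.
  by rewrite (_ : 1 + k%:R = k.+1%:R) ?nat1r//; exact: df.
have := is_deriveB d1 d0; rewrite mul1r scale1r /fdiff.
by congr (is_derive _ _ _ _); apply/funext => x; rewrite -{2}[x]scale1r.
Qed.

(** Iterated mean value theorem: every difference of step h costs a factor h and
    one derivative. The hypotheses concern the segment swept by the differences
    alone, so that the bound is available for f regular near a point only. *)
Lemma fdiffn_bound n e f x (h C : R) : 0 <= h ->
  (forall k, (k < n)%N -> forall s, 0 <= s <= n%:R * h ->
    derivable (iter k (fun f x => 'D_e f x) f) (s *: e + x) e) ->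
  (forall s, 0 <= s <= n%:R * h ->
    `|iter n (fun f x => 'D_e f x) f (s *: e + x)| <= C) ->
  `|iter n (fdiff (h *: e)) f x| <= C * h ^+ n.
Proof.
move=> h0; elim: n f x => [|n IHn] f x df bf /=.
  have := bf 0; rewrite scale0r add0r mul0r lexx => /(_ isT) /=.
  by rewrite expr0 mulr1.
pose G t := iter n (fdiff (h *: e)) f (t *: e + x).
have G1 t : 0 <= t <= h -> is_derive (t : R) 1 G
   (iter n (fdiff (h *: e)) (fun x => 'D_e f x) (t *: e + x)).
  move=> /andP[t0 th]; apply/is_derive_line_at; apply: is_derive_fdiffn => k kn.
  rewrite scalerA addrAC -scalerDl; apply: (df 0%N) => //.
  apply/andP; split; first by rewrite addr_ge0// mulr_ge0.
  by rewrite -natr1 mulrDl mul1r addrC lerD// ler_wpM2r// ler_nat.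
have cG : {within `[0, h], continuous G}.
  apply: derivable_within_continuous => t; rewrite in_itv/= => /G1 [] //.
have [c c0h] : exists2 c, c \in `[0, h]%R & G h - G 0 =
     (iter n (fdiff (h *: e)) (fun x => 'D_e f x) (c *: e + x)) * (h - 0).
  apply: (@MVT_segment _ G (fun c => iter n (fdiff (h *: e)) (fun x => 'D_e f x) (c *: e + x))) => // t.
  by rewrite in_itv/= => /andP[t0 th]; apply: G1; rewrite !ltW.
move: c0h; rewrite in_itv/= => /andP[c0 ch].
have -> : G h - G 0 = fdiff (h *: e) (iter n (fdiff (h *: e)) f) x.
  by rewrite /G /fdiff scale0r add0r [x + _]addrC.
move=> ->; rewrite subr0 normrM (ger0_norm h0) exprSr mulrA ler_wpM2r//.
have sb s : 0 <= s <= n%:R * h -> 0 <= s + c <= n.+1%:R * h.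
  move=> /andP[s0 sn]; rewrite addr_ge0//=.
  by rewrite -natr1 mulrDl mul1r lerD.
apply: IHn => [k kn s sn|s sn].
- rewrite addrA -scalerDl -(iterSr k (fun f x => 'D_e f x)).
  by apply: df => //; exact: sb.
- by rewrite addrA -scalerDl -(iterSr n (fun f x => 'D_e f x)); apply: bf; exact: sb.
Qed.

Lemma Cn_iter_derive n (U : set E) f i k : Cn n U f -> (k <= n)%N ->
  Cn (n - k) U (iter k (fun f x => 'D_(delta_mx ord0 i) f x) f).
Proof.
elim: k => [|k IHk] Cf kn; first by rewrite subn0.
by have := IHk Cf (ltnW kn); rewrite -(subnSK kn) => -[_ /(_ i) []].
Qed.

(** A periodic function of bounded support vanishes: translate by a large multiple
    of the period. *)
Lemma fdiff_eq0 w f : w != 0 -> (exists M : R, forall x, f x != 0 -> `|x| <= M) ->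
  (forall x, fdiff w f x = 0) -> forall x, f x = 0.
Proof.
move=> w0 [M fM] df x.
have P n : f (x + n%:R *: w) = f x.
  elim: n => [|n <-]; first by rewrite scale0r addr0.
  have := df (x + n%:R *: w); rewrite /fdiff => /eqP; rewrite subr_eq0 => /eqP <-.
  by rewrite -addrA -{3}[w]scale1r -scalerDl natr1.
apply/eqP/negPn/negP => fx0.
pose n := (Num.truncn ((M + `|x|) / `|w|)).+1.
have := fM (x + n%:R *: w); rewrite P => /(_ fx0).
have w1 : 0 < `|w| by rewrite normr_gt0.
apply/negP; rewrite -ltNge.
have : (M + `|x|) / `|w| < n%:R by exact: truncnS_gt.
rewrite ltr_pdivrMr// => H.
rewrite addrC; apply: (lt_le_trans _ (lerB_normD (n%:R *: w) x)).
by rewrite normrZ ger0_norm// ltrBrDr.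
Qed.

Lemma fdiffn_neq0 n w f : w != 0 -> (exists M : R, forall x, f x != 0 -> `|x| <= M) ->
  (exists x, f x != 0) -> exists x, iter n (fdiff w) f x != 0.
Proof.
move=> w0 [M fM] fx; elim: n => [|n IHn] //=.
apply/not_existsP => H; have [x /eqP] := IHn; apply.
apply: (@fdiff_eq0 w) => //; last by move=> y; apply/eqP/negPn/negP/H.
exists (M + n%:R * `|w|) => y; apply: contraNT; rewrite -ltNge => yM; apply/eqP.
apply: (@fdiffn_eq0 n w f [set y | `|y| <= M]) => // k kn /=.
apply/negP; rewrite -ltNge; apply: (lt_le_trans _ (lerB_normD y (k%:R *: w))).
rewrite normrZ ger0_norm// ltrBrDr; apply: le_lt_trans yM.
by rewrite lerD2l ler_wpM2r// ler_nat.
Qed.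

Lemma rV_norm_ltP (x : E) (r : R) : 0 < r ->
  `|x| < r <-> forall i, `|x ord0 i| < r.
Proof.
move=> r0; rewrite [`|x|]mx_normrE; split => [/bigmax_ltP[_ H] i|H].
  exact: (H (ord0, i)).
by apply/bigmax_ltP; split => // -[i j] _ /=; rewrite ord1.
Qed.

Lemma rV_norm_leP (x : E) (r : R) : 0 <= r ->
  `|x| <= r <-> forall i, `|x ord0 i| <= r.
Proof.
move=> r0; rewrite [`|x|]mx_normrE; split => [/bigmax_leP[_ H] i|H].
  exact: (H (ord0, i)).
by apply/bigmax_leP; split => // -[i j] _ /=; rewrite ord1.
Qed.

(** The bump is the flat function of rho^2 - sum_i (x_i - y_i)^2. *)
Lemma exists_bump (y : E) (rho : R) : 0 < rho -> exists theta : E -> R,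
  [/\ forall n, Cn n setT theta, forall x, 0 <= theta x, 0 < theta y &
      forall x, theta x != 0 -> `|x - y| < rho].
Proof.
move=> rho0; pose q (x : E) := rho ^+ 2 + \sum_(i <- enum 'I_d) -1 * ((x ord0 i - y ord0 i) * (x ord0 i - y ord0 i)).
exists (fun x => flat 1 (q x)); split.
- move=> n; apply: Cn_flat => {}n; apply: CnD; [exact: openT|exact: Cn_cst openT|].
  apply: Cn_sum => [|i]; first exact: openT.
  apply: CnM; [exact: openT|exact: Cn_cst openT|].
  by apply: CnM; [exact: openT| |]; apply: CnD; [exact: openT|exact: Cn_coord|exact: Cn_cst openT|exact: openT|exact: Cn_coord|exact: Cn_cst openT].
- move=> x; rewrite /flat; case: ifP => // _.
  by rewrite hornerE mul1r expR_ge0.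
- rewrite flat1_gt0 /q big1 ?addr0 ?exprn_gt0// => i _.
  by rewrite subrr mul0r mulr0.
- move=> x x0; have : 0 < flat 1 (q x).
    rewrite lt_neqAle eq_sym x0 /= /flat; case: ifP => // _.
    by rewrite hornerE mul1r expR_ge0.
  rewrite flat1_gt0 /q -mulr_sumr mulN1r subr_gt0 => H.
  apply/rV_norm_ltP => // i; rewrite !mxE.
  rewrite -(@ltr_pXn2r _ 2) ?nnegrE ?(ltW rho0)// real_normK ?num_real//.
  apply: le_lt_trans H; rewrite big_enum/= (bigD1 i)//= expr2 lerDl.
  by apply: sumr_ge0 => j _; rewrite -expr2 sqr_ge0.
Qed.

End Differences.

(** * Borel sets and boxes *)

Lemma lt_mul_pow2 (R : realType) (M e : R) : 0 < e ->
  exists n, forall j, (n <= j)%N -> M < e * 2 ^+ j.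
Proof.
move=> e0; exists (Num.bound (M / e)) => j /upper_nthrootP.
by rewrite ltr_pdivrMr// mulrC.
Qed.

Section BorelRV.
Context (R : realType) (d : nat).
Local Notation E := 'rV[R]_d.
Local Notation Zd := 'rV[int]_d.

Definition dyadic_cube (n : nat) (k : Zd) : set E :=
  [set y | forall i, Num.floor (2 ^+ n * y ord0 i) = k ord0 i].

Lemma measurable_dyadic_cube n k : measurable (dyadic_cube n k).
Proof.
rewrite (_ : dyadic_cube n k = \bigcap_(i in [set: 'I_d])
    ((fun y : E => y ord0 i) @^-1`
      `[(k ord0 i)%:~R / 2 ^+ n, (k ord0 i + 1)%:~R / 2 ^+ n[%classic)).
  apply: fin_bigcap_measurable => // i _.
  by rewrite -[X in measurable X]setTI; exact: measurable_rV_coord.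
have c2 : 0 < (2 : R) ^+ n by rewrite exprn_gt0.
apply/seteqP; split=> y /= Hy i => [_|].
  rewrite /= in_itv/= ler_pdivrMr// ltr_pdivlMr// ![y _ _ * _]mulrC.
  by rewrite -floor_eq; exact/eqP.
apply/eqP; rewrite floor_eq; have := Hy i I.
by rewrite /= in_itv/= ler_pdivrMr// ltr_pdivlMr// ![y _ _ * _]mulrC.
Qed.

Lemma dyadic_cube_dist n k (x y : E) : dyadic_cube n k x -> dyadic_cube n k y ->
  forall i, `|x ord0 i - y ord0 i| < 2 ^- n.
Proof.
move=> kx ky i; have := floor_itv (2 ^+ n * x ord0 i).
have := floor_itv (2 ^+ n * y ord0 i); rewrite kx ky.
rewrite intrD => /andP[y1 y2] /andP[x1 x2].
have c2 : 0 < (2 : R) ^+ n by rewrite exprn_gt0.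
rewrite -(@ltr_pM2l _ (2 ^+ n))// divff ?gt_eqF// -(gtr0_norm c2) -normrM mulrBr.
by rewrite ltr_norml; apply/andP; split; lra.
Qed.

(** The sigma-algebra is generated by the coordinates, so dyadic cubes are
    measurable, and an open set is a countable union of them. *)
Lemma open_measurable_rV (A : set E) : open A -> measurable A.
Proof.
move=> oA.
pose F (nk : nat * Zd) := if `[< dyadic_cube nk.1 nk.2 `<=` A >]
  then dyadic_cube nk.1 nk.2 else set0.
rewrite (_ : A = \bigcup_nk F nk).
  apply: countable_bigcupT_measurable => // nk; rewrite /F.
  by case: ifP => // _; exact: measurable_dyadic_cube.
apply/seteqP; split=> [x Ax|x [nk _]]; last first.
  by rewrite /F; case: ifPn => // /asboolP H /H.
have : nbhs x A by rewrite nbhsE; exists A.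
move=> /nbhs_ballP[e /= e0 eA].
have [n nP] := lt_mul_pow2 1 e0.
exists (n, \row_i Num.floor (2 ^+ n * x ord0 i)) => //; rewrite /F /=.
have xk : dyadic_cube n (\row_i Num.floor (2 ^+ n * x ord0 i)) x.
  by move=> i; rewrite mxE.
case: ifPn => // /asboolPn; apply: contra_notP => _ y yk; apply: eA.
rewrite -ball_normE /=; apply/rV_norm_ltP => // i; rewrite !mxE.
apply: lt_trans (dyadic_cube_dist xk yk i) _.
by rewrite -div1r ltr_pdivrMr ?exprn_gt0//; exact: nP.
Qed.

Lemma continuous_measurable_rV (f : E -> R) : continuous f ->
  measurable_fun setT f.
Proof.
move=> cf; apply: (measurability _ (RGenOpens.measurableE R)).
move=> _ [_ [a [b ->] <-]]; rewrite setTI; apply: open_measurable_rV.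
by apply: open_comp => // x _; exact: cf.
Qed.

End BorelRV.

Section LebesgueBoxes.
Context (R : realType).

(** The norm being the sup norm, a ball is a product of intervals; peel off one
    coordinate at a time. *)
Lemma lebesgue_rV_box d (c : 'rV[R]_d) (r : R) : 0 <= r ->
  lebesgue_rV [set x : 'rV[R]_d | `|x - c| <= r] = ((2 * r) ^+ d)%:E.
Proof.
move=> r0; have -> : [set x : 'rV[R]_d | `|x - c| <= r] =
    [set x : 'rV[R]_d | forall i, `|x ord0 i - c ord0 i| <= r].
  by apply/seteqP; split=> x /=; [move/rV_norm_leP|move=> H; apply/rV_norm_leP] => // => [H i|i]; [have := H r0 i|]; rewrite !mxE.
elim: d c => [|d IHd] c.
  by rewrite /= diracE mem_set//= => -[].
rewrite [LHS]/=; pose c0 := c ord0 ord0; pose c' : 'rV[R]_d := rsubmx (c : 'rV_(1 + d)).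
have sec (x : R) : [set y : 'rV[R]_d | forall i, `|rVcons (x, y) ord0 i - c ord0 i| <= r] =
    if x \in `[c0 - r, c0 + r] then [set y : 'rV[R]_d | forall i, `|y ord0 i - c' ord0 i| <= r]
    else set0.
  have x0 (y : 'rV[R]_d) : rVcons (x, y) ord0 ord0 = x.
    rewrite /rVcons /= mxE; case: splitP => // j _; by rewrite mxE.
  have xl (y : 'rV[R]_d) (i : 'I_d) : rVcons (x, y) ord0 (rshift 1 i) = y ord0 i.
    by rewrite /rVcons (@row_mxEr _ 1 1 d).
  have xin : (x \in `[c0 - r, c0 + r]) = (`|x - c0| <= r).
    by rewrite in_itv/= ler_distl.
  rewrite xin; apply/seteqP; split=> [y /= H|y].
    have := H ord0; rewrite x0 => -> i /=.
    by have := H (rshift 1 i); rewrite xl /c' mxE.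
  case: ifP => // xc H i.
  have [j ->|j ->] := @split_ordP 1 d i.
    rewrite (_ : lshift d j = ord0) ?x0//.
    by apply/val_inj; rewrite /= ord1.
  by rewrite xl; have := H j; rewrite /c' mxE.
rewrite (_ : (fun _ => _) = (fun x => ((2 * r) ^+ d)%:E) \_ `[c0 - r, c0 + r]%classic); last first.
  apply/funext => x; rewrite sec /patch mem_setE; case: ifP => // _.
  exact: measure0.
rewrite -integral_mkcond integral_cst//= lebesgue_measure_itv/= lte_fin.
case: ltP => H.
  by rewrite -EFinB -EFinM exprSr; congr ((_ * _)%:E); lra.
have -> : r = 0 by lra.
by rewrite mule0 mulr0 expr0n.
Qed.

(** By uniqueness of the measure that gives every interval its length. *)
Lemma lebesgue_measure_shift (a : R) (A : set (measurableTypeR R)) :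
  measurable A -> lebesgue_measure [set x : R | A (x + a)] = lebesgue_measure A.
Proof.
move=> mA.
have mS : measurable_fun [set: measurableTypeR R] (fun x : measurableTypeR R => x + a : measurableTypeR R).
  exact: measurable_funD.
pose m : {measure set (measurableTypeR R) -> \bar R} :=
  measure_function_pushforward__canonical__measure_function_Measure
    (@lebesgue_measure R) mS.
have := @lebesgue_measure_unique R m; move/(_ _ A mA) => -> // X [[x y] _ <-].
rewrite lebesgue_measure_itv/= /m /= /pushforward.
rewrite (_ : _ @^-1` _ = `]x - a, y - a]%classic); last first.
  by apply/seteqP; split=> z /=; rewrite !in_itv/= ltrBlDr lerBrDr.
rewrite lebesgue_measure_itv/= !lte_fin ltrD2r.
by case: ifP => // _; rewrite -!EFinB; congr (_%:E); lra.
Qed.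

End LebesgueBoxes.

(** * Integrals of continuous functions of bounded support *)

Section IntegralsRV.
Context (R : realType) (d : nat).
Local Notation E := 'rV[R]_d.
Local Notation mu := (@lebesgue_rV R d).
Implicit Types f g : E -> R.

Definition bsupp f := exists M : R, forall x, f x != 0 -> `|x| <= M.

(** All integrands on R^d below are of this kind: they are integrable, and stable
    under the operations of the proof. *)
Definition cont_bsupp f := continuous f /\ bsupp f.

Lemma compact_closed_ball_rV (c : E) (r : R) : compact [set x : E | `|x - c| <= r].
Proof.
apply: bounded_closed_compact.
  exists (`|c| + r); split; first exact: num_real.
  move=> M rM x /= xr; apply: ltW; apply: le_lt_trans rM.
  by rewrite -[x](subrK c) addrC; apply: le_trans (ler_normD _ _) _; rewrite lerD2l.
have -> : [set x : E | `|x - c| <= r] = (fun x => `|x - c|) @^-1` [set x | x <= r] by [].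
apply: closed_comp; last exact: closed_le.
move=> x _; apply: continuous_comp; last exact: norm_continuous.
by apply: continuousB; [exact: id|exact: cst_continuous].
Qed.

Lemma cont_bsupp_integrable f : cont_bsupp f -> mu.-integrable setT (EFin \o f).
Proof.
move=> [cf [M0 fM0]]; pose M := Num.max 0 M0.
have M00 : 0 <= M by rewrite le_max lexx.
pose A := [set x : E | `|x - 0| <= M].
have cA : compact A by exact: compact_closed_ball_rV.
have mA : measurable A.
  rewrite -[A]setCK; apply: measurableC; apply: open_measurable_rV.
  by apply: closed_openC; apply: compact_closed => //; exact: norm_hausdorff.
have -> : EFin \o f = (EFin \o f) \_ A.
  apply/funext => x; rewrite /patch; case: ifPn => //; rewrite notin_setE /A /= => H.
  congr EFin; apply/eqP/negPn/negP => /fM0 xM; apply: H.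
  by rewrite subr0 le_max xM orbT.
apply/(integrable_mkcond _ mA).
apply: measurable_bounded_integrable => //.
- have muA : mu A = ((2 * M) ^+ d)%:E := lebesgue_rV_box 0 M00.
  by rewrite -[X in (X < _)%E]/(mu A) muA ltry.
- by apply: measurable_funTS; exact: continuous_measurable_rV.
- have : compact (f @` A) by apply: continuous_compact => //; exact: continuous_subspaceT.
  move=> /compact_bounded [N [Nr HN]]; exists N; split => // x xN y Ay.
  by apply: (HN x xN); exists y.
Qed.

Lemma cont_bsuppD f g : cont_bsupp f -> cont_bsupp g -> cont_bsupp (fun x => f x + g x).
Proof.
move=> [cf [M fM]] [cg [N gN]]; split; first by move=> x; exact: continuousD (cf x) (cg x).
exists (Num.max M N) => x; rewrite le_max; apply: contraNT.
rewrite negb_or -!ltNge => /andP[xM xN].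
have -> : f x = 0 by apply/eqP/negPn/negP => /fM; rewrite leNgt xM.
have -> : g x = 0 by apply/eqP/negPn/negP => /gN; rewrite leNgt xN.
by rewrite addr0.
Qed.

Lemma cont_bsuppMr f g : cont_bsupp f -> continuous g -> cont_bsupp (fun x => f x * g x).
Proof.
move=> [cf [M fM]] cg; split; first by move=> x; exact: continuousM (cf x) (cg x).
by exists M => x /eqP fg; apply: fM; apply: contra_notN fg => /eqP ->; rewrite mul0r.
Qed.

Lemma cont_bsuppMl f g : continuous f -> cont_bsupp g -> cont_bsupp (fun x => f x * g x).
Proof.
move=> cf cg; have := cont_bsuppMr cg cf; congr cont_bsupp.
by apply/funext => x; rewrite mulrC.
Qed.

Lemma cont_bsuppZ (k : R) f : cont_bsupp f -> cont_bsupp (fun x => k * f x).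
Proof. by apply: cont_bsuppMl => x; exact: cst_continuous. Qed.

Lemma cont_bsupp_affine f (a : R) (b : E) : a != 0 -> cont_bsupp f -> cont_bsupp (fun x => f (a *: x + b)).
Proof.
move=> a0 [cf [M fM]]; split.
  move=> x; apply: (@continuous_comp _ _ _ (fun x : E => a *: x + b)); last exact: cf.
  exact: continuous_affine.
exists ((M + `|b|) / `|a|) => x /fM H.
rewrite ler_pdivlMr ?normr_gt0// mulrC -normrZ -[a *: x](addrK b).
by apply: le_trans (ler_normB _ _) _; rewrite lerD2r.
Qed.

Lemma cont_bsupp_fdiff f (w : E) : cont_bsupp f -> cont_bsupp (fdiff w f).
Proof.
move=> cf; have := cont_bsuppD (cont_bsupp_affine w (oner_neq0 R) cf) (cont_bsuppZ (-1) cf).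
by congr cont_bsupp; apply/funext => x; rewrite scale1r mulN1r.
Qed.

Lemma cont_bsupp_fdiffn n f (w : E) : cont_bsupp f -> cont_bsupp (iter n (fdiff w) f).
Proof. by move=> cf; elim: n => //= n; exact: cont_bsupp_fdiff. Qed.

Lemma cont_bsupp_sum (I : Type) (s : seq I) (f : I -> E -> R) :
  (forall i, cont_bsupp (f i)) -> cont_bsupp (fun x => \sum_(i <- s) f i x).
Proof.
move=> cf; elim: s => [|i s IHs].
  rewrite (_ : (fun _ => _) = fun=> 0).
    split; first exact: cst_continuous.
    by exists 0 => x; rewrite eqxx.
  by apply/funext => x; rewrite big_nil.
have := cont_bsuppD (cf i) IHs; congr cont_bsupp.
by apply/funext => x; rewrite big_cons.
Qed.

Lemma Rintegral_cont_bsupp_sum (I : Type) (s : seq I) (f : I -> E -> R) :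
  (forall i, cont_bsupp (f i)) ->
  \int[mu]_x (\sum_(i <- s) f i x) = \sum_(i <- s) \int[mu]_x f i x.
Proof.
move=> cf; elim: s => [|i s IHs].
  rewrite big_nil (_ : (fun _ => _) = fun=> 0).
    by rewrite Rintegral_cst// mul0r.
  by apply/funext => x; rewrite big_nil.
rewrite big_cons -IHs -RintegralD//; [|exact: cont_bsupp_integrable|exact: cont_bsupp_integrable (cont_bsupp_sum _ _)].
by apply: eq_Rintegral => x _; rewrite big_cons.
Qed.

(** By continuity f exceeds f y / 2 on a box around y, which has positive volume. *)
Lemma cont_bsupp_Rintegral_gt0 f (y : E) : cont_bsupp f -> (forall x, 0 <= f x) -> 0 < f y ->
  0 < \int[mu]_x f x.
Proof.
move=> cf f0 fy; have [cont _] := cf.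
have : \forall x \near y, f y / 2 < f x.
  by apply: (cvgr_gt (f y) (cont y)); lra.
move=> /nbhs_ballP[e /= e0 He].
pose A := [set x : E | `|x - y| <= e / 2].
have mA : measurable A.
  rewrite -[A]setCK; apply: measurableC; apply: open_measurable_rV.
  apply: closed_openC; apply: compact_closed; first exact: norm_hausdorff.
  exact: compact_closed_ball_rV.
rewrite -lte_fin /Rintegral fineK; last first.
  exact: integrable_fin_num (cont_bsupp_integrable cf).
have e20 : 0 <= e / 2 by rewrite divr_ge0 // ltW.
have muA : mu A = ((2 * (e / 2)) ^+ d)%:E := lebesgue_rV_box y e20.
apply: (@lt_le_trans _ _ (\int[mu]_(x in A) (f y / 2)%:E)%E).
  have -> : (\int[mu]_(x in A) (f y / 2)%:E = (f y / 2 * (2 * (e / 2)) ^+ d)%:E)%E.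
    rewrite [RHS](EFinM (f y / 2)) -muA; exact: integral_cst.
  rewrite lte_fin mulr_gt0 ?divr_gt0// exprn_gt0//.
  by rewrite mulr_gt0// divr_gt0.
rewrite [X in (X <= _)%E]integral_mkcond; apply: ge0_le_integral => //.
- by move=> x _; rewrite /patch; case: ifP => // _; rewrite lee_fin divr_ge0 // ltW.
- apply/(measurable_restrictT _ mA); exact: measurable_cst.
- by apply/measurable_EFinP; exact: continuous_measurable_rV.
- move=> x _; rewrite /patch; case: ifPn => [|_]; last by rewrite lee_fin.
  rewrite inE /A /= => xy; rewrite lee_fin ltW//; apply: He.
  rewrite -ball_normE /= distrC; apply: le_lt_trans xy _.
  by rewrite ltr_pdivrMr// ltr_pMr// ltr1n.
Qed.

End IntegralsRV.

Section Translation.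
Context (R : realType) (d : nat).
Local Notation E := 'rV[R]_d.+1.
Local Notation mu := (@lebesgue_rV R d.+1).
Implicit Types (f g : E -> R) (a : R).

Definition e0 : E := delta_mx ord0 ord0.

Lemma e0_neq0 : e0 != 0.
Proof.
apply/eqP => /matrixP/(_ ord0 ord0); rewrite !mxE !eqxx /=.
by apply/eqP; rewrite oner_eq0.
Qed.

Lemma rVcons_e0 a (x : R) (y : 'rV[R]_d) : rVcons (x, y) + a *: e0 = rVcons (x + a, y).
Proof.
apply/rowP => i; rewrite mxE.
have [j ->|j ->] := @split_ordP 1 d i; rewrite /rVcons /=.
  by rewrite (@row_mxEl _ 1 1 d) (@row_mxEl _ 1 1 d) !mxE/= (ord1 j)/= mulr1.
rewrite (@row_mxEr _ 1 1 d) (@row_mxEr _ 1 1 d) !mxE/=.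
by rewrite mulr0 addr0.
Qed.

(** The first coordinate is the outermost variable of the iterated integral that
    defines the measure, so translations in that direction reduce to R. *)
Lemma lebesgue_rV_shift a (A : set E) : measurable A ->
  lebesgue_rV [set x | A (x + a *: e0)] = lebesgue_rV A.
Proof.
move=> mA; rewrite /=.
pose F (x : measurableTypeR R) : \bar R := lebesgue_rV [set y : 'rV[R]_d | A (rVcons (x, y))].
have mF : measurable_fun [set: measurableTypeR R] F.
  have mB : measurable (@rVcons R d @^-1` A).
    by rewrite -[X in measurable X]setTI; exact: measurable_rVcons.
  have := @measurable_fun_xsection _ _ (measurableTypeR R) 'rV[R]_d R
    (@lebesgue_rV R d) _ mB.
  congr (measurable_fun _ _); apply/funext => x /=; congr lebesgue_rV.
  by apply/funext => y; rewrite /xsection /= inE.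
pose sh : measurableTypeR R -> measurableTypeR R := fun x => x + a.
have mS : measurable_fun [set: measurableTypeR R] sh.
  exact: measurable_funD.
transitivity (\int[lebesgue_measure]_x ((F \o sh) x))%E.
  apply: eq_integral => x _ /=; rewrite /F; congr lebesgue_rV.
  by apply/funext => y /=; rewrite rVcons_e0.
rewrite -(@ge0_integral_pushforward _ _ _ _ _ _ mS (@lebesgue_measure R) setT F)//.
apply: eq_measure_integral => B mB _; exact: lebesgue_measure_shift.
Qed.

Lemma Rintegral_shift a f : cont_bsupp f ->
  \int[mu]_x f (x + a *: e0) = \int[mu]_x f x.
Proof.
move=> cf; rewrite /Rintegral; congr fine.
pose sh : E -> E := fun x => x + a *: e0.
have mS : measurable_fun [set: E] sh.
  apply: measurable_fun_rVP => i.
  rewrite (_ : (fun _ => _) = (fun x : E => x ord0 i + (a *: e0) ord0 i)).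
    by apply: measurable_funD => //; exact: measurable_rV_coord.
  by apply/funext => x; rewrite mxE.
have cf1 : cont_bsupp (f \o sh).
  have := cont_bsupp_affine (a *: e0) (oner_neq0 R) cf; congr cont_bsupp.
  by apply/funext => x /=; rewrite scale1r.
transitivity (\int[pushforward mu sh]_x (f x)%:E)%E.
  rewrite (@integral_pushforward _ _ _ _ _ _ mS mu setT (EFin \o f))//=.
    by apply/measurable_EFinP; apply: continuous_measurable_rV; have [] := cf.
  exact: cont_bsupp_integrable cf1.
apply: eq_measure_integral => B mB _; exact: lebesgue_rV_shift.
Qed.

(** Summation by parts. It takes the place of integration by parts and rests on
    translation invariance alone. *)
Lemma Rintegral_fdiff a f g : cont_bsupp f -> cont_bsupp g ->
  \int[mu]_x (fdiff (a *: e0) f x * g x) = \int[mu]_x (f x * fdiff (- a *: e0) g x).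
Proof.
move=> cf cg.
have cfa : cont_bsupp (fun x => f (x + a *: e0)).
  have := cont_bsupp_affine (a *: e0) (oner_neq0 R) cf; congr cont_bsupp.
  by apply/funext => x /=; rewrite scale1r.
have cga : cont_bsupp (fun x => g (x + - a *: e0)).
  have := cont_bsupp_affine (- a *: e0) (oner_neq0 R) cg; congr cont_bsupp.
  by apply/funext => x /=; rewrite scale1r.
have [cf0 _] := cf; have [cg0 _] := cg.
transitivity (\int[mu]_x (f (x + a *: e0) * g x) - \int[mu]_x (f x * g x)).
  rewrite -RintegralB//.
  - by apply: eq_Rintegral => x _; rewrite /fdiff mulrBl.
  - exact/cont_bsupp_integrable/cont_bsuppMr.
  - exact/cont_bsupp_integrable/cont_bsuppMr.
rewrite -(@Rintegral_shift (- a)); last exact: cont_bsuppMr.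
rewrite -RintegralB//.
- by apply: eq_Rintegral => x _; rewrite /fdiff mulrBr scaleNr subrK.
- rewrite (_ : (fun _ => _) = (fun x => f x * g (x + - a *: e0))).
    exact/cont_bsupp_integrable/cont_bsuppMl.
  by apply/funext => x; rewrite scaleNr subrK.
- exact/cont_bsupp_integrable/cont_bsuppMr.
Qed.

Lemma Rintegral_fdiffn n a f g : cont_bsupp f -> cont_bsupp g ->
  \int[mu]_x (iter n (fdiff (a *: e0)) f x * g x) =
  \int[mu]_x (f x * iter n (fdiff (- a *: e0)) g x).
Proof.
move=> cf; elim: n g => //= n IHn g cg.
rewrite Rintegral_fdiff//; last exact: cont_bsupp_fdiffn.
rewrite IHn; last exact: cont_bsupp_fdiff.
by apply: eq_Rintegral => x _; rewrite -iterSr.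
Qed.

End Translation.

(** * The dyadic tree *)

Section DyadicTree.
Context (d : nat).
Local Notation Zd := 'rV[int]_d.

Definition child (p : Zd) (b : {ffun 'I_d -> bool}) : Zd :=
  \row_i (p ord0 i * 2 + (b i : nat)%:Z).

Lemma parent_child p b : parent (child p b) = p.
Proof.
apply/rowP => i; rewrite !mxE divzMDl//.
by case: (b i); rewrite ?divz0 ?addr0// divz_small ?addr0.
Qed.

Lemma child_parent k : exists b, k = child (parent k) b.
Proof.
exists [ffun i => (k ord0 i %% 2)%Z != 0]; apply/rowP => i; rewrite !mxE ffunE.
rewrite {1}(divz_eq (k ord0 i) 2); congr (_ + _).
have : (0 <= k ord0 i %% 2)%Z by rewrite modz_ge0.
have : ((k ord0 i %% 2)%Z < 2) by rewrite ltz_pmod.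
by case: (k ord0 i %% 2)%Z => [[|[|]]|].
Qed.

Lemma child_inj p : injective (child p).
Proof.
move=> b b' /rowP bb'; apply/ffunP => i; have := bb' i; rewrite !mxE => /addrI.
by case: (b i); case: (b' i).
Qed.

(** The tree is rooted at 0, so that every sum over its level j runs over this
    finite list. *)
Fixpoint nodes (j : nat) : seq Zd :=
  if j is j'.+1 then
    [seq child p b | p <- nodes j', b <- enum {ffun 'I_d -> bool}]
  else [:: 0].

Lemma mem_nodesS j k : (k \in nodes j.+1) = (parent k \in nodes j).
Proof.
apply/allpairsP/idP => [[[p b] [/= pj _ ->]]|kj]; first by rewrite parent_child.
have [b kE] := child_parent k.
by exists (parent k, b); rewrite mem_enum.
Qed.

Lemma uniq_nodes j : uniq (nodes j).
Proof.
elim: j => //= j IHj; apply: allpairs_uniq => //; first exact: enum_uniq.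
move=> [p b] [p' b'] _ _ /= e; have pp' : p = p' by rewrite -(parent_child p b) e parent_child.
by congr (_, _) => //; apply: (@child_inj p); rewrite e pp'.
Qed.

Lemma size_nodes j : size (nodes j) = (2 ^ (d * j))%N.
Proof.
elim: j => [|j IHj]; first by rewrite muln0.
rewrite size_allpairs IHj -cardE card_ffun card_bool card_ord -expnD.
by rewrite mulnS addnC.
Qed.

Lemma big_nodesS (R : Type) (idx : R) (op : Monoid.com_law idx) j (F : Zd -> R) :
  \big[op/idx]_(k <- nodes j.+1) F k =
  \big[op/idx]_(p <- nodes j) \big[op/idx]_(b : {ffun 'I_d -> bool}) F (child p b).
Proof.
by rewrite big_allpairs_dep; apply: eq_bigr => p _; rewrite big_enum.
Qed.

Lemma nodes_bounds j k : k \in nodes j -> forall i, 0 <= k ord0 i < 2 ^+ j.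
Proof.
elim: j k => [|j IHj] k.
  by rewrite inE => /eqP -> i; rewrite mxE expr0.
rewrite mem_nodesS => /IHj H i; have := H i; rewrite mxE exprSr => /andP[k0 k1].
rewrite {1 2}(divz_eq (k ord0 i) 2).
have : (0 <= k ord0 i %% 2)%Z by rewrite modz_ge0.
have : ((k ord0 i %% 2)%Z < 2) by rewrite ltz_pmod.
move: k0 k1; set q := (k ord0 i %/ 2)%Z; set m := (k ord0 i %% 2)%Z.
move: (2 ^+ j) => N; lia.
Qed.

End DyadicTree.

Section TreeGeometry.
Context (R : realType) (d : nat) (beta : R) (t : nat -> 'rV[int]_d -> R).
Local Notation E := 'rV[R]_d.
Local Notation Zd := 'rV[int]_d.

Lemma level_nodes j k : level beta t j k -> k \in nodes d j.
Proof.
elim: j k => [|j IHj] k /=; first by move=> ->; rewrite inE.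
by move=> [/IHj + _]; rewrite mem_nodesS.
Qed.

Lemma Q_parent j k (y : E) : Q j.+1 k y -> Q j (parent k) y.
Proof.
move=> [yD yk]; split=> // i; rewrite mxE -yk.
have := floor_itv (2 ^+ j.+1 * y ord0 i); set m := Num.floor _.
move=> /andP[m1 m2]; apply: floor_def.
have mE := divz_eq m 2.
have m0 : (0 <= m %% 2)%Z by rewrite modz_ge0.
have m3 : ((m %% 2)%Z < 2) by rewrite ltz_pmod.
have : (m%:~R : R) = (m %/ 2)%Z%:~R * 2 + (m %% 2)%Z%:~R.
  by rewrite {1}mE intrD intrM.
have : (0 : R) <= (m %% 2)%Z%:~R by rewrite ler0z.
have : ((m %% 2)%Z%:~R : R) <= 1.
  by rewrite -[leRHS]/(1%:~R) ler_int; move: m3; case: (m %% 2)%Z => // -[|[|]].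
move: m1 m2; rewrite !intrD exprS => *; apply/andP; split; lra.
Qed.

(** Going up to the parent enlarges the cube. *)
Lemma level_Q i j k (y : E) : level beta t (i + j) k -> Q (i + j) k y ->
  exists2 k', level beta t j k' & Q j k' y.
Proof.
elim: i k => [|i IHi] k; first by exists k.
by move=> /= [kp _] /Q_parent; exact: IHi.
Qed.

Lemma nodes_Q j k : k \in nodes d j -> Q j k ((2 ^- j : R) *: intv R k).
Proof.
move=> /nodes_bounds kj; have c2 : 0 < (2 : R) ^+ j by rewrite exprn_gt0.
split=> i; rewrite !mxE.
  have /andP[k0 k1] := kj i.
  rewrite mulr_ge0 ?invr_ge0 ?ler0z ?(ltW c2)//= mulrC ler_pdivrMr// mul1r.
  have : ((k ord0 i)%:~R : R) <= (2 ^+ j)%:~R by rewrite ler_int ltW.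
  by rewrite rmorphXn.
by rewrite mulrA divff ?gt_eqF// mul1r intrKfloor.
Qed.

Lemma closure_Q_dist j k (x : E) : closure (Q j k) x ->
  `|x - 2 ^- j *: intv R k| <= 2 ^- j.
Proof.
have c2 : 0 < (2 : R) ^+ j by rewrite exprn_gt0.
have i2 : 0 <= (2 : R) ^- j by rewrite invr_ge0 ltW.
pose A := [set y : E | `|y - 2 ^- j *: intv R k| <= 2 ^- j].
have /closure_id AE : closed A.
  by apply: compact_closed; [exact: norm_hausdorff|exact: compact_closed_ball_rV].
suff : Q j k `<=` A by move=> /closureS; rewrite -AE; exact.
move=> y [_ yk] /=; apply/rV_norm_leP => // i; rewrite !mxE -yk.
have /andP[f1 f2] := floor_itv (2 ^+ j * y ord0 i).
rewrite -(@ler_pM2l _ (2 ^+ j))// divff ?gt_eqF// -{1}(gtr0_norm c2) -normrM mulrBr.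
rewrite mulrA divff ?gt_eqF// mul1r ger0_norm ?subr_ge0//.
by rewrite lerBlDr; apply: ltW; rewrite intrD addrC in f2.
Qed.

Lemma closure_Q_unit_cube j k (x : E) : closure (Q j k) x -> unit_cube x.
Proof.
move=> xQ i.
pose A := (fun y : E => y ord0 i) @^-1` `[0, 1]%classic.
have /closure_id AE : closed A.
  apply: closed_comp; last exact: interval_closed.
  by move=> y _; exact: coord_continuous.
suff : Q j k `<=` A by move=> /closureS /(_ _ xQ); rewrite -AE /A /= in_itv.
by move=> y [/(_ i) + _]; rewrite /A /= in_itv.
Qed.

End TreeGeometry.

(** * The series away from tau *)

Section WaveletSeries.
Context (R : realType) (d r : nat) (s p : R) (phi : 'rV[R]_d -> R)
  (Psi : 'I_(2 ^ d - 1) -> 'rV[R]_d -> R) (beta : R)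
  (t : nat -> 'rV[int]_d -> R)
  (X : nat -> 'rV[int]_d -> 'I_(2 ^ d - 1) -> R).
Local Notation E := 'rV[R]_d.
Local Notation Zd := 'rV[int]_d.
Local Notation mu := (@lebesgue_rV R d).
Local Notation T := (tree beta t).
Local Notation F := (random_wseries s p T X).
Hypothesis CPsi : forall l, Cn r setT (Psi l).
Hypothesis sPsi : forall l, compactly_supported_in setT (Psi l).

Lemma coef_random_notin j k l : k \notin nodes d j -> coef_mother F j k l = 0.
Proof. by move=> kj; rewrite /= asboolF// => /level_nodes; apply/negP. Qed.

Lemma partial_sumE J x : partial_sum phi Psi F J x =
  \sum_(j < J) \sum_(k <- nodes d j) \sum_l
    coef_mother F j k l * mother Psi j k l x.
Proof.
rewrite /partial_sum fsbig1 ?add0r; last by move=> k _; rewrite /= mul0r.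
apply: eq_bigr => j _; rewrite (fsbigE (nodes d j)).
- by apply: eq_bigl => k; rewrite in_setT.
- exact: uniq_nodes.
- by [].
- move=> k _ kj; apply: big1 => l _.
  by rewrite coef_random_notin// mul0r.
Qed.

Lemma Cn_mother n j k l : Cn n setT (Psi l) -> Cn n setT (mother Psi j k l).
Proof.
move=> C; apply: CnM; [exact: openT|exact: Cn_cst openT|].
have := Cn_affine (2 ^+ j) (- intv R k) C; apply: eq_Cn => //; exact: openT.
Qed.

Lemma Cn_partial_sum J : Cn r setT (partial_sum phi Psi F J).
Proof.
have -> : partial_sum phi Psi F J = fun x => \sum_(j < J) \sum_(k <- nodes d j) \sum_l
    coef_mother F j k l * mother Psi j k l x.
  by apply/funext => x; exact: partial_sumE.
apply: Cn_sum => [|j]; first exact: openT.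
apply: Cn_sum => [|k]; first exact: openT.
apply: Cn_sum => [|l]; first exact: openT.
by apply: CnM; [exact: openT|exact: Cn_cst openT|exact: Cn_mother].
Qed.

(** One radius serves all the mother wavelets, there being finitely many. *)
Lemma bsuppPsi : exists M : R, forall l x, Psi l x != 0 -> `|x| <= M.
Proof.
have H l : exists M : R, forall x, Psi l x != 0 -> `|x| <= M.
  have [K [cK _ PK]] := sPsi l.
  have /compact_bounded [N [Nr HN]] := cK.
  exists (N + 1) => x Px; apply: (HN (N + 1)); first by rewrite ltrDl.
  by apply: contrapT => /PK /eqP; rewrite (negbTE Px).
have [M HM] := choice H.
exists (\big[Num.max/0]_l M l) => l x /HM xM.
by apply: le_trans xM _; exact: le_bigmax.
Qed.

Lemma mother_supp : exists M : R, forall j k l x,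
  mother Psi j k l x != 0 -> `|x - 2 ^- j *: intv R k| <= M / 2 ^+ j.
Proof.
have [M HM] := bsuppPsi; exists M => j k l x.
have c2 : 0 < (2 : R) ^+ j by rewrite exprn_gt0.
rewrite /mother mulf_eq0 negb_or => /andP[_ /HM].
rewrite ler_pdivlMr// mulrC -{2}(gtr0_norm c2) -normrZ scalerBr scalerA divff ?gt_eqF//.
by rewrite scale1r.
Qed.

(** Off tau some level j has all its closed cubes away from x. The cubes of later
    levels lie inside those of level j, and wavelets of high level have small
    supports, so near x only finitely many C^r terms of the series are present. *)
Lemma singsupp_subset_tau : singsupp phi Psi r F `<=` tau R T.
Proof.
move=> x [xD xs]; apply: contrapT => xtau; apply: xs.
have [j j1 xj] : exists2 j, (1 <= j)%N & forall k, T (j, k) -> ~ closure (Q j k) x.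
  apply: contra_notP xtau => H j /= j1.
  apply: contrapT => Hj; apply: H; exists j => // k Tk xQ; apply: Hj.
  by exists k.
have near_x : exists2 e : R, 0 < e & forall k, T (j, k) -> forall y, `|x - y| < e -> ~ Q j k y.
  have : forall s : seq Zd, exists2 e : R, 0 < e & forall k, k \in s -> T (j, k) -> forall y, `|x - y| < e -> ~ Q j k y.
    elim => [|k sq [e e0 IH]]; first by exists 1.
    have [Tk|Tk] := pselect (T (j, k)); last first.
      by exists e => // k'; rewrite inE => /orP[/eqP ->//|]; exact: IH.
    have := xj _ Tk; move=> /existsNP[B /not_implyP[xB /nonemptyPn QB]].
    have /nbhs_ballP[e' /= e'0 He'] := xB.
    exists (Num.min e e'); first by rewrite lt_min e0.
    move=> k'; rewrite inE => /orP[/eqP -> _ y|k's Tk' y]; rewrite lt_min => /andP[xy xy'].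
      have By : B y by apply: He'; rewrite -ball_normE.
      by move=> Qy; have : (Q j k `&` B) y by []; rewrite QB.
    exact: IH Tk' _ xy.
  move=> /(_ (nodes d j)) [e e0 He]; exists e => // k Tk; apply: He => //.
  exact: level_nodes Tk.
have [e e0 He] := near_x.
have [M HM] := mother_supp.
have e20 : 0 < e / 2 by rewrite divr_gt0.
have [J0 HJ0] := lt_mul_pow2 M e20.
(* wavelets of level J1 on have supports of size at most e / 2 *)
pose J1 := maxn j J0.
have vanish J k l y : (J1 <= J)%N -> T (J, k) -> `|x - y| < e / 2 -> mother Psi J k l y = 0.
  rewrite geq_max => /andP[jJ J0J] Tk xy; apply/eqP/negPn/negP => /HM.
  have {}Tk : level beta t J k := Tk.
  have kJ := level_nodes Tk.
  have QJ := nodes_Q R kJ.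
  have [k' Tk' Qk'] : exists2 k', level beta t j k' & Q j k' (2 ^- J *: intv R k).
    have := @level_Q _ _ beta t (J - j) j k (2 ^- J *: intv R k).
    by rewrite subnK//; apply.
  have := He k' Tk' (2 ^- J *: intv R k) => H.
  apply/negP; rewrite -ltNge.
  have {}H : e <= `|x - 2 ^- J *: intv R k|.
    by rewrite leNgt; apply/negP => /H; exact.
  have : M / 2 ^+ J < e / 2.
    by rewrite ltr_pdivrMr ?exprn_gt0//; exact: HJ0.
  have := ler_distD y x (2 ^- J *: intv R k).
  move: H xy; lra.
exists (ball x (e / 2)); split.
- exact: ball_open.
- exact: ballxx.
exists (partial_sum phi Psi F J1); split.
  exact: CnS (Cn_partial_sum J1).
move=> theta [_ [K [_ KU K0]]].
apply: cvg_near_cst; exists J1 => // J /= J1J.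
apply: eq_Rintegral => y _.
have [Ky|/K0 ->] := pselect (K y); last by rewrite !mulr0.
congr (_ * _); rewrite !partial_sumE -(subnKC J1J) big_split_ord /=.
rewrite [X in _ + X]big1 ?addr0// => i _.
apply: big1 => k _; apply: big1 => l _.
have [Tk|Tk] := pselect (T ((J1 + i)%N, k)).
  rewrite vanish ?mulr0//; first exact: leq_addr.
  by have := KU _ Ky; rewrite -ball_normE.
by rewrite asboolF// mul0r.
Qed.

Lemma tau_unit_cube : tau R T `<=` @unit_cube R d.
Proof. by move=> x /(_ 1%N (leqnn _)) [k _]; exact: closure_Q_unit_cube. Qed.

End WaveletSeries.

(** * Probes: differences of bumps *)

Section Probe.
Context (R : realType) (d r : nat).
Local Notation E := 'rV[R]_d.+1.
Local Notation Zd := 'rV[int]_d.+1.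
Local Notation mu := (@lebesgue_rV R d.+1).
Local Notation e0 := (@e0 R d).

Lemma eq_fdiffn n (w : E) (f g : E -> R) x :
  (forall k, (k <= n)%N -> f (x + k%:R *: w) = g (x + k%:R *: w)) ->
  iter n (fdiff w) f x = iter n (fdiff w) g x.
Proof.
elim: n x => [|n IHn] x fg /=.
  by have := fg 0%N (leqnn _); rewrite scale0r addr0.
rewrite /fdiff !IHn// => k kn; first by apply: fg; exact: leqW.
by rewrite -addrA -{1 3}[w]scale1r -scalerDl nat1r; apply: fg.
Qed.

Lemma norm_e0 : `|e0| <= 1.
Proof.
apply/rV_norm_leP => // i; rewrite mxE.
by case: (_ && _); rewrite ?normr1 ?normr0.
Qed.

(** Take a bump supported where F keeps the sign that it has at y. *)
Lemma exists_probe (F : E -> R) y : continuous F -> F y != 0 ->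
  exists (theta : E -> R) (c sg : R),
  [/\ forall n, Cn n setT theta, cont_bsupp theta, forall x, 0 <= theta x, 0 < theta y &
      [/\ 0 < c, `|sg| = 1 & forall x, theta x != 0 -> c <= sg * F x]].
Proof.
move=> cF Fy; pose sg := Num.sg (F y).
have sgF : sg * F y = `|F y| by rewrite /sg -normrEsg.
have c0 : 0 < `|F y| by rewrite normr_gt0.
have : \forall x \near y, `|F y| / 2 < sg * F x.
  have cn : {for y, continuous (fun x => sg * F x)}.
    exact: (@continuousM _ _ (fun=> sg) F y (@cst_continuous _ _ sg y) (cF y)).
  apply: (cvgr_gt (sg * F y) cn).
  by rewrite sgF; lra.
move=> /nbhs_ballP[e /= ep He].
have [theta [C1 t0 ty ts]] := exists_bump y ep.
exists theta, (`|F y| / 2), sg; split=> //.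
  split; first by move=> x; exact: (Cn_continuous (C1 0%N)).
  exists (`|y| + e) => x /ts xy; rewrite -[x](subrK y) addrC.
  by apply: le_trans (ler_normD _ _) _; rewrite lerD2l ltW.
split; first by rewrite divr_gt0.
  by rewrite /sg normr_sg Fy.
move=> x /ts xy; apply/ltW/He; by rewrite -ball_normE /= distrC.
Qed.

Section Probing.
Variables (theta : E -> R).
Hypothesis Ctheta : forall n, Cn n setT theta.
Hypothesis theta_cont_bsupp : cont_bsupp theta.
Hypothesis theta0 : forall x, 0 <= theta x.

(** Test functions that measure C^r regularity at scale 2^-j around the node. The
    differences cost a function of class C^r a factor 2^(-jr), whereas against the
    wavelet of the same node they only produce its r-th difference of step 1. *)
Definition probe (j : nat) (k : Zd) (x : E) : R :=
  iter r (fdiff (- e0)) theta (2 ^+ j *: x - intv R k).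

(** The unit in which the pairings with a probe are measured. The upper and the
    lower bound below are both multiples of it, so its value cancels and no
    change of variables is ever made. *)
Definition mass (j : nat) (k : Zd) : R :=
  \int[mu]_x theta (2 ^+ j *: x - intv R k).

Lemma pow2_neq0 j : (2 : R) ^+ j != 0. Proof. by rewrite expf_neq0. Qed.

Lemma mass_gt0 j k : (exists y, 0 < theta y) -> 0 < mass j k.
Proof.
move=> [y ty].
apply: (@cont_bsupp_Rintegral_gt0 _ _ _ (2 ^- j *: (y + intv R k))) => //.
  exact: cont_bsupp_affine (pow2_neq0 j) theta_cont_bsupp.
by rewrite scalerA divff ?pow2_neq0// scale1r addrK.
Qed.

Lemma cont_bsupp_probe j k : cont_bsupp (probe j k).
Proof. by apply: cont_bsupp_affine (pow2_neq0 j) _; exact: cont_bsupp_fdiffn. Qed.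

Lemma Rintegral_probe (f : E -> R) j k : cont_bsupp f ->
  \int[mu]_x (f x * probe j k x) =
  \int[mu]_x (iter r (fdiff (2 ^- j *: e0)) f x * theta (2 ^+ j *: x - intv R k)).
Proof.
move=> cf; rewrite (@Rintegral_fdiffn _ _ r (2 ^- j) f (fun x => theta (2 ^+ j *: x - intv R k)))//.
  apply: eq_Rintegral => x _; rewrite fdiffn_affine scalerA mulrN divff ?pow2_neq0//.
  by rewrite scaleN1r.
exact: cont_bsupp_affine (pow2_neq0 j) theta_cont_bsupp.
Qed.

(** Once the differences are moved to the wavelet, the integrand has constant sign
    on the support of theta. *)
Lemma Rintegral_scaled_probe (f : E -> R) (c sg : R) j k : cont_bsupp f -> `|sg| = 1 ->
  (forall x, theta x != 0 -> c <= sg * iter r (fdiff e0) f x) ->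
  c * mass j k <= `|\int[mu]_x (f (2 ^+ j *: x - intv R k) * probe j k x)|.
Proof.
move=> cf sg1 H.
have cfj : cont_bsupp (fun x => f (2 ^+ j *: x - intv R k)) by exact: cont_bsupp_affine (pow2_neq0 j) cf.
have ct : cont_bsupp (fun x => theta (2 ^+ j *: x - intv R k)) by exact: cont_bsupp_affine (pow2_neq0 j) theta_cont_bsupp.
rewrite Rintegral_probe//; set I := Rintegral _ _ _.
have -> : `|I| = `|sg * I| by rewrite normrM sg1 mul1r.
apply: le_trans (ler_norm _); rewrite {}/I.
have cf2 : cont_bsupp (fun x => iter r (fdiff (2 ^- j *: e0)) (fun x => f (2 ^+ j *: x - intv R k)) x *
   theta (2 ^+ j *: x - intv R k)).
  apply: cont_bsuppMl => //; first by have [] := cont_bsupp_fdiffn r (2 ^- j *: e0) cfj.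
rewrite -!RintegralZl//; do ?exact: cont_bsupp_integrable.
apply: le_Rintegral => //.
- exact/cont_bsupp_integrable/cont_bsuppZ.
- exact/cont_bsupp_integrable/cont_bsuppZ.
move=> x _; rewrite fdiffn_affine scalerA divff ?pow2_neq0// scale1r mulrA.
set z := (_ *: x - _).
have [->|tz] := eqVneq (theta z) 0; first by rewrite !mulr0.
by rewrite ler_wpM2r//; exact: H.
Qed.

Lemma probe_supp : exists2 M : R, 0 <= M & forall j k x,
  (forall s, 0 <= s <= r%:R * 2 ^- j -> theta (2 ^+ j *: x - intv R k) != 0 ->
     `|s *: e0 + x - 2 ^- j *: intv R k| <= M / 2 ^+ j) /\
  (probe j k x != 0 -> `|x - 2 ^- j *: intv R k| <= M / 2 ^+ j).
Proof.
have [_ [M0 HM0]] := theta_cont_bsupp; exists (Num.max 0 M0 + r%:R).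
  by rewrite addr_ge0// le_max lexx.
have tM z : theta z != 0 -> `|z| <= Num.max 0 M0.
  by move=> /HM0 zM; rewrite le_max zM orbT.
move=> j k x; have c2 : 0 < (2 : R) ^+ j by rewrite exprn_gt0.
have E1 z : `|z - 2 ^- j *: intv R k| * 2 ^+ j = `|2 ^+ j *: z - intv R k|.
  by rewrite mulrC -{1}(gtr0_norm c2) -normrZ scalerBr scalerA divff ?gt_eqF// scale1r.
split.
  move=> s0 /andP[s1 s2] /tM H; rewrite ler_pdivlMr// E1.
  rewrite scalerDr scalerA -addrA addrC; apply: le_trans (ler_normD _ _) _.
  rewrite lerD// normrZ -[leRHS]mulr1; apply: ler_pM => //; last exact: norm_e0.
  rewrite ger0_norm ?mulr_ge0 ?(ltW c2)//.
  by rewrite mulrC -ler_pdivlMr.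
rewrite ler_pdivlMr// E1; apply: contraNT; rewrite -ltNge => H; apply/eqP.
apply: (@fdiffn_eq0 _ _ r (- e0) theta [set z | `|z| <= Num.max 0 M0]) => // i ir /=.
apply/negP; rewrite -ltNge; apply: (lt_le_trans _ (lerB_normD _ _)).
rewrite ltrBrDr; apply: le_lt_trans H; rewrite lerD2l normrZ normrN normr_nat.
rewrite -[leRHS]mulr1; apply: ler_pM => //; last exact: norm_e0.
by rewrite ler_nat.
Qed.

Lemma continuous_dist_rV (x0 : E) : continuous (fun z : E => `|z - x0|).
Proof.
move=> z; apply: continuous_comp; last exact: norm_continuous.
by apply: continuousB; [exact: id|exact: cst_continuous].
Qed.

(** The integral of g against a function supported near x0 is the integral of f
    against it, and f is globally integrable. *)
Lemma cutoff (g : E -> R) (x0 : E) (e : R) : 0 < e ->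
  (forall x, `|x - x0| < e -> {for x, continuous g}) ->
  exists2 f : E -> R, cont_bsupp f & forall x, `|x - x0| <= e / 2 -> f x = g x.
Proof.
move=> ep cg.
(* equal to 1 on the ball of radius e / 2, to 0 off that of radius 3 e / 4 *)
pose chi (z : E) : R := Num.min 1 (Num.max 0 (3 + - (4 / e) * `|z - x0|)).
have cchi : continuous chi.
  have c1 : continuous (fun z : E => 3 + - (4 / e) * `|z - x0|).
    move=> z; have c0 := @cst_continuous E R.
    exact: (continuousD (c0 3 z) (continuousM (c0 (- (4 / e)) z)
      (@continuous_dist_rV x0 z))).
  move=> z; have c0 := @cst_continuous E R.
  exact: (continuous_min (c0 1 z) (continuous_max (c0 0 z) (c1 z))).
have chi0 z : 3 / 4 * e <= `|z - x0| -> chi z = 0.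
  move=> H; rewrite /chi (_ : Num.max _ _ = 0).
    by apply/min_idPr.
  apply/max_idPl; rewrite mulNr subr_le0 -(@ler_pM2r _ e)// mulrAC divfK ?gt_eqF//.
  by move: H; lra.
exists (fun z => chi z * g z).
  split.
    move=> z; have [ze|ze] := ltP `|z - x0| e.
      exact: (continuousM (cchi z) (cg _ ze)).
    have nz : \forall y \near z, chi y * g y = 0.
      have : \forall y \near z, 3 / 4 * e < `|y - x0|.
        apply: (cvgr_gt `|z - x0| (@continuous_dist_rV x0 z)).
        by apply: lt_le_trans ze; rewrite gtr_pMl// ltr_pdivrMr// mul1r ltr_nat.
      by apply: filterS => y /ltW /chi0 ->; rewrite mul0r.
    rewrite /prop_for /continuous_at /= (nbhs_singleton nz).
    exact: (@cvg_near_cst _ _ _ _ (nbhs z)).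
  exists (`|x0| + e) => z.
  have [H|H] := leP (3 / 4 * e) `|z - x0|; first by rewrite chi0// mul0r eqxx.
  move=> _; rewrite -[z](subrK x0) addrC.
  apply: le_trans (ler_normD _ _) _; rewrite lerD2l; apply: le_trans (ltW H) _.
  by rewrite ger_pMl// ler_pdivrMr// mul1r ler_nat.
move=> z H; rewrite /chi (_ : Num.min _ _ = 1) ?mul1r//.
apply/min_idPl; rewrite le_max; apply/orP; right.
rewrite mulNr lerBrDr -lerBrDl -(@ler_pM2r _ e)// mulrAC divfK ?gt_eqF//.
by move: H; rewrite ler_pdivlMr//; lra.
Qed.

(** Moving the differences to g, each of them costs a factor 2^-j by the mean value
    theorem, and the r-th derivative of g is bounded near x0. *)
Lemma Rintegral_probe_Cn (g : E -> R) (U : set E) (x0 : E) :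
  open U -> U x0 -> Cn r U g ->
  exists C rho : R, exists j1 : nat, [/\ 0 < C, 0 < rho & forall j k,
    (j1 <= j)%N -> `|x0 - 2 ^- j *: intv R k| <= rho ->
    test_function U (probe j k) /\
    `|\int[mu]_x (g x * probe j k x)| <= C * 2 ^- (j * r) * mass j k].
Proof.
move=> oU Ux0 Cg.
pose D n (f : E -> R) := iter n (fun f x => 'D_e0 f x) f.
have DC n : (n <= r)%N -> Cn (r - n) U (D n g) by move=> nr; exact: Cn_iter_derive.
pose C := `|D r g x0| + 1.
have C0 : 0 < C by rewrite ltr_pwDr.
have : \forall x \near x0, U x /\ `|D r g x| < C.
  have nU : nbhs x0 U by exact: open_nbhs_nbhs.
  have cD : {for x0, continuous (D r g)}.
    by apply: Cn_continuous Ux0; have := DC r (leqnn r); exact.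
  apply: filterI => //.
  have cn : {for x0, continuous (fun x => `|D r g x|)}.
    exact: (continuous_comp cD (@norm_continuous _ _ _)).
  apply: (cvgr_lt `|D r g x0| cn).
  by rewrite /C ltrDl.
move=> /nbhs_ballP[e /= ep He].
have Be z : `|z - x0| < e -> U z /\ `|D r g z| < C.
  by move=> H; apply: He; rewrite -ball_normE /= distrC.
have [f cf fg] : exists2 f : E -> R, cont_bsupp f & forall x, `|x - x0| <= e / 2 -> f x = g x.
  apply: cutoff => // x /Be[Ux _]; exact: Cn_continuous Cg x Ux.
have [M M0 HM] := probe_supp.
have [j1 Hj1] := @lt_mul_pow2 R M (e / 4) ltac:(by rewrite divr_gt0).
exists C, (e / 4), j1; split=> //; first by rewrite divr_gt0.
move=> j k jj kx.
have c2 : 0 < (2 : R) ^+ j by rewrite exprn_gt0.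
have Me : M / 2 ^+ j < e / 4 by rewrite ltr_pdivrMr//; exact: Hj1.
have close z : `|z - 2 ^- j *: intv R k| <= M / 2 ^+ j -> `|z - x0| <= e / 2.
  move=> H; have := ler_distD (2 ^- j *: intv R k) z x0.
  by move: kx H Me; rewrite [X in X <= e / 4]distrC; lra.
have e2e : e / 2 < e by rewrite ltr_pdivrMr// ltr_pMr// ltr1n.
have [_ Hp] := (fun x => (HM j k x).1, fun x => (HM j k x).2).
split.
  split.
    by move=> n; apply: Cn_affine; exact: Cn_fdiffn.
  exists [set z | `|z - 2 ^- j *: intv R k| <= M / 2 ^+ j]; split.
  - exact: compact_closed_ball_rV.
  - by move=> z /= /close zx; have [] := Be z (le_lt_trans zx e2e).
  - move=> z /= Hz; apply/eqP/negPn/negP => /Hp; exact: Hz.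
have -> : \int[mu]_x (g x * probe j k x) = \int[mu]_x (f x * probe j k x).
  apply: eq_Rintegral => x _; have [->|px] := eqVneq (probe j k x) 0.
    by rewrite !mulr0.
  by rewrite fg//; apply: close; exact: Hp.
rewrite Rintegral_probe//.
have ct : cont_bsupp (fun x => theta (2 ^+ j *: x - intv R k)) by exact: cont_bsupp_affine (pow2_neq0 j) theta_cont_bsupp.
have cff : cont_bsupp (fun x => iter r (fdiff (2 ^- j *: e0)) f x * theta (2 ^+ j *: x - intv R k)).
  by apply: cont_bsuppMl => //; have [] := cont_bsupp_fdiffn r (2 ^- j *: e0) cf.
apply: le_trans (le_normr_Rintegral _ _) _ => //; first exact: cont_bsupp_integrable.
rewrite -RintegralZl//; last exact: cont_bsupp_integrable.
apply: le_Rintegral => //.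
- by apply: (@integrable_abse _ _ _ mu _ (EFin \o _)); exact: cont_bsupp_integrable.
- exact/cont_bsupp_integrable/cont_bsuppZ.
move=> x _; rewrite normrM (ger0_norm (theta0 _)).
have [->|tx] := eqVneq (theta (2 ^+ j *: x - intv R k)) 0; first by rewrite !mulr0.
rewrite ler_wpM2r//.
have Hs s : 0 <= s <= r%:R * 2 ^- j -> `|s *: e0 + x - x0| <= e / 2.
  by move=> sr; apply: close; exact: (HM j k x).1.
have i2 : 0 <= (2 : R) ^- j by rewrite invr_ge0 ltW.
have -> : iter r (fdiff (2 ^- j *: e0)) f x = iter r (fdiff (2 ^- j *: e0)) g x.
  apply: eq_fdiffn => i ir; rewrite scalerA addrC; apply: fg; apply: Hs.
  by rewrite mulr_ge0//= ler_wpM2r// ler_nat.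
have -> : (2 : R) ^- (j * r) = (2 ^- j) ^+ r by rewrite exprM exprVn.
apply: fdiffn_bound => //.
- move=> i ir s0 /Hs H.
  have := DC i (ltnW ir); rewrite -(subnSK ir) => -[_ /(_ ord0) [+ _]].
  by apply; have [] := Be _ (le_lt_trans H e2e).
- by move=> s0 /Hs H; apply: ltW; have [] := Be _ (le_lt_trans H e2e).
Qed.

End Probing.
End Probe.

(** * Regularity at a point of tau *)

Section SmoothnessEvent.
Context (R : realType) (d r : nat) (s p : R) (phi : 'rV[R]_d.+1 -> R)
  (Psi : 'I_(2 ^ d.+1 - 1) -> 'rV[R]_d.+1 -> R) (beta : R)
  (t : nat -> 'rV[int]_d.+1 -> R)
  (X : nat -> 'rV[int]_d.+1 -> 'I_(2 ^ d.+1 - 1) -> R).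
Local Notation E := 'rV[R]_d.+1.
Local Notation Zd := 'rV[int]_d.+1.
Local Notation mu := (@lebesgue_rV R d.+1).
Local Notation T := (tree beta t).
Local Notation F := (random_wseries s p T X).
Hypothesis CPsi : forall l, Cn r setT (Psi l).
Hypothesis sPsi : forall l, compactly_supported_in setT (Psi l).
Variables (theta : E -> R).
Hypothesis Ctheta : forall n, Cn n setT theta.
Hypothesis theta_cont_bsupp : cont_bsupp theta.
Hypothesis theta0 : forall x, 0 <= theta x.
Hypothesis theta_gt0 : exists y, 0 < theta y.

Lemma cont_bsupp_Psi l : cont_bsupp (Psi l).
Proof.
split; first by move=> x; exact: Cn_continuous (CPsi l) x I.
by have [M HM] := bsuppPsi sPsi; exists M => x; exact: HM.
Qed.

Lemma cont_bsupp_mother j k l : cont_bsupp (mother Psi j k l).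
Proof. by apply: cont_bsuppZ; exact: cont_bsupp_affine (pow2_neq0 R j) (cont_bsupp_Psi l). Qed.

Definition pairing (j : nat) (k : Zd) (i : nat) (m : Zd) (l : 'I_(2 ^ d.+1 - 1)) : R :=
  \int[mu]_x (mother Psi i m l x * probe r theta j k x).

Lemma Rintegral_partial_sum_probe J j k :
  \int[mu]_x (partial_sum phi Psi F J x * probe r theta j k x) =
  \sum_(i < J) \sum_(m <- nodes d.+1 i) \sum_l
    coef_mother F i m l * pairing j k i m l.
Proof.
have cp : continuous (probe r theta j k) by have [] := cont_bsupp_probe r theta_cont_bsupp j k.
have c3 i m l : cont_bsupp (fun x => coef_mother F i m l * (mother Psi i m l x * probe r theta j k x)).
  by apply: cont_bsuppZ; apply: cont_bsuppMr => //; exact: cont_bsupp_mother.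
have c2 i m : cont_bsupp (fun x => \sum_l coef_mother F i m l * (mother Psi i m l x * probe r theta j k x)).
  exact: cont_bsupp_sum.
have c1 i : cont_bsupp (fun x => \sum_(m <- nodes d.+1 i) \sum_l coef_mother F i m l * (mother Psi i m l x * probe r theta j k x)).
  exact: cont_bsupp_sum.
transitivity (\int[mu]_x (\sum_(i < J) \sum_(m <- nodes d.+1 i) \sum_l
    coef_mother F i m l * (mother Psi i m l x * probe r theta j k x))).
  apply: eq_Rintegral => x _; rewrite partial_sumE mulr_suml; apply: eq_bigr => i _.
  rewrite mulr_suml; apply: eq_bigr => m _; rewrite mulr_suml; apply: eq_bigr => l _.
  by rewrite mulrA.
rewrite Rintegral_cont_bsupp_sum//; apply: eq_bigr => i _.
rewrite Rintegral_cont_bsupp_sum//; apply: eq_bigr => m _.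
rewrite Rintegral_cont_bsupp_sum//; apply: eq_bigr => l _.
rewrite RintegralZl//; apply: cont_bsupp_integrable; apply: cont_bsuppMr => //; exact: cont_bsupp_mother.
Qed.

(** The neighbourhood of a point of tau is encoded by a node (a, k') of the tree, so
    that only countably many neighbourhoods occur. *)
Definition near_node (a : nat) (k' : Zd) (j : nat) (k : Zd) : Prop :=
  `|2 ^- j *: intv R k - 2 ^- a *: intv R k'| <= 2 * 2 ^- a.

Lemma tau_node x j : tau R T x -> exists2 k, T (j.+1, k) & `|x - 2 ^- j.+1 *: intv R k| <= 2 ^- j.+1.
Proof. by move=> /(_ j.+1 (ltn0Sn _)) [k Tk /closure_Q_dist xk]; exists k. Qed.

(** What C^r regularity near one point of tau forces. The bound of
    Rintegral_probe_Cn holds for the limit of the pairings in the sense of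
    distributions, hence, with a larger constant, for the partial sums from some
    J0 on. All the parameters range over countable sets, which makes this
    conclusion usable almost surely. *)
Lemma smooth_point_of_tau x : tau R T x -> ~ singsupp phi Psi r F x ->
  exists (a : nat) (k' : Zd) (C : nat) (j1 : nat), [/\ (0 < C)%N &
    forall j, (j1 <= j)%N ->
    (exists2 k, T (j, k) & near_node a k' j k) /\
    forall k, T (j, k) -> near_node a k' j k ->
      exists J0, forall J, (J0 <= J)%N ->
        `|\sum_(i < J) \sum_(m <- nodes d.+1 i) \sum_l
          coef_mother F i m l * pairing j k i m l| <=
        C%:R * 2 ^- (j * r) * mass theta j k].
Proof.
move=> xtau xns.
have [U [oU Ux [g [Cg cvg]]]] : exists U : set E, [/\ open U, U x & is_Cr_on phi Psi r F U].
  by apply: contrapT => H; apply: xns; split => //; exact: tau_unit_cube xtau.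
have [C [rho [j1 [C0 rho0 HC]]]] := Rintegral_probe_Cn Ctheta theta_cont_bsupp theta0 oU Ux Cg.
have [a0 Ha] := @lt_mul_pow2 R 3 rho rho0.
(* the scale of the neighbourhood: 3 * 2^-a <= rho; a is positive since tau starts
   at level 1 *)
pose a := a0.+1.
have [k' Tk' xk'] := tau_node a0 xtau.
have p2 i : 0 < (2 : R) ^+ i by rewrite exprn_gt0.
have arho : 3 * 2 ^- a <= rho.
  by rewrite ler_pdivrMr// ltW// Ha.
exists a, k', (Num.truncn C).+2, (maxn j1 a); split=> // j.
rewrite geq_max => /andP[j1j aj]; split.
  have j0 : (0 < j)%N by exact: leq_ltn_trans aj.
  have [k Tk xk] := tau_node j.-1 xtau; rewrite prednK// in Tk xk.
  exists k => //; rewrite /near_node.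
  have ja : (2 : R) ^- j <= 2 ^- a.
    by rewrite lef_pV2 ?posrE// ler_eXn2l// ltr1n.
  have := ler_distD x (2 ^- j *: intv R k) (2 ^- a *: intv R k').
  by move: xk xk' ja; rewrite -/a [X in X <= 2 ^- j -> _]distrC; lra.
move=> k Tk nk.
have xk : `|x - 2 ^- j *: intv R k| <= rho.
  apply: le_trans arho.
  have := ler_distD (2 ^- a *: intv R k') x (2 ^- j *: intv R k).
  by move: nk xk'; rewrite -/a /near_node [X in X <= 2 * _ -> _]distrC; lra.
have [tf bI] := HC j k j1j xk.
have w0 : 0 < 2 ^- (j * r) * mass theta j k.
  by rewrite mulr_gt0 ?invr_gt0// mass_gt0.
have := cvg _ tf => /cvgr_norm_lt /(_ ((Num.truncn C).+2%:R * 2 ^- (j * r) * mass theta j k)).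
have H : `|\int[mu]_x (g x * probe r theta j k x)| <
    (Num.truncn C).+2%:R * 2 ^- (j * r) * mass theta j k.
  apply: le_lt_trans bI _; rewrite -!mulrA ltr_pM2r//.
  by apply: lt_trans (truncnS_gt C) _; rewrite ltr_nat.
move=> /(_ H) [J0 _ HJ0]; exists J0 => J J0J.
by rewrite -Rintegral_partial_sum_probe; apply/ltW/HJ0.
Qed.

End SmoothnessEvent.

(** * Iterates of a generating function *)

Section GeneratingFunction.
Context (R : realType) (M : nat) (b : R).
Hypothesis b0 : 0 < b.
Hypothesis b1 : b <= 1.
Local Notation N := M.+2.
Local Notation m := (N%:R * b).
Hypothesis m1 : 1 < m.

(** Generating function of the number of successes in N independent trials of
    probability b, here the number of children of a node of the tree. *)
Definition genf (x : R) : R := (1 - b + b * x) ^+ N.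

Let m0 : 0 < m. Proof. exact: lt_trans m1. Qed.

Lemma genf_bounds x : 0 <= x <= 1 -> 0 <= genf x <= 1.
Proof.
move=> /andP[x0 x1]; have u0 : 0 <= 1 - b + b * x.
  by rewrite addr_ge0 ?mulr_ge0// ?subr_ge0// ltW.
rewrite /genf exprn_ge0//= exprn_ile1// -lerBrDl opprB addrCA subrr addr0.
by rewrite ger_pMr.
Qed.

Lemma iter_genf_bounds n x : 0 <= x <= 1 -> 0 <= iter n genf x <= 1.
Proof. by move=> x01; elim: n => //= n; exact: genf_bounds. Qed.

Lemma iter_genf_mono n : {in `[0, 1] &, {homo iter n genf : x y / x <= y}}.
Proof.
move=> x y; rewrite !in_itv/= => x01 y01 xy; elim: n => //= n IHn.
have /andP[xn0 xn1] := iter_genf_bounds n x01.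
have base z : 0 <= z -> 0 <= 1 - b + b * z.
  by move=> z0; rewrite addr_ge0 ?mulr_ge0 ?subr_ge0// ltW.
rewrite /genf lerXn2r ?nnegrE ?base//; first exact: le_trans IHn.
by rewrite lerD2l ler_pM2l.
Qed.

(** As (1 - b y)^N (1 + b y)^N <= 1, Bernoulli's inequality bounds genf (1 - y) by
    1 / (1 + m y). For the reciprocal of the distance to 1 this is an affine
    bound, which can be iterated. *)
Lemma genf_gap y : 0 < y <= 1 ->
  0 < 1 - genf (1 - y) /\ (1 - genf (1 - y))^-1 <= 1 + (m * y)^-1.
Proof.
move=> /andP[y0 y1]; have my0 : 0 < m * y by rewrite mulr_gt0.
have H : genf (1 - y) <= (1 + m * y)^-1.
  have E1 : 1 - b + b * (1 - y) = 1 - b * y by ring.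
  rewrite /genf E1 -div1r ler_pdivlMr; last by rewrite ltr_wpDl.
  have by1 : 0 <= 1 - b * y.
    by rewrite subr_ge0 -[leRHS]mulr1 ler_pM// ltW.
  apply: (@le_trans _ _ ((1 - b * y) ^+ N * (1 + b * y) ^+ N)).
    rewrite ler_wpM2l ?exprn_ge0//.
    have bern k : 1 + k%:R * (b * y) <= (1 + b * y) ^+ k.
      elim: k => [|k IHk]; first by rewrite mul0r addr0 expr0.
      have by0 : 0 <= b * y by rewrite mulr_ge0 // ltW.
      have k0 : 0 <= k%:R * (b * y) * (b * y) by rewrite !mulr_ge0 // ltW.
      rewrite exprS; apply: le_trans (ler_wpM2l _ IHk); last by rewrite addr_ge0.
      by rewrite -natr1; move: k0; nra.
    by rewrite -mulrA; exact: bern.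
  rewrite -exprMn exprn_ile1//.
    by rewrite mulr_ge0// addr_ge0 ?mulr_ge0// ltW.
  by rewrite -subr_sqr expr1n lerBlDr lerDl sqr_ge0.
have H2 : (1 + m * y)^-1 = 1 - m * y / (1 + m * y).
  apply: (@mulfI _ (1 + m * y)); first by rewrite gt_eqF// addr_gt0.
  by rewrite mulrBr mulrCA !divff ?gt_eqF ?addr_gt0//; ring.
have H3 : m * y / (1 + m * y) <= 1 - genf (1 - y) by rewrite H2 in H; rewrite lerBrDr addrC -lerBrDr.
have H4 : 0 < m * y / (1 + m * y) by rewrite divr_gt0 ?addr_gt0.
split; first exact: lt_le_trans H3.
have : (1 - genf (1 - y))^-1 <= (m * y / (1 + m * y))^-1.
  by rewrite lef_pV2 ?posrE//; exact: lt_le_trans H3.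
move=> /le_trans; apply; rewrite invf_div mulrDl divff ?gt_eqF// mul1r addrC.
by rewrite lexx.
Qed.

Let divr_sub1 (q : R) : q - 1 != 0 -> q / (q - 1) = 1 + (q - 1)^-1.
Proof. by move=> q1; rewrite -{1}(subrK 1 q) mulrDl divff// mul1r. Qed.

(** The affine bounds of genf_gap add up to a geometric series. If y is a multiple
    of m^-n, the distance to 1 after n steps is bounded below uniformly in n. *)
Lemma iter_genf_gap n y : 0 < y <= 1 ->
  0 < 1 - iter n genf (1 - y) /\
  (1 - iter n genf (1 - y))^-1 <= (m ^+ n * y)^-1 + m / (m - 1).
Proof.
move=> /[dup] y01 /andP[y0 y1]; have mm : 0 < m - 1 by rewrite subr_gt0.
elim: n => [|n [IH1 IH2]] /=.
  rewrite subKr expr0 mul1r y0; split=> //.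
  by rewrite lerDl divr_ge0// ltW.
have /andP[i0 i1] := @iter_genf_bounds n (1 - y) ltac:(by rewrite subr_ge0 y1 lerBlDr lerDl ltW).
have := @genf_gap (1 - iter n genf (1 - y)).
rewrite subKr IH1 lerBlDr lerDl i0 => /(_ isT)[H1 H2]; split=> //.
apply: (le_trans H2); rewrite invfM exprS -mulrA invfM.
have : m^-1 * (1 - iter n genf (1 - y))^-1 <= m^-1 * ((m ^+ n * y)^-1 + m / (m - 1)).
  by rewrite ler_wpM2l// invr_ge0 ltW.
rewrite divr_sub1 ?gt_eqF//.
have -> : m^-1 * ((m ^+ n * y)^-1 + (1 + (m - 1)^-1)) = m^-1 * (m ^+ n * y)^-1 + (m - 1)^-1.
  rewrite mulrDr; congr (_ + _).
  by rewrite -divr_sub1 ?gt_eqF// mulrA mulVf ?mul1r// gt_eqF.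
move=> H; rewrite [leRHS]addrCA lerD2l -invfM.
by move: H; rewrite -!invfM.
Qed.

(** Compares slopes of chords of the power function: the one over [v, u] is smaller
    than the one over [u, 1], by a definite factor if u stays below c < 1. *)
Lemma expr_contract (u v c : R) : 0 <= v -> v <= u -> u <= c -> c <= 1 ->
  (u ^+ N - v ^+ N) * (1 - u) <= (1 - (1 - c) / N%:R) * ((u - v) * (1 - u ^+ N)).
Proof.
move=> v0 vu uc c1.
have u0 : 0 <= u by exact: le_trans vu.
have u1 : u <= 1 by exact: le_trans c1.
have v1 : v <= 1 by exact: le_trans vu u1.
rewrite subrXX -(expr1n _ N) [X in _ <= _ * (_ * X)]subrXX expr1n.
have -> : \sum_(i < N) 1 ^+ (N.-1 - i) * u ^+ i = \sum_(i < N) u ^+ (N.-1 - i).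
  rewrite (reindex_inj rev_ord_inj) /=; apply: eq_bigr => i _.
  by rewrite expr1n mul1r subSS.
set S1 := \sum_(i < N) u ^+ _ * _; set S := \sum_(i < N) _.
suff : S1 <= (1 - (1 - c) / N%:R) * S.
  have uv : 0 <= (u - v) * (1 - u) by rewrite mulr_ge0 ?subr_ge0.
  move=> /(ler_wpM2l uv); rewrite mulrAC => /le_trans; apply.
  by rewrite le_eqVlt; apply/orP; left; apply/eqP; ring.
have SN : S <= N%:R.
  rewrite /S -[N in N%:R]card_ord -sumr_const ler_sum// => i _.
  exact: exprn_ile1.
have S1E : S1 <= S - (1 - c).
  rewrite /S1 /S big_ord_recl [X in _ <= X - _]big_ord_recl /= expr0 mulr1 -addrA lerD2l.
  rewrite big_ord_recr [X in _ <= X - _]big_ord_recr /= /bump /= !add1n !subnn !expr0 !mul1r.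
  have H1 : \sum_(i < M) u ^+ (M.+1 - bump 0 (widen_ord (leqnSn M) i)) * v ^+ bump 0 (widen_ord (leqnSn M) i)
      <= \sum_(i < M) u ^+ (M.+1 - bump 0 (widen_ord (leqnSn M) i)).
    apply: ler_sum => i _; rewrite -[leRHS]mulr1 ler_wpM2l ?exprn_ge0//.
    exact: exprn_ile1.
  have H2 : v ^+ M.+1 <= c.
    apply: (le_trans _ (le_trans vu uc)).
    by rewrite exprS -[leRHS]mulr1 ler_wpM2l// exprn_ile1.
  by move: H1 H2; rewrite /bump /=; lra.
apply: (le_trans S1E).
rewrite mulrBl mul1r lerD2l lerN2 -mulrA ler_piMr ?subr_ge0//.
by rewrite mulrC ler_pdivrMr// mul1r.
Qed.

(** Both orbits tend to the extinction probability: by expr_contract the ratio of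
    their gap to the distance of the upper one from 1 decreases geometrically. *)
Lemma iter_genf_merge (delta e : R) : 0 < delta <= 1 -> 0 < e ->
  exists i, iter i genf (1 - delta) - iter i genf 0 < e.
Proof.
move=> /[dup] d01 /andP[d0 d1] e0.
pose y i := iter i genf (1 - delta); pose x i := iter i genf 0.
have y01 i : 0 <= y i <= 1.
  by apply: iter_genf_bounds; rewrite subr_ge0 d1 lerBlDr lerDl ltW.
have x01 i : 0 <= x i <= 1 by apply: iter_genf_bounds; rewrite lexx ler01.
have xy i : x i <= y i.
  by apply: iter_genf_mono; rewrite ?in_itv/= ?lexx ?ler01 ?subr_ge0 ?d1 ?lerBlDr ?lerDl ?(ltW d0).
have mm : 0 < m - 1 by rewrite subr_gt0.
pose D := (delta^-1 + m / (m - 1)).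
have D0 : 0 < D by rewrite addr_gt0 ?invr_gt0 ?divr_gt0.
have yD i : D^-1 <= 1 - y i.
  have [g1 g2] := iter_genf_gap i d01.
  rewrite -[leRHS]invrK lef_pV2 ?posrE ?invr_gt0//; apply: le_trans g2 _.
  rewrite lerD2r lef_pV2 ?posrE ?mulr_gt0 ?exprn_gt0// ler_pMl//.
  exact: exprn_ege1 (ltW m1).
have D1 : D^-1 <= 1 by have := yD 0%N; have /andP[] := y01 0%N; lra.
(* D^-1 bounds from below the distance to 1 of the whole orbit of 1 - delta *)
pose c := 1 - b * D^-1; pose kappa := 1 - (1 - c) / N%:R.
have c1 : c <= 1 by rewrite lerBlDr lerDl mulr_ge0 ?invr_ge0// ltW.
have bD : 0 < b / D by rewrite divr_gt0.
have bD1 : b / D <= 1 by rewrite -[leRHS]mulr1 ler_pM ?invr_ge0// ltW.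
have N0 : 0 < (N%:R : R) by rewrite ltr0n.
have kE : kappa = 1 - b / D / N%:R by rewrite /kappa /c; congr (_ - _ / _); ring.
have k0 : 0 <= kappa.
  rewrite kE subr_ge0 ler_pdivrMr// mul1r (le_trans bD1)//.
  by rewrite -[1]/(1%:R) ler_nat.
have k1 : kappa < 1 by rewrite kE ltrBlDr ltrDl divr_gt0.
have step i : (y i.+1 - x i.+1) * (1 - y i) <= kappa * ((y i - x i) * (1 - y i.+1)).
  have := @expr_contract (1 - b + b * y i) (1 - b + b * x i) c.
  have /andP[x0' x1'] := x01 i; have /andP[y0' y1'] := y01 i.
  have a1 : 0 <= 1 - b + b * x i by rewrite addr_ge0 ?mulr_ge0 ?subr_ge0// ltW.
  have a2 : 1 - b + b * x i <= 1 - b + b * y i by rewrite lerD2l ler_pM2l.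
  have a3 : 1 - b + b * y i <= c.
    have : b * D^-1 <= b * (1 - y i) by rewrite ler_pM2l.
    by rewrite /c; lra.
  move=> /(_ a1 a2 a3 c1); rewrite -/kappa.
  have -> : (1 - b + b * y i) ^+ N = y i.+1 by [].
  have -> : (1 - b + b * x i) ^+ N = x i.+1 by [].
  have -> : 1 - (1 - b + b * y i) = b * (1 - y i) by ring.
  have -> : 1 - b + b * y i - (1 - b + b * x i) = b * (y i - x i) by ring.
  rewrite [X in X <= _ -> _]mulrCA -[X in _ <= _ * X -> _]mulrA.
  by rewrite [X in _ <= X -> _]mulrCA ler_pM2l.
have ypos i : 0 < 1 - y i by apply: lt_le_trans (yD i); rewrite invr_gt0.
have geo i : y i - x i <= kappa ^+ i * (1 - y i) / delta.
  elim: i => [|i IHi].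
    rewrite expr0 mul1r /y /x /= subKr divff ?gt_eqF//.
    by rewrite subr0 lerBlDr lerDl ltW.
  rewrite -(@ler_pM2r _ (1 - y i))//; apply: le_trans (step i) _.
  have : kappa * ((y i - x i) * (1 - y i.+1)) <= kappa * (kappa ^+ i * (1 - y i) / delta * (1 - y i.+1)).
    by rewrite ler_wpM2l// ler_pM2r.
  move=> /le_trans; apply; rewrite le_eqVlt; apply/orP; left; apply/eqP.
  rewrite exprS; ring.
have /cvgrPdist_lt/(_ (e * delta)) : kappa ^+ n @[n --> \oo] --> (0 : R).
  by apply: cvg_expr; rewrite ger0_norm.
rewrite mulr_gt0// => /(_ isT)[i _ /(_ i (leqnn i))] /=.
rewrite sub0r normrN ger0_norm ?exprn_ge0// => H.
exists i; apply: le_lt_trans (geo i) _.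
rewrite ltr_pdivrMr//; apply: le_lt_trans H.
rewrite -[leRHS]mulr1 ler_wpM2l ?exprn_ge0//.
by have /andP[? _] := y01 i; lra.
Qed.

End GeneratingFunction.

(** * Thinning *)

Lemma bigcap_seq_cons (T : Type) (I : eqType) (c : I) (s : seq I) (M : I -> set T) :
  \bigcap_(i in [set` c :: s]) M i = M c `&` \bigcap_(i in [set` s]) M i.
Proof.
apply/seteqP; split=> [w Mw|w [Mc Ms] i /=].
  split; first by apply: Mw; rewrite /= mem_head.
  by move=> i /= is_; apply: Mw; rewrite /= inE is_ orbT.
by rewrite inE => /orP[/eqP ->//|]; exact: Ms.
Qed.

Section BoundedExpectation.
Context (R : realType) (disp : measure_display) (Omega : measurableType disp)
  (P : probability Omega R).
Implicit Types (f g : Omega -> R) (A G : set Omega).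
Local Notation Ex f := (\int[P]_w f w).

(** Products of finitely many factors 1 - a 1_A are of this kind, so that their
    expectations exist without further argument. *)
Definition bounded_mfun f := measurable_fun setT f /\ exists C : R, forall w, `|f w| <= C.

Lemma bounded_mfun_integrable f : bounded_mfun f -> P.-integrable setT (EFin \o f).
Proof.
move=> [mf [C fC]]; apply: measurable_bounded_integrable => //.
  by apply: le_lt_trans (probability_le1 P measurableT) _; rewrite ltry.
exists C; split; first exact: num_real.
by move=> M CM w _; apply: le_trans (fC w) (ltW CM).
Qed.

Lemma bounded_mfunD f g : bounded_mfun f -> bounded_mfun g -> bounded_mfun (fun w => f w + g w).
Proof.
move=> [mf [C fC]] [mg [D gD]]; split; first exact: measurable_funD.
by exists (C + D) => w; apply: le_trans (ler_normD _ _) _; rewrite lerD.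
Qed.

Lemma bounded_mfunM f g : bounded_mfun f -> bounded_mfun g -> bounded_mfun (fun w => f w * g w).
Proof.
move=> [mf [C fC]] [mg [D gD]]; split; first exact: measurable_funM.
by exists (C * D) => w; rewrite normrM ler_pM.
Qed.

Lemma bounded_mfun_cst (c : R) : bounded_mfun (fun=> c).
Proof. by split; [exact: measurable_cst|exists `|c|]. Qed.

Lemma bounded_mfun_indic A : measurable A -> bounded_mfun (\1_A : Omega -> R).
Proof.
move=> mA; split; first exact: measurable_indic.
by exists 1 => w; rewrite indicE; case: (_ \in _); rewrite ?normr1 ?normr0.
Qed.

Lemma bounded_mfun_sub_indic (a : R) A : measurable A -> bounded_mfun (fun w => 1 - a * \1_A w).
Proof.
move=> mA; have := bounded_mfunD (bounded_mfun_cst 1) (bounded_mfunM (bounded_mfun_cst (- a)) (bounded_mfun_indic mA)).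
by congr bounded_mfun; apply/funext => w; rewrite mulNr.
Qed.

Lemma bounded_mfun_prod (I : eqType) (s : seq I) (f : I -> Omega -> R) :
  (forall i, i \in s -> bounded_mfun (f i)) -> bounded_mfun (fun w => \prod_(i <- s) f i w).
Proof.
elim: s => [|i s IHs] fs.
  rewrite (_ : (fun _ => _) = fun=> 1); first exact: bounded_mfun_cst.
  by apply/funext => w; rewrite big_nil.
have fs' j : j \in s -> bounded_mfun (f j) by move=> js; apply: fs; rewrite inE js orbT.
by have := bounded_mfunM (fs i (mem_head _ _)) (IHs fs'); congr bounded_mfun; apply/funext => w; rewrite big_cons.
Qed.

Lemma Ex_le f g : bounded_mfun f -> bounded_mfun g -> (forall w, f w <= g w) -> Ex f <= Ex g.
Proof. by move=> bf bg fg; apply: le_Rintegral => //; exact: bounded_mfun_integrable. Qed.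

Lemma Ex_indic A : measurable A -> Ex (\1_A : Omega -> R) = fine (P A).
Proof.
by move=> mA; rewrite /Rintegral integral_indic// setIT.
Qed.

Section Thinning.
Context (I : eqType) (M K : I -> set Omega) (a b : R) (GG : set (set Omega)).
Hypothesis mM : forall c, measurable (M c).
Hypothesis mGG : forall G, GG G -> measurable G.
Hypothesis GGI : setI_closed GG.
Hypothesis ind : forall G s, GG G -> uniq s ->
  P (G `&` \bigcap_(c in [set` s]) M c) = (P G * (b ^+ size s)%:E)%E.

Let mMs (s : seq I) : measurable (\bigcap_(c in [set` s]) M c).
Proof. exact: fin_bigcap_measurable. Qed.

(** Induction on s, expanding the factor of its head. The marks already expanded
    are collected in s0; by independence of GG each contributes a factor b. *)
Lemma thinning_aux (s s0 : seq I) G : GG G ->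
  (forall c, c \in s -> GG (K c)) -> uniq (s0 ++ s) ->
  Ex (fun w => \1_(G `&` \bigcap_(c in [set` s0]) M c) w *
     \prod_(c <- s) (1 - a * \1_(K c `&` M c) w)) =
  b ^+ size s0 * Ex (fun w => \1_G w * \prod_(c <- s) (1 - a * b * \1_(K c) w)).
Proof.
elim: s s0 G => [|c s IHs] s0 G GG_G GG_K us.
  rewrite cats0 in us.
  under eq_Rintegral => w _ do rewrite big_nil mulr1.
  under [in RHS]eq_Rintegral => w _ do rewrite big_nil mulr1.
  have mG := mGG GG_G.
  rewrite !Ex_indic//; last exact: measurableI.
  by rewrite ind// fineM ?fin_num_measure// mulrC.
have GKc : GG (K c) by apply: GG_K; rewrite mem_head.
have GKs c' : c' \in s -> GG (K c') by move=> c's; apply: GG_K; rewrite inE c's orbT.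
have bp1 : bounded_mfun (fun w => \prod_(c <- s) (1 - a * \1_(K c `&` M c) w)).
  apply: bounded_mfun_prod => i /GKs /mGG mK; apply: bounded_mfun_sub_indic; exact: measurableI.
have bp2 : bounded_mfun (fun w => \prod_(c <- s) (1 - a * b * \1_(K c) w)).
  by apply: bounded_mfun_prod => i /GKs /mGG mK; apply: bounded_mfun_sub_indic.
have mG := mGG GG_G; have mK := mGG GKc.
pose f1 w := \1_(G `&` \bigcap_(c in [set` s0]) M c) w * \prod_(c <- s) (1 - a * \1_(K c `&` M c) w) : R.
pose f2 w := \1_((G `&` K c) `&` \bigcap_(c in [set` c :: s0]) M c) w * \prod_(c <- s) (1 - a * \1_(K c `&` M c) w) : R.
pose g1 w := \1_G w * \prod_(c <- s) (1 - a * b * \1_(K c) w) : R.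
pose g2 w := \1_(G `&` K c) w * \prod_(c <- s) (1 - a * b * \1_(K c) w) : R.
have bf1 : bounded_mfun f1 by apply: bounded_mfunM => //; apply: bounded_mfun_indic; exact: measurableI.
have bf2 : bounded_mfun f2.
  by apply: bounded_mfunM => //; apply: bounded_mfun_indic; apply: measurableI => //; exact: measurableI.
have bg1 : bounded_mfun g1 by apply: bounded_mfunM => //; exact: bounded_mfun_indic.
have bg2 : bounded_mfun g2 by apply: bounded_mfunM => //; apply: bounded_mfun_indic; exact: measurableI.
have zE f k : bounded_mfun f -> Ex (fun w => k * f w) = k * Ex f.
  by move=> bf; rewrite RintegralZl//; exact: bounded_mfun_integrable.
have bz f k : bounded_mfun f -> bounded_mfun (fun w => k * f w) by move=> bf; exact: bounded_mfunM (bounded_mfun_cst k) bf.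
transitivity (Ex f1 - a * Ex f2).
  rewrite -zE// -RintegralB//; [|exact: bounded_mfun_integrable|exact/bounded_mfun_integrable/bz].
  apply: eq_Rintegral => w _; rewrite big_cons /f1 /f2.
  have -> : \1_(G `&` K c `&` \bigcap_(i in [set` c :: s0]) M i) w =
      \1_(G `&` \bigcap_(i in [set` s0]) M i) w * \1_(K c `&` M c) w :> R.
    rewrite -[RHS]/((\1_(G `&` \bigcap_(i in [set` s0]) M i) \* \1_(K c `&` M c)) w) -indicI.
    by rewrite bigcap_seq_cons [M c `&` _]setIC setIACA.
  by ring.
transitivity (b ^+ size s0 * (Ex g1 - a * b * Ex g2)).
  have -> : Ex f1 = b ^+ size s0 * Ex g1.
    apply: IHs => //; move: us; rewrite -cat1s uniq_catCA /= => /andP[_].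
    by [].
  have -> : Ex f2 = b ^+ (size s0).+1 * Ex g2.
    apply: (IHs (c :: s0)) => //; first exact: GGI.
    by move: us; rewrite -cat1s uniq_catCA.
  by rewrite exprS; ring.
congr (_ * _); rewrite -zE// -RintegralB//; [|exact: bounded_mfun_integrable|exact/bounded_mfun_integrable/bz].
apply: eq_Rintegral => w _; rewrite big_cons /g1 /g2 indicI /=; ring.
Qed.

(** Independent marks of probability b can be averaged out inside the product
    although the events K c are arbitrarily dependent on each other. *)
Lemma thinning (s : seq I) : GG setT -> (forall c, c \in s -> GG (K c)) -> uniq s ->
  Ex (fun w => \prod_(c <- s) (1 - a * \1_(K c `&` M c) w)) =
  Ex (fun w => \prod_(c <- s) (1 - a * b * \1_(K c) w)).
Proof.
move=> GT GK us; have := @thinning_aux s [::] setT GT GK us.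
rewrite expr0 mul1r => H.
transitivity (Ex (fun w => \1_([set: Omega] `&` \bigcap_(c in [set` [::]]) M c) w *
     \prod_(c <- s) (1 - a * \1_(K c `&` M c) w))).
  by apply: eq_Rintegral => w _; rewrite setTI indicE mem_set ?mul1r.
by rewrite H; apply: eq_Rintegral => w _; rewrite indicE mem_set// mul1r.
Qed.

End Thinning.

End BoundedExpectation.

(** * The law of the tree *)

Lemma prob_uniform_lt (R : realType) (b : R) : 0 <= b <= 1 ->
  uniform_prob (@ltr01 R) `]-oo, b[%classic = b%:E.
Proof.
move=> /andP[b0 b1]; rewrite /uniform_prob integral_uniform_pdf.
rewrite (_ : _ `&` _ = `[0, b[%classic); last first.
  apply/seteqP; split=> x /=; rewrite !in_itv/=.
    by move=> [xb /andP[x0 _]]; rewrite x0.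
  by move=> /andP[x0 xb]; split=> //; rewrite x0/= (le_trans (ltW xb)).
rewrite (eq_integral (fun=> 1%:E)); last first.
  move=> x; rewrite inE/= in_itv/= /uniform_pdf => /andP[x0 xb].
  by rewrite x0 (le_trans (ltW xb))//= subr0 invr1.
rewrite integral_cst//= lebesgue_measure_itv/= lte_fin mul1e.
case: ltP => [_|bb0]; first by rewrite -EFinB subr0.
by congr _%:E; apply/eqP; rewrite eq_le b0.
Qed.

Section TreeLaw.
Context (R : realType) (disp : measure_display) (Omega : measurableType disp)
  (P : probability Omega R) (d : nat) (beta : R)
  (t : nat -> 'rV[int]_d -> {RV P >-> R}).
Local Notation Zd := 'rV[int]_d.
Hypothesis tindep : mutually_independent (fun n : nat * Zd => t n.1 n.2).
Hypothesis tlaw : forall j k A, measurable A ->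
  distribution P (t j k) A = uniform_prob (@ltr01 R) A.
Hypothesis beta01 : 0 <= beta <= 1.
Local Notation Ex f := (\int[P]_w f w).

(** Edges are indexed by their lower ends. *)
Definition edge (i : nat * Zd) : set Omega := t i.1 i.2 @^-1` `]-oo, beta[%classic.

Definition Lev (j : nat) (k : Zd) : set Omega :=
  [set w | level beta (fun j k => t j k w) j k].

Lemma measurable_edge i : measurable (edge i).
Proof. by rewrite -[edge i]setTI; apply: measurable_funPT. Qed.

Lemma prob_edges (s : seq (nat * Zd)) : uniq s ->
  P (\bigcap_(i in [set` s]) edge i) = (beta ^+ size s)%:E.
Proof.
move=> us; rewrite (tindep (A := fun=> `]-oo, beta[%classic) us)//.
rewrite (eq_bigr (fun=> beta%:E)) => [|i _].
  by elim: s {us} => [|i s IHs]; rewrite ?big_nil ?big_cons// IHs exprS EFinM.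
by rewrite -(prob_uniform_lt beta01) -(tlaw i.1 i.2).
Qed.

Fixpoint ancestors (j : nat) (k : Zd) : seq (nat * Zd) :=
  if j is j'.+1 then (j, k) :: ancestors j' (parent k) else [::].

Lemma ancestors_level j k i : i \in ancestors j k -> (i.1 <= j)%N.
Proof.
elim: j k => //= j IHj k; rewrite inE => /orP[/eqP -> //|/IHj].
exact: leqW.
Qed.

Lemma uniq_ancestors j k : uniq (ancestors j k).
Proof.
elim: j k => //= j IHj k; rewrite IHj andbT; apply/negP => /ancestors_level.
by rewrite /= ltnn.
Qed.

Lemma size_ancestors j k : size (ancestors j k) = j.
Proof. by elim: j k => //= j IHj k; rewrite IHj. Qed.

Lemma LevE j k : k \in nodes d j ->
  Lev j k = \bigcap_(i in [set` ancestors j k]) edge i.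
Proof.
elim: j k => [|j IHj] k.
  by rewrite inE => /eqP ->; apply/seteqP; split.
rewrite mem_nodesS => /IHj H; rewrite /= bigcap_seq_cons -H.
apply/seteqP; split=> w /=; rewrite /Lev /edge /= in_itv/=.
  by move=> [].
by move=> [].
Qed.

Lemma measurable_Lev j k : measurable (Lev j k).
Proof.
have [kj|kj] := boolP (k \in nodes d j).
  rewrite LevE//; apply: fin_bigcap_measurable => // i _; exact: measurable_edge.
rewrite (_ : Lev j k = set0)//; apply/seteqP; split=> // w /level_nodes.
by rewrite (negbTE kj).
Qed.

Lemma prob_Lev j k : k \in nodes d j -> P (Lev j k) = (beta ^+ j)%:E.
Proof.
by move=> /LevE ->; rewrite prob_edges ?uniq_ancestors// size_ancestors.
Qed.

(** The expectation of x^Z, where Z is the number of nodes of level n in the tree. *)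
Definition pop_gf (n : nat) (x : R) : R :=
  Ex (fun w => \prod_(k <- nodes d n) (1 - (1 - x) * \1_(Lev n k) w)).

(** Thinning averages out the edges below level n, and the 2^d siblings with the
    same parent are then grouped together. *)
Lemma pop_gfS n x : pop_gf n.+1 x = pop_gf n ((1 - beta + beta * x) ^+ (2 ^ d)).
Proof.
rewrite /pop_gf.
pose M (c : Zd) := edge (n.+1, c).
pose K (c : Zd) := Lev n (parent c).
pose GG := [set G | exists2 s : seq (nat * Zd), (forall i, i \in s -> (i.1 <= n)%N) &
   G = \bigcap_(i in [set` s]) edge i].
transitivity (Ex (fun w => \prod_(c <- nodes d n.+1) (1 - (1 - x) * \1_(K c `&` M c) w))).
  apply: eq_Rintegral => w _; apply: eq_bigr => c _.
  suff -> : Lev n.+1 c = K c `&` M c by [].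
  apply/seteqP; split=> v; rewrite /Lev /K /M /edge /= in_itv/=.
    by move=> [].
  by move=> [].
have GGm G : GG G -> measurable G.
  by move=> [s _ ->]; apply: fin_bigcap_measurable => // i _; exact: measurable_edge.
rewrite (@thinning _ _ _ _ _ M K _ beta GG)//.
- apply: eq_Rintegral => w _; rewrite big_nodesS; apply: eq_bigr => p _.
  under eq_bigr do rewrite /K parent_child.
  rewrite prodr_const card_ffun card_bool card_ord indicE.
  case: (_ \in _); rewrite ?mulr1 ?mulr0 ?subr0 ?expr1n//.
  rewrite subKr; congr (_ ^+ _); ring.
- move=> c; exact: measurable_edge.
- move=> _ _ [s sn ->] [s' s'n ->]; exists (s ++ s').
    by move=> i; rewrite mem_cat => /orP[/sn|/s'n].
  apply/seteqP; split=> [w [ws ws'] i /=|w H].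
    by rewrite mem_cat => /orP[/ws|/ws'].
  by split=> i /= ii; apply: H; rewrite /= mem_cat ii ?orbT.
- move=> _ s [s' s'n ->] us.
  have -> : \bigcap_(i in [set` s']) edge i = \bigcap_(i in [set` undup s']) edge i.
    by congr bigcap; apply/funext => i; rewrite /= mem_undup.
  have -> : \bigcap_(i in [set` undup s']) edge i `&` \bigcap_(c in [set` s]) M c =
      \bigcap_(i in [set` undup s' ++ [seq (n.+1, c) | c <- s]]) edge i.
    apply/seteqP; split=> [w [ws' ws] i /=|w H].
      by rewrite mem_cat => /orP[/ws' //|/mapP[c cs ->]]; exact: ws.
    split=> [i /= ii|c /= cs]; apply: H; rewrite /= mem_cat ?ii//.
    by rewrite map_f ?orbT.
  rewrite !prob_edges ?undup_uniq//.
    by rewrite size_cat size_map exprD EFinM.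
  rewrite cat_uniq undup_uniq/= map_inj_uniq ?us ?andbT//; last by move=> c c' [].
  apply/hasPn => _ /mapP[c _ ->]; rewrite mem_undup; apply/negP => /s'n.
  by rewrite /= ltnn.
- by exists [::] => //; apply/seteqP; split.
- move=> c; rewrite mem_nodesS => cn; exists (ancestors n (parent c)).
    by move=> i; exact: ancestors_level.
  by rewrite /K LevE.
- exact: uniq_nodes.
Qed.

Lemma pop_gfE n x : pop_gf n x = iter n (fun x => (1 - beta + beta * x) ^+ (2 ^ d)) x.
Proof.
elim: n x => [|n IHn] x; last by rewrite pop_gfS IHn -iterSr.
rewrite /pop_gf /= (_ : (fun _ => _) = fun=> x).
  rewrite Rintegral_cst//= probability_setT; by rewrite mulr1.
apply/funext => w; rewrite big_cons big_nil mulr1 indicE mem_set//.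
by rewrite mulr1 subKr.
Qed.

End TreeLaw.

(** * The Besov norm of the random series, and null events *)

Section BesovOfRandomSeries.
Context (R : realType) (d : nat) (s p t0 beta : R) (t : nat -> 'rV[int]_d -> R)
  (X : nat -> 'rV[int]_d -> 'I_(2 ^ d - 1) -> R).
Local Notation Zd := 'rV[int]_d.
Local Notation T := (tree beta t).
Local Notation F := (random_wseries s p T X).
Hypothesis p0 : 0 < p.

Definition level_mass (j : nat) : R :=
  \sum_(k <- nodes d j) \sum_l (if `[< T (j, k) >] then `|X j k l| `^ p else 0).

Lemma level_mass_ge0 j : 0 <= level_mass j.
Proof.
apply: sumr_ge0 => k _; apply: sumr_ge0 => l _; by case: ifP => // _; rewrite powR_ge0.
Qed.

(** The Besov weight and the factors h_j^p combine into 2^(jp(t0 - s)). *)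
Lemma besov_level (j : nat) :
  (besov_weight d t0 p j%:R *
    (\esum_(k in [set: Zd]) \sum_l (`|coef_mother F j k l| `^ p)%:E) =
  (2 `^ (j%:R * (p * (t0 - s))) * level_mass j)%:E)%E.
Proof.
pose u k : \bar R := (\sum_l (`|coef_mother F j k l| `^ p)%:E)%E.
have u0 k : (0 <= u k)%E.
  by apply: sume_ge0 => l _; rewrite lee_fin powR_ge0.
have -> : (\esum_(k in [set: Zd]) u k = \sum_(k <- nodes d j) u k)%E.
  rewrite (fsbig_seq _ _ (uniq_nodes d j)) -esum_fset//.
  rewrite [RHS]esum_mkcond; apply: eq_esum => k _; case: ifPn => // kj.
  rewrite /u big1// => l _; rewrite coef_random_notin ?normr0 ?powR0 ?gt_eqF//.
  by apply: contraNN kj => kj; rewrite mem_set.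
rewrite /besov_weight.
have -> : (\sum_(k <- nodes d j) u k =
    (2 `^ (- (j%:R * (s + d%:R / 2 - d%:R / p) * p)) * level_mass j)%:E)%E.
  rewrite /level_mass mulr_sumr -sumEFin; apply: eq_bigr => k _.
  rewrite /u sumEFin mulr_sumr; congr (_%:E); apply: eq_bigr => l _ /=.
  case: ifP => _; last by rewrite normr0 powR0 ?mulr0// gt_eqF.
  rewrite normrM powRM ?normr_ge0//; congr (_ * _).
  by rewrite ger0_norm ?powR_ge0// -powRrM mulNr.
rewrite -EFinM (mulrA (2 `^ _)) -powRD ?pnatr_eq0 ?implybT//; congr ((_ `^ _ * _)%:E).
by ring.
Qed.

Lemma besov_spaceP : besov_space t0 p F <->
  (\sum_(0 <= j <oo) (2 `^ (j%:R * (p * (t0 - s))) * level_mass j)%:E < +oo)%E.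
Proof.
rewrite /besov_space /= /besov_norm.
rewrite (eq_eseriesr (fun j _ => besov_level j)).
set S := (\sum_(0 <= j <oo) _)%E.
have -> : (besov_weight d t0 p (-1) * (\esum_(k in [set: Zd]) (`|coef_father F k| `^ p)%:E) = 0)%E.
  rewrite esum1 ?mule0// => k _; by rewrite normr0 powR0 ?gt_eqF.
rewrite add0e; split; last exact: poweR_lty.
by apply: lty_poweRy; rewrite invr_eq0 gt_eqF.
Qed.

End BesovOfRandomSeries.

Section SmallSets.
Context (R : realType) (disp : measure_display) (Omega : measurableType disp)
  (P : probability Omega R).

Lemma negligible_small (A : set Omega) :
  (forall e : R, 0 < e -> exists B, [/\ measurable B, A `<=` B & (P B <= e%:E)%E]) ->
  P.-negligible A.
Proof.
move=> H.
have /choice[B HB] : forall n : nat, exists B,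
    [/\ measurable B, A `<=` B & (P B <= (n.+1%:R^-1)%:E)%E].
  by move=> n; apply: H; rewrite invr_gt0.
have mB : measurable (\bigcap_n B n) by apply: bigcapT_measurable => n; have [] := HB n.
exists (\bigcap_n B n); split=> //; last by move=> w Aw n _; have [_ + _] := HB n; exact.
apply/eqP; rewrite eq_le measure_ge0 andbT; apply/lee_addgt0Pr => e e0; rewrite add0e.
have [n _ /(_ n (leqnn n))] := near_infty_natSinv_lt (PosNum e0).
move=> /= ne.
have [mBn _ PBn] := HB n.
apply: (@le_trans _ _ (P (B n))); last by apply: le_trans PBn _; rewrite lee_fin ltW.
by apply: le_measure; rewrite ?inE// => w; apply.
Qed.

(** The intersections of tails increase, and each lies in some F n with n >= n0. *)
Lemma prob_liminf_le (F : nat -> set Omega) (n0 : nat) (b : R) :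
  (forall n, measurable (F n)) -> (forall n, (n0 <= n)%N -> (P (F n) <= b%:E)%E) ->
  measurable (\bigcup_m \bigcap_(n in [set n | (m <= n)%N]) F n) /\
  (P (\bigcup_m \bigcap_(n in [set n | (m <= n)%N]) F n) <= b%:E)%E.
Proof.
move=> mF Fb; pose G m := \bigcap_(n in [set n | (m <= n)%N]) F n.
have mG m : measurable (G m) by exact: bigcap_measurableType.
have mU : measurable (\bigcup_m G m) by exact: bigcupT_measurable.
split=> //.
have Ghomo : {homo G : n m / (n <= m)%N >-> (n <= m)%O}.
  move=> n m nm; apply/subsetPset => w Gw k /= mk; apply: Gw; exact: leq_trans mk.
have /cvg_lim <-// := @nondecreasing_cvg_mu _ _ _ P _ mG mU Ghomo.
apply: lime_le.
  apply: ereal_nondecreasing_is_cvgn => n m nm; apply: le_measure; rewrite ?inE//.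
  by apply/subsetPset; exact: Ghomo.
near=> m; apply: (@le_trans _ _ (P (F (maxn m n0)))); last by apply: Fb; exact: leq_maxr.
apply: le_measure; rewrite ?inE//.
by move=> w; apply; exact: leq_maxl.
Unshelve. all: by end_near. Qed.

End SmallSets.

(** * The law of one coefficient *)

Section XLaw.
Context (R : realType) (disp : measure_display) (Omega : measurableType disp)
  (P : probability Omega R) (d : nat) (kappa p c : R)
  (X : nat -> 'rV[int]_d -> 'I_(2 ^ d - 1) -> {RV P >-> R}).
Local Notation Zd := 'rV[int]_d.
Hypothesis Xlaw : forall j k l A, measurable A ->
  distribution P (X j k l) A = (\int[lebesgue_measure]_(x in A)
    (c * expR (- (2 * kappa `^ p)^-1 * `|x| `^ p))%:E)%E.

Definition Xdens (x : R) : R := c * expR (- (2 * kappa `^ p)^-1 * `|x| `^ p).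

Lemma measurable_Xdens : measurable_fun setT Xdens.
Proof.
apply: measurable_funM => //; apply: measurableT_comp; first exact: measurable_expR.
apply: measurable_funM => //.
apply: (@measurableT_comp _ _ _ _ _ _ (fun y => y `^ p)); first exact: measurable_powR.
exact: (@normr_measurable R setT).
Qed.

Lemma Xdens_le x : `|Xdens x| <= `|c|.
Proof.
rewrite normrM -[leRHS]mulr1 ler_wpM2l// ger0_norm ?expR_ge0//.
rewrite -expR0 ler_expR mulNr oppr_le0 mulr_ge0 ?powR_ge0// invr_ge0.
by rewrite mulr_ge0 ?powR_ge0.
Qed.

Lemma prob_X_itv_le j k l (a b M : R) : a <= b ->
  (forall x, a <= x <= b -> `|Xdens x| <= M) ->
  (P (X j k l @^-1` `[a, b]%classic) <= (M * (b - a))%:E)%E.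
Proof.
move=> ab XM; have := Xlaw j k l (measurable_itv `[a, b]); rewrite /distribution /= /pushforward => ->.
apply: le_trans (lee_abs _) _.
have mX : measurable_fun `[a, b]%classic (EFin \o Xdens).
  by apply/measurable_EFinP/measurable_funTS; exact: measurable_Xdens.
apply: le_trans (@le_abse_integral _ _ _ lebesgue_measure `[a, b]%classic _ _ mX) _ => //.
have -> : (M * (b - a))%:E = (\int[lebesgue_measure]_(x in `[a, b]) M%:E)%E.
  rewrite integral_cst//= lebesgue_measure_itv/= lte_fin.
  case: ltP => [_|ba]; first by rewrite -EFinB -EFinM.
  have -> : a = b by apply/eqP; rewrite eq_le ab.
  by rewrite subrr mulr0 mule0.
by apply: ge0_le_integral => //; apply: measurableT_comp mX.
Qed.

Lemma prob_X_itv j k l (a b : R) : a <= b ->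
  (P (X j k l @^-1` `[a, b]%classic) <= (`|c| * (b - a))%:E)%E.
Proof. by move=> ab; apply: prob_X_itv_le => // x _; exact: Xdens_le. Qed.

Definition far (v : R) : set R := [set x | v <= `|x|].

Lemma measurable_far v : measurable (far v).
Proof.
rewrite (_ : far v = (fun x : R => `|x|) @^-1` `[v, +oo[%classic).
  by rewrite -[X in measurable X]setTI; exact: (@normr_measurable R setT).
by apply/seteqP; split=> x /=; rewrite in_itv/= andbT.
Qed.

(** A bounded density gives the interval [-v, v] a probability at most 2 |c| v. *)
Lemma prob_far (l : 'I_(2 ^ d - 1)) : exists v rho : R, [/\ 0 < v, 0 < rho <= 1 &
  forall j k l, P (X j k l @^-1` far v) = rho%:E].
Proof.
(* this makes 2 |c| v at most 1 / 2 *)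
pose v : R := (4 * (`|c| + 1))^-1.
have c1 : 0 < `|c| + 1 by rewrite ltr_wpDl.
have v0 : 0 < v by rewrite invr_gt0 mulr_gt0.
pose rhoE : \bar R := (\int[lebesgue_measure]_(x in far v) (Xdens x)%:E)%E.
have PE j k l1 : P (X j k l1 @^-1` far v) = rhoE.
  by have := Xlaw j k l1 (measurable_far v); rewrite /distribution /= /pushforward => ->.
pose j := 0%N; pose k : Zd := 0; pose Near : set R := `[(- v), v]%classic.
have mX : measurable (X j k l @^-1` far v).
  by rewrite -[X in measurable X]setTI; exact: measurable_funPT (measurable_far v).
have mN : measurable (X j k l @^-1` Near).
  by rewrite -[X in measurable X]setTI; exact: measurable_funPT (measurable_itv _).
have Pfin : P (X j k l @^-1` far v) \is a fin_num by exact: fin_num_measure.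
exists v, (fine (P (X j k l @^-1` far v))); split=> //; last first.
  by move=> j' k' l'; rewrite fineK// !PE.
apply/andP; split; last by rewrite -lee_fin fineK// probability_le1.
have : (1 <= P (X j k l @^-1` far v) + P (X j k l @^-1` Near))%E.
  rewrite -(probability_setT P); apply: le_trans (measureU2 _ mX mN).
  apply: le_measure; rewrite ?inE//; first exact: measurableU.
  move=> w _; have [H|H] := leP v `|X j k l w|; first by left.
  by right; rewrite /Near /= in_itv/= -ler_norml ltW.
have vv : - v <= v by have [] := ge0_cp (ltW v0).
have := @prob_X_itv j k l (- v) v vv.
rewrite -(fineK Pfin) => H1 H2.
have : (1 <= (fine (P (X j k l @^-1` far v)) + `|c| * (v - - v))%:E)%E.
  by apply: le_trans H2 _; rewrite EFinD leeD2l.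
rewrite lee_fin => H; apply: contraTT H; rewrite -leNgt -ltNge => H.
have : `|c| * (v - - v) <= 1 / 2.
  have -> : v - - v = 1 / (2 * (`|c| + 1)) by rewrite /v; field; rewrite gt_eqF.
  rewrite mulrA mulr1 ler_pdivrMr ?mulr_gt0//; have := normr_ge0 c; lra.
lra.
Qed.

End XLaw.

Lemma prod_1sub_ge (R : realFieldType) (I : Type) (s : seq I) (u : I -> R) :
  (forall i, 0 <= u i <= 1) ->
  0 <= \prod_(i <- s) (1 - u i) <= 1 /\ 1 - \sum_(i <- s) u i <= \prod_(i <- s) (1 - u i).
Proof.
move=> u01; elim: s => [|i s [/andP[IH0 IH1] IH2]].
  by rewrite !big_nil subr0 lexx ler01.
rewrite !big_cons; have /andP[u0 u1] := u01 i; split.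
  by rewrite mulr_ge0 ?subr_ge0//= mulr_ile1 ?subr_ge0// lerBlDr lerDl.
have : u i * \prod_(j <- s) (1 - u j) <= u i by rewrite ler_piMr.
by rewrite mulrBl mul1r; move: IH2; lra.
Qed.

(** * Divergence at the critical exponent *)

Section MarkedPopulation.
Context (R : realType) (disp : measure_display) (Omega : measurableType disp)
  (P : probability Omega R) (d : nat) (beta kappa p c : R)
  (t : nat -> 'rV[int]_d -> {RV P >-> R})
  (X : nat -> 'rV[int]_d -> 'I_(2 ^ d - 1) -> {RV P >-> R}).
Local Notation Zd := 'rV[int]_d.
Hypothesis tindep : mutually_independent (fun n : nat * Zd => t n.1 n.2).
Hypothesis tlaw : forall j k A, measurable A ->
  distribution P (t j k) A = uniform_prob (@ltr01 R) A.
Hypothesis Xindep : mutually_independent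
  (fun n : nat * Zd * 'I_(2 ^ d - 1) => X n.1.1 n.1.2 n.2).
Hypothesis Xlaw : forall j k l A, measurable A ->
  distribution P (X j k l) A = (\int[lebesgue_measure]_(x in A)
    (c * expR (- (2 * kappa `^ p)^-1 * `|x| `^ p))%:E)%E.

Definition tree_events : set (set Omega) :=
  [set B | exists n, B = [set w | tree beta (fun j k => t j k w) n]].

Definition X_events : set (set Omega) :=
  [set B | exists j k l A, measurable A /\ B = X j k l @^-1` A].

Hypothesis TX : independent_generated P tree_events X_events.
Hypothesis beta0 : 0 < beta.
Hypothesis beta1 : beta <= 1.
Local Notation Ex f := (\int[P]_w f w).
Local Notation Lev := (Lev beta t).

Let beta01 : 0 <= beta <= 1. Proof. by rewrite ltW. Qed.

Lemma sigma_tree_Lev j k : <<s tree_events >> (Lev j k).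
Proof. by apply: sub_sigma_algebra; exists (j, k). Qed.

Lemma sigma_fin_bigcap (G : set (set Omega)) (I : eqType) (s : seq I) (F : I -> set Omega) :
  (forall i, i \in s -> <<s G >> (F i)) -> <<s G >> (\bigcap_(i in [set` s]) F i).
Proof.
move=> GF.
exact: (@fin_bigcap_measurable _ (g_sigma_algebraType G) _ _ F (finite_seq s) GF).
Qed.

Definition extinct (i : nat) : set Omega := [set w | forall k, ~ Lev i k w].

Lemma extinctE i : extinct i = \bigcap_(k in [set` nodes d i]) ~` Lev i k.
Proof.
apply/seteqP; split=> [w H k _|w H k]; first exact: H.
by move=> /[dup] /level_nodes ki; exact: H.
Qed.

Lemma measurable_extinct i : measurable (extinct i).
Proof.
rewrite extinctE; apply: fin_bigcap_measurable => // k _.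
by apply: measurableC; exact: measurable_Lev.
Qed.

Lemma prob_extinct i : P (extinct i) = (pop_gf beta t i 0)%:E.
Proof.
have mE := measurable_extinct i.
rewrite -(fineK (fin_num_measure P _ mE)) -Ex_indic//; congr (_%:E).
rewrite /pop_gf; apply: eq_Rintegral => w _.
have [H|H] := pselect (extinct i w).
  rewrite indicE mem_set// big1// => k _.
  by rewrite [X in _ * X]indicE memNset ?mulr0 ?subr0//; exact: H.
rewrite indicE memNset//.
have [k ki Lk] : exists2 k, k \in nodes d i & Lev i k w.
  apply: contrapT => HH; apply: H => k Lk; apply: HH; exists k => //.
  exact: level_nodes Lk.
by rewrite (big_rem k)//= subr0 indicE mem_set// mulr1 subrr mul0r.
Qed.

Section Marks.
Context (l0 : 'I_(2 ^ d - 1)) (v rho : R).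
Hypothesis Pfar : forall j k l, P (X j k l @^-1` far v) = rho%:E.

Definition mark (n : nat) (k : Zd) : set Omega := X n k l0 @^-1` far v.

Lemma measurable_mark n k : measurable (mark n k).
Proof.
by rewrite -[mark n k]setTI; exact: measurable_funPT (measurable_far v).
Qed.

Definition marked (n : nat) (w : Omega) : R :=
  \sum_(k <- nodes d n) \1_(Lev n k `&` mark n k) w.

(** The marked nodes of level n are a thinning of the nodes of level n. *)
Lemma marked_gf n (a : R) :
  Ex (fun w => \prod_(k <- nodes d n) (1 - a * \1_(Lev n k `&` mark n k) w)) =
  pop_gf beta t n (1 - a * rho).
Proof.
pose GG := [set G | exists s : seq (nat * Zd), G = \bigcap_(i in [set` s]) Lev i.1 i.2].
rewrite (@thinning _ _ _ _ _ (mark n) (Lev n) _ rho GG)//.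
- rewrite /pop_gf; apply: eq_Rintegral => w _; apply: eq_bigr => k _.
  by rewrite opprB addrCA subrr addr0.
- move=> k; exact: measurable_mark.
- move=> _ [s ->]; apply: fin_bigcap_measurable => // i _; exact: measurable_Lev.
- move=> _ _ [s ->] [s' ->]; exists (s ++ s').
  apply/seteqP; split=> [w [ws ws'] i /=|w H].
    by rewrite mem_cat => /orP[/ws|/ws'].
  by split=> i /= ii; apply: H; rewrite /= mem_cat ii ?orbT.
- move=> _ s [s' ->] us; rewrite TX.
  + congr (_ * _)%E.
    have -> : \bigcap_(k in [set` s]) mark n k =
        \bigcap_(i in [set` [seq (n, k, l0) | k <- s]]) (X i.1.1 i.1.2 i.2 @^-1` far v).
      apply/seteqP; split=> [w ws i /= /mapP[k ks ->]|w H k /= ks]; first exact: ws.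
      by apply: (H (n, k, l0)); rewrite /= map_f.
    rewrite (Xindep (A := fun=> far v)).
    * rewrite big_map (eq_bigr (fun=> rho%:E)) => [|i _]; last exact: Pfar.
      elim: s {us} => [|i s IHs]; rewrite ?big_nil ?big_cons//.
      by rewrite IHs -EFinM exprS.
    * by rewrite map_inj_uniq// => k k' [].
    * by move=> _; exact: measurable_far.
  + by apply: sigma_fin_bigcap => i _; exact: sigma_tree_Lev.
  + apply: sigma_fin_bigcap => k _; apply: sub_sigma_algebra.
    by exists n, k, l0, (far v); split => //; exact: measurable_far.
- by exists [::]; apply/seteqP; split.
- move=> k _; exists [:: (n, k)]; apply/seteqP; split=> [w Lw i /=|w H].
    by rewrite inE => /eqP ->.
  by apply: (H (n, k)); rewrite /= inE.
- exact: uniq_nodes.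
Qed.

Definition few (n : nat) (a eta : R) : set Omega := [set w | a * marked n w <= eta].

Lemma measurable_marked n : measurable_fun setT (marked n).
Proof.
apply: measurable_sum => k; apply: measurable_indic.
by apply: measurableI; [exact: measurable_Lev|exact: measurable_mark].
Qed.

Lemma measurable_few n a eta : measurable (few n a eta).
Proof.
rewrite (_ : few n a eta = (fun w => a * marked n w) @^-1` `]-oo, eta]%classic).
  rewrite -[X in measurable X]setTI; apply: measurable_funM => //.
  exact: measurable_marked.
by apply/seteqP; split=> w; rewrite /few /= in_itv.
Qed.

(** Markov's inequality for the product of the factors 1 - a 1_A, which is at least
    1 - a times the number of marked nodes. *)
Lemma prob_few n (a eta : R) : 0 <= a <= 1 -> 0 <= eta ->
  (P (few n a eta) <= (pop_gf beta t n (1 - a * rho) + eta)%:E)%E.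
Proof.
move=> a01 eta0; have mD := measurable_few n a eta.
have mLM k : measurable (Lev n k `&` mark n k).
  by apply: measurableI; [exact: measurable_Lev|exact: measurable_mark].
have fD : P (few n a eta) \is a fin_num by exact: fin_num_measure.
rewrite -(fineK fD) lee_fin -marked_gf.
have bp : bounded_mfun (fun w => \prod_(k <- nodes d n) (1 - a * \1_(Lev n k `&` mark n k) w)).
  by apply: bounded_mfun_prod => k _; exact: bounded_mfun_sub_indic.
have := @Ex_le _ _ _ P (fun w => (1 - eta) * \1_(few n a eta) w) _
  (bounded_mfunM (bounded_mfun_cst _ (1 - eta)) (bounded_mfun_indic R mD)) bp.
have H w : (1 - eta) * \1_(few n a eta) w <=
    \prod_(k <- nodes d n) (1 - a * \1_(Lev n k `&` mark n k) w).
  have u01 (k : Zd) : 0 <= a * \1_(Lev n k `&` mark n k) w <= 1.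
    by rewrite indicE; case: (_ \in _); rewrite ?mulr1// mulr0 lexx ler01.
  have [/andP[p0 _] p2] := prod_1sub_ge (nodes d n) u01.
  rewrite [X in _ * X]indicE; case: (boolP (w \in _)); rewrite ?mulr0// mulr1 inE => wD.
  by apply: le_trans p2; rewrite lerD2l lerN2 -mulr_sumr.
move=> /(_ H); rewrite RintegralZl//; last exact/bounded_mfun_integrable/bounded_mfun_indic.
rewrite Ex_indic// mulrBl mul1r lerBlDr => /le_trans; apply.
rewrite lerD2l -[leRHS]mulr1 ler_wpM2l//.
by rewrite -lee_fin fineK// probability_le1.
Qed.

Lemma extinct_few i n a eta : (i <= n)%N -> 0 <= eta -> extinct i `<=` few n a eta.
Proof.
move=> ni eta0 w wi; rewrite /few /= /marked big1 ?mulr0// => k _.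
rewrite indicE memNset// => -[Lk _].
have [j {ni} jE] : exists j, n = (j + i)%N by exists (n - i)%N; rewrite subnK.
move: Lk; rewrite {}jE; elim: j k => [|j IHj] k; first exact: wi.
by move=> [/IHj].
Qed.

End Marks.

Section Survival.
Context (l0 : 'I_(2 ^ d - 1)).
Hypothesis m1 : 1 < (2 ^ d)%:R * beta.
Hypothesis p0 : 0 < p.
Local Notation m := ((2 ^ d)%:R * beta).

(** The event that few nodes are marked contains extinction at level i, whose
    probability is an iterate of the generating function at 0. Subtracting it
    leaves the gap between two orbits, which is small for i large, uniformly in n. *)
Lemma prob_few_surviving (v rho : R) (e : R) : 0 < rho <= 1 -> 0 < e ->
  (forall j k l, P (X j k l @^-1` far v) = rho%:E) ->
  exists i, forall n, (i <= n)%N ->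
    (P (few l0 v n (m ^- (n - i)) e `\` extinct i) <= (e + e)%:E)%E.
Proof.
move=> rho01 e0 Pfar.
have m0 : 0 < m by exact: lt_trans m1.
have [M NE] : exists M, (2 ^ d = M.+2)%N.
  case E : (2 ^ d)%N m1 => [|[|M]] m1'; last by exists M.
  - by move: m1'; rewrite mul0r ltr10.
  - by move: m1'; rewrite mul1r ltNge beta1.
pose f := genf M beta.
have gE n x : pop_gf beta t n x = iter n f x.
  by rewrite pop_gfE// NE.
have mE : (2 ^ d)%:R = M.+2%:R :> R by rewrite NE.
move: m1 m0; rewrite mE => m1' {}m0.
have rho0 : 0 < rho by have /andP[] := rho01.
(* the bound of iter_genf_gap after n - i steps from y = rho m^-(n - i) *)
pose D := rho^-1 + M.+2%:R * beta / (M.+2%:R * beta - 1).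
have mm : 0 < M.+2%:R * beta - 1 by rewrite subr_gt0.
have D1 : 1 <= D.
  have : 1 <= rho^-1 by rewrite invr_ge1 ?unitfE ?gt_eqF//; have /andP[] := rho01.
  have : 0 < M.+2%:R * beta / (M.+2%:R * beta - 1) by rewrite divr_gt0.
  by rewrite /D; lra.
have D0 : 0 < D by exact: lt_le_trans D1.
have d01 : 0 < D^-1 <= 1 by rewrite invr_gt0 D0/= invf_le1.
have [i Hi] := iter_genf_merge beta0 beta1 m1' d01 e0.
exists i => n ni.
have a01 : 0 <= (M.+2%:R * beta) ^- (n - i) <= 1.
  rewrite invr_ge0 exprn_ge0 ?(ltW m0)//= invf_le1 ?exprn_gt0//.
  exact: exprn_ege1 (ltW m1').
have mF := measurable_few l0 v n ((M.+2%:R * beta) ^- (n - i)) e.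
have mEx := measurable_extinct i.
rewrite measureD//; last first.
  by apply: le_lt_trans (probability_le1 _ mF) _; rewrite ltry.
have -> : few l0 v n ((M.+2%:R * beta) ^- (n - i)) e `&` extinct i = extinct i.
  by apply/setIidr; apply: extinct_few => //; exact: ltW.
rewrite [X in (_ - X)%E]prob_extinct leeBlDr ?fin_numE//.
apply: le_trans (prob_few l0 Pfar n a01 (ltW e0)) _.
rewrite -EFinD lee_fin !gE.
suff : iter n f (1 - (M.+2%:R * beta) ^- (n - i) * rho) <= iter i f (1 - D^-1).
  by move: Hi; rewrite -/f; lra.
rewrite -{1}(subnKC ni) iterD.
have y01 : 0 < (M.+2%:R * beta) ^- (n - i) * rho <= 1.
  move: a01 rho01 => /andP[_ a1] /andP[_ r1].
  rewrite mulr_gt0 ?invr_gt0 ?exprn_gt0//=.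
  by rewrite -[leRHS]mulr1 ler_pM ?invr_ge0 ?exprn_ge0 ?(ltW m0) ?(ltW rho0).
have [g1 g2] := iter_genf_gap beta0 beta1 m1' (n - i) y01.
have y0 : 0 <= 1 - (M.+2%:R * beta) ^- (n - i) * rho <= 1.
  by move: y01 => /andP[y0 y1]; rewrite subr_ge0 y1 lerBlDr lerDl ltW.
apply: iter_genf_mono => //.
- by rewrite in_itv/=; exact: iter_genf_bounds.
- by rewrite in_itv/=; move: d01 => /andP[d0 d1]; rewrite subr_ge0 d1 lerBlDr lerDl ltW.
rewrite lerBrDr addrC -lerBrDr -[leRHS]invrK lef_pV2 ?posrE ?invr_gt0//.
by move: g2; rewrite mulrA divff ?mul1r// expf_neq0// gt_eqF.
Qed.

(** The terms of a convergent series tend to 0, so m^-n times the number of marked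
    nodes of level n would tend to 0; while the tree survives this has arbitrarily
    small probability by prob_few_surviving. *)
Lemma extinct_or_besov_series_diverges :
  {ae P, forall w, (exists i, extinct i w) \/
    ~ (\sum_(0 <= j <oo) (m ^- j *
        level_mass p beta (fun j k => t j k w) (fun j k l => X j k l w) j)%:E < +oo)%E}.
Proof.
have [v [rho [v0 rho01 Pfar]]] := prob_far Xlaw l0.
have m0 : 0 < m by exact: lt_trans m1.
apply: negligible_small => e e_gt0.
have e2 : 0 < e / 2 by rewrite divr_gt0.
have [i Hi] := prob_few_surviving rho01 e2 Pfar.
pose F n := few l0 v n (m ^- (n - i)) (e / 2) `\` extinct i.
have mF n : measurable (F n).
  by apply: measurableD; [exact: measurable_few|exact: measurable_extinct].
have [mU PU] := @prob_liminf_le _ _ _ P F i (e / 2 + e / 2) mF Hi.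
exists (\bigcup_k \bigcap_(n in [set n | (k <= n)%N]) F n); split=> //; last first.
  by apply: le_trans PU _; rewrite -splitr.
move=> w /= /not_orP[/forallNP wext /contrapT fin].
pose u (j : nat) : \bar R := (m ^- j *
        level_mass p beta (fun j k => t j k w) (fun j k l => X j k l w) j)%:E.
have u0 j : (0 <= u j)%E.
  by rewrite lee_fin mulr_ge0 ?level_mass_ge0// invr_ge0 exprn_ge0// ltW.
have tail := nneseries_tail_cvg fin (fun j _ => u0 j).
have vp : 0 < v `^ p by rewrite powR_gt0.
(* if the n-th term is below eps, then m^-(n - i) times the number of marked
   nodes is below e / 2 *)
pose eps := m ^- i * v `^ p * (e / 2).
have eps0 : 0 < eps by rewrite !mulr_gt0// invr_gt0 exprn_gt0.
have [K _ HK] : \forall n \near \oo, (\sum_(n <= k <oo) u k < eps%:E)%E.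
  move/fine_cvgP : tail => [/= tfin].
  move=> /cvgrPdist_lt /(_ _ eps0) tl; near=> n.
  have tn : (\sum_(n <= k <oo) u k)%E \is a fin_num by near: n; exact: tfin.
  rewrite -(fineK tn) lte_fin.
  have : `|0 - fine (\sum_(n <= k <oo) u k)%E| < eps by near: n; exact: tl.
  by rewrite sub0r normrN; apply: le_lt_trans; exact: ler_norm.
exists (maxn K i) => // n /=; rewrite geq_max => /andP[Kn ni]; split; last exact: wext.
have un : (u n < eps%:E)%E.
  apply: le_lt_trans (HK n Kn).
  apply: le_trans (nneseries_lim_ge n.+1 (P := xpredT) (fun k _ _ => u0 k)).
  by rewrite big_nat1.
have mE : marked l0 v n w * v `^ p <=
    level_mass p beta (fun j k => t j k w) (fun j k l => X j k l w) n.
  rewrite /marked mulr_suml /level_mass; apply: ler_sum => k _.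
  rewrite indicE; case: (boolP (w \in _)) => [|_]; last first.
    by rewrite mul0r; apply: sumr_ge0 => l _; case: ifP => // _; rewrite powR_ge0.
  rewrite inE => -[Lk Mk]; rewrite mul1r asboolT; last exact: Lk.
  rewrite (bigD1 l0)//= -[leLHS]addr0 lerD//.
    by rewrite ge0_ler_powR ?nnegrE ?(ltW v0)//; exact: ltW.
  by apply: sumr_ge0 => l _; rewrite powR_ge0.
rewrite /few /=.
have : m ^- n * (marked l0 v n w * v `^ p) < eps.
  move: un; rewrite lte_fin; apply: le_lt_trans; rewrite ler_wpM2l//.
  by rewrite invr_ge0 exprn_ge0// ltW.
rewrite /eps; move: (marked l0 v n w) => N.
rewrite -{1}(subnK ni) exprD invfM.
move=> H; apply: ltW.
have c0 : 0 < m ^- i * v `^ p by rewrite mulr_gt0// invr_gt0 exprn_gt0.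
rewrite -(ltr_pM2l c0); apply: le_lt_trans H.
by rewrite le_eqVlt; apply/orP; left; apply/eqP; ring.
Unshelve. all: by end_near. Qed.

Lemma extinct_tau (w : Omega) i : extinct i w ->
  ~ (tau R (tree beta (fun j k => t j k w)) !=set0).
Proof.
move=> wi [x tx].
have wi1 : extinct i.+1 w by move=> k [Lk _]; exact: wi Lk.
by have [k Lk _] := tx i.+1 isT; exact: (wi1 k).
Qed.

(** At t0 = s - gamma / p the weight 2^(jp(t0 - s)) equals m^-j. *)
Lemma ae_not_besov (s gamma : R) : 2 `^ gamma = m ->
  {ae P, forall w, tau R (tree beta (fun j k => t j k w)) !=set0 ->
    ~ besov_space (s - gamma / p) p
       (random_wseries s p (tree beta (fun j k => t j k w)) (fun j k l => X j k l w))}.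
Proof.
move=> gE; apply: filterS extinct_or_besov_series_diverges => w.
move=> [[i wi] /(extinct_tau wi)//|div _ /(besov_spaceP _ _ _ _ _ p0)].
congr (~ (_ < _)%E): div.
apply: eq_eseriesr => j _; congr ((_ * _)%:E).
rewrite -gE -powR_mulrn ?powR_ge0// -powRrM -powRN; congr (_ `^ _).
by field; rewrite gt_eqF.
Qed.

End Survival.
End MarkedPopulation.

(** * Moments of one coefficient *)

Lemma nneseries_geometric_lty (R : realType) (K q : R) (u : nat -> R) :
  0 <= K -> 0 < q < 1 -> (forall n, 0 <= u n <= K * q ^+ n) ->
  (\sum_(0 <= n <oo) (u n)%:E < +oo)%E.
Proof.
move=> K0 /andP[q0 q1] uK.
have u0 n : (0 <= (u n)%:E)%E by rewrite lee_fin; have /andP[] := uK n.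
apply: (@le_lt_trans _ _ (K / (1 - q))%:E); last exact: ltry.
apply: lime_le; first exact: is_cvg_nneseries.
apply: nearW => n; rewrite sumEFin lee_fin.
apply: (@le_trans _ _ (series (geometric K q) n)).
  by apply: ler_sum => i _; have /andP[] := uK i.
by apply: geometric_le_lim => //; rewrite gtr0_norm.
Qed.

Section Moments.
Context (R : realType) (disp : measure_display) (Omega : measurableType disp)
  (P : probability Omega R) (d : nat) (kappa p c : R)
  (X : nat -> 'rV[int]_d -> 'I_(2 ^ d - 1) -> {RV P >-> R}).
Hypothesis Xlaw : forall j k l A, measurable A ->
  distribution P (X j k l) A = (\int[lebesgue_measure]_(x in A)
    (c * expR (- (2 * kappa `^ p)^-1 * `|x| `^ p))%:E)%E.
Hypothesis kappa0 : 0 < kappa.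
Hypothesis p1 : 1 <= p.
Local Notation a := ((2 * kappa `^ p)^-1).

Let a0 : 0 < a. Proof. by rewrite invr_gt0 mulr_gt0// powR_gt0. Qed.
Let p0 : 0 <= p. Proof. exact: le_trans p1. Qed.

(** The p-th moment is bounded through the probabilities of these sets, on which
    the density is at most |c| exp(-n^p / (2 kappa^p)). *)
Definition shell (n : nat) : set R := [set x | n%:R <= `|x| < n.+1%:R].

Lemma measurable_shell n : measurable (shell n).
Proof.
rewrite (_ : shell n = (fun x : R => `|x|) @^-1` `[n%:R, n.+1%:R[%classic).
  by rewrite -[X in measurable X]setTI; exact: (@normr_measurable R setT).
by apply/seteqP; split=> x /=; rewrite in_itv.
Qed.

Lemma measurable_X_shell j k l n : measurable (X j k l @^-1` shell n).
Proof. by rewrite -[X in measurable X]setTI; exact: measurable_funPT (measurable_shell n). Qed.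

Lemma prob_shell j k l n :
  (P (X j k l @^-1` shell n) <= (2 * (`|c| * expR (- a * n%:R `^ p)))%:E)%E.
Proof.
set M := `|c| * _.
have XM x : n%:R <= `|x| -> `|Xdens kappa p c x| <= M.
  move=> nx; rewrite /Xdens normrM ler_wpM2l// ger0_norm ?expR_ge0// ler_expR.
  by rewrite !mulNr lerN2 ler_wpM2l ?(ltW a0)// ge0_ler_powR ?nnegrE.
have mI j' k' l' (I : interval R) : measurable (X j' k' l' @^-1` [set` I]).
  by rewrite -[X in measurable X]setTI; exact: measurable_funPT (measurable_itv _).
apply: (@le_trans _ _ (P (X j k l @^-1` `[n%:R, n.+1%:R]%classic `|`
    X j k l @^-1` `[(- n.+1%:R), (- n%:R)]%classic))).
  apply: le_measure; rewrite ?inE; [exact: measurable_X_shell|exact: measurableU|].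
  move=> w /= /andP[]; rewrite !in_itv/= ler_normr ltr_norml => /orP[nx|nx] /andP[x1 x2].
    by left; rewrite nx ltW.
  by right; rewrite (ltW x1)/= lerNr.
apply: le_trans (measureU2 _ (mI _ _ _ _) (mI _ _ _ _)) _.
rewrite mulrDl mul1r EFinD; apply: leeD.
  apply: le_trans (prob_X_itv_le Xlaw _ _ _ (M := M) _ _) _.
  - by rewrite ler_nat.
  - by move=> x /andP[nx _]; apply: XM; apply: le_trans nx (ler_norm _).
  - by rewrite -natrB// subSnn mulr1.
apply: le_trans (prob_X_itv_le Xlaw _ _ _ (M := M) _ _) _.
- by rewrite lerN2 ler_nat.
- by move=> x /andP[_ nx]; apply: XM; rewrite ler_normr lerNr nx orbT.
- by rewrite opprK addrC -natrB// subSnn mulr1.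
Qed.

Definition shell_weight (n : nat) : R :=
  n.+1%:R `^ p * (2 * (`|c| * expR (- a * n%:R `^ p))).

Lemma shell_weight_ge0 n : 0 <= shell_weight n.
Proof. by rewrite !mulr_ge0 ?powR_ge0 ?expR_ge0. Qed.

(** As p >= 1, n^p >= n; and y exp(-ay) <= (2/a) exp(-ay/2), so the terms decay
    geometrically. *)
Lemma shell_weight_summable : (\sum_(0 <= n <oo) (shell_weight n)%:E < +oo)%E.
Proof.
(* the maximum with 1 takes care of the term n = 0 *)
pose K : R := Num.max 1 (2 `^ p * (2 / a)) * (2 * `|c|).
apply: (@nneseries_geometric_lty _ K (expR (- (a / 2)))).
- by rewrite mulr_ge0// le_max ler01.
- by rewrite expR_gt0/= expR_lt1 oppr_lt0 divr_gt0.
move=> n; rewrite shell_weight_ge0/= /shell_weight /K.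
set N := n%:R `^ p.
suff H : n.+1%:R `^ p * expR (- a * N) <=
    Num.max 1 (2 `^ p * (2 / a)) * expR (- (a / 2)) ^+ n.
  have c0 : 0 <= 2 * `|c| by rewrite mulr_ge0.
  by have := ler_wpM2r c0 H; congr (_ <= _); ring.
case: n @N => [|n] N.
  by rewrite powR1 /N powR0 ?gt_eqF ?(lt_le_trans _ p1)// mulr0 expR0 mulr1 expr0 mulr1 le_max lexx.
have N1 : n.+1%:R <= N by rewrite /N -{1}[n.+1%:R]powRr1// ler_powR// ler1n.
apply: (@le_trans _ _ (2 `^ p * (2 / a) * expR (- (a / 2)) ^+ n.+1)); last first.
  by rewrite ler_wpM2r ?exprn_ge0 ?expR_ge0// le_max lexx orbT.
have -> : expR (- a * N) = expR (- (a / 2) * N) * expR (- (a / 2) * N).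
  by rewrite -expRD; congr expR; move: a => b; field.
rewrite mulrA; apply: ler_pM; rewrite ?mulr_ge0 ?powR_ge0 ?expR_ge0//; last first.
  by rewrite -expRM_natr ler_expR !mulNr lerN2 ler_wpM2l// divr_ge0// ltW.
apply: (@le_trans _ _ (2 `^ p * N * expR (- (a / 2) * N))).
  rewrite ler_wpM2r ?expR_ge0// /N -powRM// ge0_ler_powR ?nnegrE ?mulr_ge0//.
  by rewrite -natrM ler_nat mul2n -addnn addSn ltnS leq_addl.
rewrite -mulrA ler_wpM2l ?powR_ge0//.
rewrite mulNr expRN ler_pdivrMr ?expR_gt0//.
have := expR_ge1Dx (a / 2 * N) => H.
have : 2 / a * (a / 2 * N) <= 2 / a * expR (a / 2 * N).
  by rewrite ler_wpM2l ?divr_ge0 ?(ltW a0)//; lra.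
by rewrite mulrA mulf_div [2 * a]mulrC divff ?mul1r// mulf_neq0// gt_eqF.
Qed.

Lemma powR_le_shells (x : R) :
  ((`|x| `^ p)%:E <= \sum_(0 <= n <oo) (n.+1%:R `^ p * \1_(shell n) x)%:E)%E.
Proof.
apply: le_trans (nneseries_lim_ge (Num.truncn `|x|).+1 _); last first.
  by move=> n _ _; rewrite lee_fin mulr_ge0 ?powR_ge0.
rewrite big_nat_recr//= -[leLHS]add0e; apply: leeD.
  by apply: sume_ge0 => n _; rewrite lee_fin mulr_ge0 ?powR_ge0.
have xn : (Num.truncn `|x|)%:R <= `|x| < (Num.truncn `|x|).+1%:R by exact: truncn_itv.
rewrite indicE mem_set// mulr1 lee_fin ge0_ler_powR ?nnegrE//.
by have /andP[_ /ltW] := xn.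
Qed.

Lemma moment_le : exists2 M : R, 0 <= M & forall j k l B, measurable B ->
  (forall n, P (B `&` X j k l @^-1` shell n) = P B * P (X j k l @^-1` shell n))%E ->
  (\int[P]_w (\1_B w * `|X j k l w| `^ p)%:E <= P B * M%:E)%E.
Proof.
have S0 : (0 <= \sum_(0 <= n <oo) (shell_weight n)%:E)%E.
  by apply: nneseries_ge0 => n _ _; rewrite lee_fin shell_weight_ge0.
have Sfin : (\sum_(0 <= n <oo) (shell_weight n)%:E)%E \is a fin_num.
  by rewrite ge0_fin_numE// shell_weight_summable.
exists (fine (\sum_(0 <= n <oo) (shell_weight n)%:E)%E); first exact: fine_ge0.
move=> j k l B mB ind; rewrite fineK//.
have mBX n : measurable (B `&` X j k l @^-1` shell n).
  by apply: measurableI => //; exact: measurable_X_shell.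
pose g n w : \bar R := (n.+1%:R `^ p * \1_(B `&` X j k l @^-1` shell n) w)%:E.
have g0 n w : (0 <= g n w)%E by rewrite lee_fin mulr_ge0 ?powR_ge0.
have mg n : measurable_fun setT (g n).
  by apply/measurable_EFinP/measurable_funM => //; exact: measurable_indic.
apply: (@le_trans _ _ (\int[P]_w (\sum_(0 <= n <oo) g n w))%E).
  apply: ge0_le_integral => //.
  - apply/measurable_EFinP/measurable_funM; first exact: measurable_indic.
    apply: (@measurableT_comp _ _ _ _ _ _ (fun y => y `^ p)); first exact: measurable_powR.
    by apply: measurableT_comp => //; exact: measurable_funPT.
  - by apply: ge0_emeasurable_sum => [n w _ _|n _]; [exact: g0|exact: mg].
  move=> w _; have [Bw|Bw] := pselect (B w); last first.
    by rewrite indicE memNset// mul0r; apply: nneseries_ge0 => n _ _; exact: g0.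
  rewrite indicE mem_set// mul1r; apply: le_trans (powR_le_shells _) _.
  apply: lee_nneseries => [n _ _|n _]; first by rewrite lee_fin mulr_ge0 ?powR_ge0.
  by rewrite /g !indicE in_setI (mem_set Bw).
rewrite integral_nneseries//.
have fPB : P B \is a fin_num by exact: fin_num_measure.
rewrite -(fineK fPB) -nneseriesZl ?fine_ge0//; last by move=> n _; rewrite lee_fin shell_weight_ge0.
apply: lee_nneseries => [n _ _|n _]; first by apply: integral_ge0 => w _; exact: g0.
rewrite /g (eq_integral (fun w => (n.+1%:R `^ p)%:E * (\1_(B `&` X j k l @^-1` shell n) w)%:E)%E)//.
rewrite ge0_integralZl_EFin ?powR_ge0//; last first.
  by apply/measurable_EFinP; exact: measurable_indic.
have -> : (\int[P]_w (\1_(B `&` X j k l @^-1` shell n) w)%:E =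
    P B * P (X j k l @^-1` shell n))%E by rewrite integral_indic// setIT -ind.
rewrite fineK// /shell_weight EFinM muleCA.
apply: lee_wpmul2l; first exact: measure_ge0.
by rewrite EFinM; apply: lee_wpmul2l; [rewrite lee_fin powR_ge0|exact: prob_shell].
Qed.

End Moments.

(** * Membership below the critical exponent *)

Section BesovMembership.
Context (R : realType) (disp : measure_display) (Omega : measurableType disp)
  (P : probability Omega R) (d : nat) (beta kappa p c : R)
  (t : nat -> 'rV[int]_d -> {RV P >-> R})
  (X : nat -> 'rV[int]_d -> 'I_(2 ^ d - 1) -> {RV P >-> R}).
Local Notation Zd := 'rV[int]_d.
Hypothesis tindep : mutually_independent (fun n : nat * Zd => t n.1 n.2).
Hypothesis tlaw : forall j k A, measurable A ->
  distribution P (t j k) A = uniform_prob (@ltr01 R) A.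
Hypothesis Xlaw : forall j k l A, measurable A ->
  distribution P (X j k l) A = (\int[lebesgue_measure]_(x in A)
    (c * expR (- (2 * kappa `^ p)^-1 * `|x| `^ p))%:E)%E.
Hypothesis TX : independent_generated P (tree_events beta t) (X_events X).
Hypothesis beta01 : 0 <= beta <= 1.
Hypothesis kappa0 : 0 < kappa.
Hypothesis p1 : 1 <= p.
Let p0 : 0 < p. Proof. exact: lt_le_trans p1. Qed.
Local Notation T w := (tree beta (fun j k => t j k w)).
Local Notation mass w := (level_mass p beta (fun j k => t j k w) (fun j k l => X j k l w)).

Lemma level_mass_indic w j : mass w j =
  \sum_(k <- nodes d j) \sum_l \1_(Lev beta t j k) w * `|X j k l w| `^ p.
Proof.
apply: eq_bigr => k _; apply: eq_bigr => l _; rewrite indicE.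
have [Lk|Lk] := pselect (Lev beta t j k w).
  by rewrite asboolT// mem_set// mul1r.
by rewrite asboolF// memNset// mul0r.
Qed.

Lemma measurable_mass_term j k l :
  measurable_fun setT (fun w => (\1_(Lev beta t j k) w * `|X j k l w| `^ p)%:E).
Proof.
apply/measurable_EFinP/measurable_funM.
  by apply: measurable_indic; exact: measurable_Lev.
apply: (@measurableT_comp _ _ _ _ _ _ (fun y => y `^ p)); first exact: measurable_powR.
by apply: measurableT_comp => //; exact: measurable_funPT.
Qed.

Lemma measurable_level_mass j : measurable_fun setT (fun w => (mass w j)%:E).
Proof.
under eq_fun do rewrite level_mass_indic.
apply/measurable_EFinP/measurable_sum => k; apply: measurable_sum => l.
exact/measurable_EFinP/measurable_mass_term.
Qed.

(** There are 2^(dj) possible nodes of level j, each in the tree with probability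
    beta^j, independently of its coefficients. *)
Lemma expected_level_mass : exists2 M : R, 0 <= M & forall j,
  (\int[P]_w (mass w j)%:E <= (((2 ^ d)%:R * beta) ^+ j * M)%:E)%E.
Proof.
have [M M0 HM] := moment_le Xlaw kappa0 p1.
exists ((2 ^ d - 1)%:R * M); first by rewrite mulr_ge0.
move=> j.
have t0 k l w : (0 <= (\1_(Lev beta t j k) w * `|X j k l w| `^ p)%:E)%E.
  by rewrite lee_fin mulr_ge0 ?powR_ge0.
have -> : (\int[P]_w (mass w j)%:E = \sum_(k <- nodes d j) \sum_l
    \int[P]_w (\1_(Lev beta t j k) w * `|X j k l w| `^ p)%:E)%E.
  under eq_integral do rewrite level_mass_indic -sumEFin.
  rewrite ge0_integral_sum//; last 2 first.
  - move=> k; apply/measurable_EFinP/measurable_sum => l.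
    exact/measurable_EFinP/measurable_mass_term.
  - by move=> k w _; rewrite -sumEFin; apply: sume_ge0.
  apply: eq_bigr => k _; under eq_integral do rewrite -sumEFin.
  by rewrite ge0_integral_sum// => l; exact: measurable_mass_term.
apply: (@le_trans _ _ (\sum_(k <- nodes d j) (beta ^+ j * ((2 ^ d - 1)%:R * M))%:E)%E).
  rewrite big_seq [leRHS]big_seq; apply: lee_sum => k kj.
  apply: (@le_trans _ _ (\sum_(l < (2 ^ d - 1)%N) (beta ^+ j * M)%:E)%E); last first.
    by rewrite sumEFin sumr_const card_ord lee_fin -[leLHS]mulr_natl mulrCA.
  apply: lee_sum => l _; rewrite EFinM -(prob_Lev tindep tlaw beta01 kj).
  apply: HM => [|n]; first exact: measurable_Lev.
  apply: TX; apply: sub_sigma_algebra; first by exists (j, k).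
  by exists j, k, l, (@shell R n); split => //; exact: measurable_shell.
rewrite sumEFin big_const_seq count_predT size_nodes iter_addr_0 lee_fin.
rewrite -[leLHS]mulr_natl expnM (natrX _ (2 ^ d)%N). by rewrite exprMn !mulrA.
Qed.

(** The expectations of the terms decay geometrically, with ratio
    2^(p(t0 - s) + gamma) < 1, so their sum is finite almost surely. *)
Lemma ae_besov (s gamma t0 : R) : 2 `^ gamma = (2 ^ d)%:R * beta ->
  t0 < s - gamma / p ->
  {ae P, forall w, besov_space t0 p (random_wseries s p (T w) (fun j k l => X j k l w))}.
Proof.
move=> gE ts; have [M M0 HM] := expected_level_mass.
pose u j w : \bar R := (2 `^ (j%:R * (p * (t0 - s))) * mass w j)%:E.
have u0 j w : (0 <= u j w)%E.
  by rewrite lee_fin mulr_ge0 ?powR_ge0 ?level_mass_ge0.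
have mu j : measurable_fun setT (u j).
  by apply/measurable_EFinP/measurable_funM => //; apply/measurable_EFinP; exact: measurable_level_mass.
pose q : R := 2 `^ (p * (t0 - s) + gamma).
have fin : (\int[P]_w \sum_(0 <= j <oo) u j w < +oo)%E.
  rewrite integral_nneseries//.
  apply: le_lt_trans (@nneseries_geometric_lty _ M q (fun j => M * q ^+ j) M0 _ _).
  - apply: lee_nneseries => [j _ _|j _]; first by apply: integral_ge0 => w _; exact: u0.
    rewrite /u (eq_integral (fun w => (2 `^ (j%:R * (p * (t0 - s))))%:E * (mass w j)%:E)%E)//.
    rewrite ge0_integralZl_EFin ?powR_ge0//; last 2 first.
    + by move=> w _; rewrite lee_fin level_mass_ge0.
    + exact: measurable_level_mass.
    apply: (@le_trans _ _ ((2 `^ (j%:R * (p * (t0 - s))))%:E * (((2 ^ d)%:R * beta) ^+ j * M)%:E)%E).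
      by apply: lee_wpmul2l; rewrite ?lee_fin ?powR_ge0.
    rewrite -EFinM lee_fin /q powRD ?pnatr_eq0 ?implybT// gE.
    have -> : 2 `^ (j%:R * (p * (t0 - s))) = (2 `^ (p * (t0 - s))) ^+ j.
      by rewrite -powR_mulrn ?powR_ge0// -powRrM mulrC.
    by rewrite [leRHS]mulrC [in leRHS]exprMn mulrA.
  - rewrite powR_gt0//= /q /powR gt_eqF// expR_lt1 pmulr_llt0 ?ln_gt0 ?ltr1n//.
    have : p * (t0 - s + gamma / p) < 0 by rewrite pmulr_rlt0//; move: ts; lra.
    by rewrite mulrDr mulrCA divff ?mulr1// gt_eqF.
  - by move=> j; rewrite mulr_ge0 ?exprn_ge0 ?powR_ge0/=.
have intS : P.-integrable setT (fun w => \sum_(0 <= j <oo) u j w)%E.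
  apply/integrableP; split; first by apply: ge0_emeasurable_sum.
  rewrite (eq_integral (fun w => \sum_(0 <= j <oo) u j w)%E)// => w _.
  by rewrite gee0_abs//; apply: nneseries_ge0.
apply: filterS (integrable_ae measurableT intS) => w /(_ I) fw.
apply/besov_spaceP => //; rewrite -ge0_fin_numE//.
by apply: nneseries_ge0 => j _ _; exact: u0.
Qed.

End BesovMembership.

(** * Anticoncentration *)

Section Independence.
Context (R : realType) (disp : measure_display) (Omega : measurableType disp)
  (P : probability Omega R).

(** Both sides are finite measures of A that agree on a generating pi-system. *)
Lemma indep_g_sigma (G : set (set Omega)) (B : set Omega) :
  G `<=` measurable -> setI_closed G -> G setT -> measurable B ->
  (forall A, G A -> P (A `&` B) = P A * P B)%E ->
  forall A, <<s G >> A -> (P (A `&` B) = P A * P B)%E.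
Proof.
move=> Gm GI GT mB ind A GA.
have fB : P B \is a fin_num by exact: fin_num_measure.
have f0 : 0 <= fine (P B) by exact: fine_ge0.
pose m1 : {measure set Omega -> \bar R} := mrestr P mB.
pose m2 : {measure set Omega -> \bar R} := mscale (NngNum f0) P.
have m2E D : m2 D = (P D * P B)%E.
  by rewrite /m2 /= /mscale /= fineK// muleC.
rewrite -m2E; apply: (@g_sigma_algebra_measure_unique _ _ _ G Gm (fun=> setT) _ _ m1 m2 GI) => //.
- by apply/seteqP; split=> // w _; exists 0%N.
- by move=> D GD; rewrite m2E; exact: ind.
- move=> _; apply: le_lt_trans (ltry 1); rewrite /m1 /= /mrestr.
  by apply: probability_le1; exact: measurableI.
Qed.

(** Cut the range of V into intervals of length c. On each of the resulting events,
    which are independent of Y, the product b Y is confined to an interval of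
    length 3 c. *)
Lemma anticoncentration (G : set (set Omega)) (Y V : Omega -> R) (K : set Omega) (M b c : R) :
  <<s G >> `<=` measurable -> measurable_fun setT Y ->
  (forall A D, <<s G >> A -> measurable D ->
    P (A `&` Y @^-1` D) = P A * P (Y @^-1` D))%E ->
  0 <= M -> (forall x y : R, x <= y -> (P (Y @^-1` `[x, y]%classic) <= (M * (y - x))%:E)%E) ->
  <<s G >> K -> (forall D, measurable D -> <<s G >> (V @^-1` D)) ->
  b != 0 -> 0 < c ->
  (P (K `&` [set w | `|V w + b * Y w| <= c]%R) <= P K * (M * (3 * c / `|b|))%:E)%E.
Proof.
move=> Gm mY ind M0 dens GK GV b0 c0.
have b0' : 0 < `|b| by rewrite normr_gt0.
pose bin (m : int) : set R := `[m%:~R * c, (m%:~R + 1) * c[%classic.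
pose A n := if pickle_inv n is Some m then K `&` V @^-1` bin m else set0.
(* if V w lies in bin m, then Y w is within rad of mid m *)
pose mid (m : int) := - ((m%:~R + 1 / 2) * c) / b.
pose rad := 3 / 2 * c / `|b|.
pose D n : set R := if pickle_inv n is Some m then
  `[mid m - rad, mid m + rad]%classic else set0.
have GA n : <<s G >> (A n).
  rewrite /A; case: pickle_inv => [m|]; last exact: sigma_algebra0.
  apply: (@measurableI _ (g_sigma_algebraType G)) => //.
  by apply: GV; exact: measurable_itv.
have mD n : measurable (D n).
  by rewrite /D; case: pickle_inv => [m|]; [exact: measurable_itv|exact: measurable0].
have mV : measurable_fun setT V.
  by move=> _ Z mZ; rewrite setTI; apply: Gm; exact: GV.
have mKs : measurable (K `&` [set w | `|V w + b * Y w| <= c]).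
  apply: measurableI; first exact: Gm.
  rewrite (_ : [set w | _] = (fun w => `|V w + b * Y w|) @^-1` `]-oo, c]%classic); last first.
    by apply/seteqP; split=> w /=; rewrite in_itv.
  rewrite -[X in measurable X]setTI.
  apply: (measurableT_comp (@normr_measurable R setT)) => //.
  by apply: measurable_funD => //; exact: measurable_funM.
have mAD n : measurable (A n `&` Y @^-1` D n).
  apply: measurableI; first exact: Gm.
  by rewrite -[X in measurable X]setTI; exact: mY.
have sub : K `&` [set w | `|V w + b * Y w| <= c] `<=` \bigcup_n (A n `&` Y @^-1` D n).
  move=> w [Kw /= sw]; pose m := Num.floor (V w / c).
  have /andP[m1 m2] := floor_itv (V w / c).
  rewrite ler_pdivlMr// in m1; rewrite intrD1 ltr_pdivrMr// in m2.
  exists (pickle m); first by [].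
  have -> : A (pickle m) = K `&` V @^-1` bin m by rewrite /A pickleK_inv.
  have -> : D (pickle m) = `[mid m - rad, mid m + rad]%classic by rewrite /D pickleK_inv.
  split; first by split; [|rewrite /bin /= in_itv/= m1].
  rewrite /= in_itv/= -ler_distl /rad ler_pdivlMr// -normrM mulrBl /mid divfK//.
  move: sw; rewrite mulrC opprK ler_norml => /andP[s1 s2].
  by rewrite ler_norml; move: m1 m2; rewrite -/m mulrDl mul1r; lra.
have AK : (\sum_(0 <= n <oo) P (A n) <= P K)%E.
  have tA : trivIset setT A.
    apply/trivIsetP => i j _ _ ij; apply/seteqP; split => // w; rewrite /A.
    case Ei : (pickle_inv i) => [m|]; last by case.
    case Ej : (pickle_inv j) => [m'|]; last by case=> _ [].
    move=> [[_ Im] [_ Im']]; move: ij.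
    suff mm : m = m'.
      have := @pickle_invK int i; rewrite Ei => <-.
      by have := @pickle_invK int j; rewrite Ej => <-; rewrite mm eqxx.
    move: Im Im'; rewrite /bin /= !in_itv/= => /andP[a1 a2] /andP[a3 a4].
    have f x : x%:~R * c <= V w -> V w < (x%:~R + 1) * c -> Num.floor (V w / c) = x.
      move=> h1 h2; apply: floor_def.
      by rewrite ler_pdivlMr// h1 intrD1 ltr_pdivrMr.
    by rewrite -(f m a1 a2) (f m' a3 a4).
  have -> : (\sum_(0 <= n <oo) P (A n) = P (\bigcup_n A n))%E.
    rewrite measure_bigcup//; last by move=> n _; exact: Gm.
    by apply: eq_eseriesl => n; rewrite in_setT.
  apply: le_measure; rewrite ?inE//; last first.
  - by move=> w [n _]; rewrite /A; case: pickle_inv => // m [].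
  - exact: Gm.
  - by apply: bigcup_measurable => n _; exact: Gm.
apply: le_trans (le_measure P _ _ sub) _; rewrite ?inE//; first exact: bigcupT_measurable.
apply: (@le_trans _ _ (\sum_(0 <= n <oo) P (A n `&` Y @^-1` D n))%E).
  by apply: measure_sigma_subadditive => //; exact: bigcupT_measurable.
apply: (@le_trans _ _ (\sum_(0 <= n <oo) (M * (3 * c / `|b|))%:E * P (A n))%E).
  apply: lee_nneseries => [n _ _|n _]; first exact: measure_ge0.
  rewrite ind// muleC; apply: lee_wpmul2r; first exact: measure_ge0.
  rewrite /D; case: pickle_inv => [m|]; last first.
    by rewrite preimage_set0 measure0 lee_fin mulr_ge0// divr_ge0// mulr_ge0// ltW.
  apply: le_trans (dens _ _ _) _.
    by rewrite lerD2l ge0_cp// /rad divr_ge0// mulr_ge0// ltW.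
  rewrite lee_fin ler_wpM2l// /rad -mulrA; lra.
have q0 : 0 <= M * (3 * c / `|b|) by rewrite mulr_ge0// divr_ge0// mulr_ge0// ltW.
rewrite nneseriesZl//.
by rewrite muleC; apply: lee_wpmul2r; rewrite ?lee_fin.
Qed.

End Independence.

(** * One coefficient given all the others *)

Section OneCoefficient.
Context (R : realType) (disp : measure_display) (Omega : measurableType disp)
  (P : probability Omega R) (d : nat) (beta kappa p c : R)
  (t : nat -> 'rV[int]_d -> {RV P >-> R})
  (X : nat -> 'rV[int]_d -> 'I_(2 ^ d - 1) -> {RV P >-> R}).
Local Notation Zd := 'rV[int]_d.
Local Notation L := 'I_(2 ^ d - 1).
Hypothesis Xindep : mutually_independent (fun n : nat * Zd * L => X n.1.1 n.1.2 n.2).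
Hypothesis Xlaw : forall j k l A, measurable A ->
  distribution P (X j k l) A = (\int[lebesgue_measure]_(x in A)
    (c * expR (- (2 * kappa `^ p)^-1 * `|x| `^ p))%:E)%E.
Hypothesis TX : independent_generated P (tree_events beta t) (X_events X).
Local Notation Lev := (Lev beta t).
Local Notation Xn n := (X n.1.1 n.1.2 n.2).
Local Notation treeS := (<<s tree_events beta t >>).

Lemma sigma_tree_measurable : treeS `<=` measurable.
Proof.
apply: smallest_sub; first exact: sigma_algebra_measurable.
by move=> _ [[j k] ->]; exact: measurable_Lev.
Qed.

Lemma measurable_X_preimage (n : nat * Zd * L) (A : set R) : measurable A ->
  measurable (Xn n @^-1` A).
Proof. by move=> mA; rewrite -[X in measurable X]setTI; exact: measurable_funPT. Qed.

(** A pi-system for the information carried by the tree and by all the coefficients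
    but that of index n0. *)
Definition others (n0 : nat * Zd * L) : set (set Omega) :=
  [set B | exists (K : set Omega) (s : seq (nat * Zd * L)) (A : nat * Zd * L -> set R),
    [/\ treeS K, uniq s, n0 \notin s, forall n, measurable (A n) &
        B = K `&` \bigcap_(n in [set` s]) (Xn n @^-1` A n)]].

Lemma others_measurable n0 : others n0 `<=` measurable.
Proof.
move=> _ [K [s [A [tK _ _ mA ->]]]]; apply: measurableI; first exact: sigma_tree_measurable.
by apply: fin_bigcap_measurable => // n _; exact: measurable_X_preimage.
Qed.

Lemma sigma_others_measurable n0 : <<s others n0 >> `<=` measurable.
Proof.
apply: smallest_sub; first exact: sigma_algebra_measurable.
exact: others_measurable.
Qed.

Lemma others_setT n0 : others n0 setT.
Proof.
exists setT, [::], (fun=> setT); split=> //; first exact: (@measurableT _ (g_sigma_algebraType (tree_events beta t))).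
by apply/seteqP; split.
Qed.

Lemma others_setI n0 : setI_closed (others n0).
Proof.
move=> _ _ [K [s [A [tK us ns mA ->]]]] [K' [s' [A' [tK' us' ns' mA' ->]]]].
exists (K `&` K'), (undup (s ++ s')),
  (fun n => (if n \in s then A n else setT) `&` (if n \in s' then A' n else setT)).
split.
- exact: (@measurableI _ (g_sigma_algebraType (tree_events beta t))).
- exact: undup_uniq.
- by rewrite mem_undup mem_cat negb_or ns.
- by move=> n; apply: measurableI; case: ifP.
rewrite setIACA; congr (_ `&` _); apply/seteqP; split=> [w [H H'] n /= _|w H].
  by split; case: ifP => //= ?; [exact: H|exact: H'].
by split=> n /= ns0; have := H n; rewrite /= mem_undup mem_cat ns0 ?orbT => /(_ isT) [].
Qed.

Lemma others_tree n0 : treeS `<=` <<s others n0 >>.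
Proof.
move=> K tK; apply: sub_sigma_algebra; exists K, [::], (fun=> setT); split=> //.
by rewrite [X in K `&` X](_ : _ = setT) ?setIT//; apply/seteqP; split.
Qed.

Lemma others_X n0 n (A : set R) : n != n0 -> measurable A -> <<s others n0 >> (Xn n @^-1` A).
Proof.
move=> nn mA; apply: sub_sigma_algebra; exists setT, [:: n], (fun=> A); split=> //.
- exact: (@measurableT _ (g_sigma_algebraType (tree_events beta t))).
- by rewrite inE eq_sym.
rewrite setTI; apply/seteqP; split=> [w H m|w /(_ n)]; rewrite /= inE ?eqxx//; last exact.
by move=> /eqP ->.
Qed.

Lemma others_indep n0 (D : set R) : measurable D ->
  forall B, <<s others n0 >> B -> (P (B `&` Xn n0 @^-1` D) = P B * P (Xn n0 @^-1` D))%E.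
Proof.
move=> mD; apply: indep_g_sigma.
- exact: others_measurable.
- exact: others_setI.
- exact: others_setT.
- exact: measurable_X_preimage.
move=> _ [K [s [A [tK us ns mA ->]]]].
have sX (q : seq _) (A0 : nat * Zd * L -> set R) : (forall n, measurable (A0 n)) ->
    <<s X_events X >> (\bigcap_(n in [set` q]) (Xn n @^-1` A0 n)).
  move=> mA0; apply: sigma_fin_bigcap => n _; apply: sub_sigma_algebra.
  by exists n.1.1, n.1.2, n.2, (A0 n).
pose A1 n := if n == n0 then D else A n.
have mA1 n : measurable (A1 n) by rewrite /A1; case: ifP.
have A1E n : n \in s -> A1 n = A n.
  by move=> n_s; rewrite /A1; case: eqP => // nn; move: ns; rewrite -nn n_s.
have -> : K `&` \bigcap_(n in [set` s]) (Xn n @^-1` A n) `&` Xn n0 @^-1` D =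
    K `&` \bigcap_(n in [set` n0 :: s]) (Xn n @^-1` A1 n).
  rewrite -setIA; congr (_ `&` _); rewrite bigcap_seq_cons setIC.
  have -> : A1 n0 = D by rewrite /A1 eqxx.
  by congr (_ `&` _); apply: eq_bigcapr => n /= n_s; rewrite A1E.
rewrite !TX//; try exact: sX.
rewrite !Xindep//= ?ns//.
rewrite big_cons {1}/A1 eqxx -muleA; congr (_ * _)%E; rewrite muleC; congr (_ * _)%E.
by rewrite !big_seq; apply: eq_bigr => n n_s; rewrite A1E.
Qed.

Section RandomSum.
Variables (a : nat -> Zd -> L -> R).

Definition random_sum (J : nat) (w : Omega) : R :=
  \sum_(i < J) \sum_(m <- nodes d i) \sum_l
    a i m l * (\1_(Lev i m) w * X i m l w).

Definition random_rest (n0 : nat * Zd * L) (J : nat) (w : Omega) : R :=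
  \sum_(i < J) \sum_(m <- nodes d i) \sum_l
    if ((i : nat), m, l) == n0 then 0 else a i m l * (\1_(Lev i m) w * X i m l w).

Lemma random_sum_split j k l J w : (j < J)%N -> k \in nodes d j ->
  random_sum J w = random_rest (j, k, l) J w + a j k l * (\1_(Lev j k) w * X j k l w).
Proof.
move=> jJ kj; rewrite /random_sum /random_rest.
set F := fun i m l => a i m l * (\1_(Lev i m) w * X i m l w).
have -> : a j k l * (\1_(Lev j k) w * X j k l w) =
    \sum_(i < J) \sum_(m <- nodes d i) \sum_l'
      if ((i : nat), m, l') == (j, k, l) then F i m l' else 0.
  rewrite (bigD1 (Ordinal jJ))//= (bigD1_seq k)//= ?uniq_nodes// (bigD1 l)//= eqxx.
  rewrite !big1 ?addr0//.
  - move=> i ij; apply: big1_seq => m _; apply: big1 => l' _.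
    case: eqP => // -[ij' _ _]; case/eqP: ij; exact/val_inj.
  - by move=> m mk; apply: big1 => l' _; case: eqP => // -[mk' _]; rewrite mk' eqxx in mk.
  - by move=> l' ll; case: eqP => // -[ll']; rewrite ll' eqxx in ll.
rewrite -big_split/=; apply: eq_bigr => i _; rewrite -big_split/=; apply: eq_bigr => m _.
by rewrite -big_split/=; apply: eq_bigr => l' _; case: ifP; rewrite ?add0r ?addr0.
Qed.

Lemma measurable_random_sum J : measurable_fun setT (random_sum J).
Proof.
apply: measurable_sum => i; apply: measurable_sum => m; apply: measurable_sum => l.
apply: measurable_funM => //; apply: measurable_funM.
  by apply: measurable_indic; exact: measurable_Lev.
exact: measurable_funPT.
Qed.

Lemma others_random_rest n0 J (D : set R) : measurable D ->
  <<s others n0 >> (random_rest n0 J @^-1` D).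
Proof.
move=> mD.
have mf : measurable_fun [set: g_sigma_algebraType (others n0)] (random_rest n0 J).
  apply: measurable_sum => i; apply: measurable_sum => m; apply: measurable_sum => l.
  have [_|nn] := eqVneq; first exact: measurable_cst.
  apply: measurable_funM; first exact: measurable_cst.
  apply: measurable_funM.
    apply: measurable_indic; apply: others_tree; exact: sigma_tree_Lev.
  by move=> _ Z mZ; rewrite setTI; exact: others_X nn mZ.
by have := mf measurableT D mD; rewrite setTI.
Qed.

Definition small_sum (J : nat) (e : R) : set Omega := [set w | `|random_sum J w| <= e].

(** Given all the other variables, the sum is an affine function of X j k l with
    slope a j k l on the event that the node belongs to the tree. *)
Lemma prob_random_sum_small j k l J (K : set Omega) (e : R) :
  (j < J)%N -> k \in nodes d j -> treeS K -> a j k l != 0 -> 0 < e ->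
  (P (K `&` Lev j k `&` small_sum J e) <=
   P (K `&` Lev j k) * (`|c| * (3 * e / `|a j k l|))%:E)%E.
Proof.
move=> jJ kj tK a0 e0.
have -> : K `&` Lev j k `&` small_sum J e =
    K `&` Lev j k `&` [set w | `|random_rest (j, k, l) J w + a j k l * X j k l w| <= e].
  apply/seteqP; split=> w [[Kw Lw] /=]; rewrite /small_sum /= (@random_sum_split j k l)// indicE mem_set// mul1r.
    by [].
  by [].
apply: (@anticoncentration _ _ _ P (others (j, k, l))) => //.
- exact: sigma_others_measurable.
- by move=> A D GA mD; exact: (@others_indep (j, k, l)).
- exact: prob_X_itv Xlaw j k l.
- apply: others_tree; apply: (@measurableI _ (g_sigma_algebraType (tree_events beta t))) => //.
  exact: sigma_tree_Lev.
- by move=> D mD; exact: others_random_rest.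
Qed.

Definition eventually_small (e : R) : set Omega :=
  \bigcup_J0 \bigcap_(J in [set J | (J0 <= J)%N]) small_sum J e.

Lemma measurable_random_sum_small J (e : R) : measurable (small_sum J e).
Proof.
rewrite (_ : small_sum J e = (fun w => `|random_sum J w|) @^-1` `]-oo, e]%classic); last first.
  by apply/seteqP; split=> w; rewrite /small_sum /= in_itv.
rewrite -[X in measurable X]setTI.
by apply: (measurableT_comp (@normr_measurable R setT)) => //; exact: measurable_random_sum.
Qed.

Lemma measurable_eventually_small e : measurable (eventually_small e).
Proof.
apply: bigcupT_measurable => J0; apply: bigcap_measurableType => J _.
exact: measurable_random_sum_small.
Qed.

Lemma prob_eventually_small j k l (K : set Omega) (e : R) :
  k \in nodes d j -> treeS K -> a j k l != 0 -> 0 < e ->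
  (P (K `&` Lev j k `&` eventually_small e) <=
   P (K `&` Lev j k) * (`|c| * (3 * e / `|a j k l|))%:E)%E.
Proof.
move=> kj tK a0 e0.
have mKL : measurable (K `&` Lev j k).
  by apply: measurableI; [exact: sigma_tree_measurable|exact: measurable_Lev].
have mF J : measurable (K `&` Lev j k `&` small_sum J e).
  by apply: measurableI => //; exact: measurable_random_sum_small.
have fb : (P (K `&` Lev j k) * (`|c| * (3 * e / `|a j k l|))%:E)%E \is a fin_num.
  by apply: fin_numM => //; exact: fin_num_measure.
have Fb J : (j.+1 <= J)%N -> (P (K `&` Lev j k `&` small_sum J e) <=
    (fine (P (K `&` Lev j k) * (`|c| * (3 * e / `|a j k l|))%:E))%:E)%E.
  by move=> jJ; rewrite fineK//; exact: prob_random_sum_small.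
rewrite -(fineK fb); have [mU] := prob_liminf_le mF Fb.
apply: le_trans; apply: le_measure; rewrite ?inE//.
  by apply: measurableI => //; exact: measurable_eventually_small.
by move=> w [KLw [J0 _ H]]; exists J0 => // J JJ; split=> //; exact: H.
Qed.

End RandomSum.

Section FirstNode.
Variables (j : nat) (l : L) (near : pred Zd) (a : Zd -> nat -> Zd -> L -> R)
  (e : Zd -> R) (q : R).
Hypothesis a0 : forall k, a k j k l != 0.
Hypothesis e0 : forall k, 0 < e k.
Hypothesis aq : forall k, `|c| * (3 * e k / `|a k j k l|) <= q.

(** Only the first surviving node near the point is examined: the events are then
    disjoint for distinct nodes, and their number 2^(dj) does not enter the bound. *)
Fixpoint first_small (s : seq Zd) : set Omega :=
  if s is k :: s' then
    if near k then
      (Lev j k `&` eventually_small (a k) (e k)) `|` (~` Lev j k `&` first_small s')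
    else first_small s'
  else set0.

Lemma measurable_first_small s : measurable (first_small s).
Proof.
elim: s => [|k s IHs] //=; case: ifP => // _; apply: measurableU; apply: measurableI => //.
- exact: measurable_Lev.
- exact: measurable_eventually_small.
- by apply: measurableC; exact: measurable_Lev.
Qed.

(** Survival of the head of the list is an event of the tree. It splits the
    probability of K into two parts, and each of them picks up the factor q. *)
Lemma prob_first_small s K : {subset s <= nodes d j} -> treeS K ->
  (P (K `&` first_small s) <= P K * q%:E)%E.
Proof.
have q0 : 0 <= q.
  by apply: le_trans (aq 0); rewrite mulr_ge0// divr_ge0// mulr_ge0// ltW.
elim: s K => [|k s IHs] K sn tK /=.
  by rewrite setI0 measure0 mule_ge0// lee_fin.
have sn' : {subset s <= nodes d j} by move=> k' ks; apply: sn; rewrite inE ks orbT.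
case: ifP => _; last exact: IHs.
have mK := sigma_tree_measurable tK; have mL := measurable_Lev beta t j k.
have tKL : treeS (K `&` ~` Lev j k).
  apply: (@measurableI _ (g_sigma_algebraType (tree_events beta t))) => //.
  apply: (@measurableC _ (g_sigma_algebraType (tree_events beta t))).
  exact: sigma_tree_Lev.
rewrite setIUr !setIA.
have m1 : measurable (K `&` Lev j k `&` eventually_small (a k) (e k)).
  by apply: measurableI; [exact: measurableI|exact: measurable_eventually_small].
have m2 : measurable (K `&` ~` Lev j k `&` first_small s).
  apply: measurableI; [exact: sigma_tree_measurable|exact: measurable_first_small].
apply: le_trans (measureU2 _ m1 m2) _.
have -> : P K = (P (K `&` Lev j k) + P (K `&` ~` Lev j k))%E.
  by rewrite addeC -setDE; exact: measureDI.
rewrite ge0_muleDl//; apply: leeD; last exact: IHs.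
apply: le_trans (@prob_eventually_small _ j k l _ _ _ tK (a0 k) (e0 k)) _.
  by apply: sn; rewrite mem_head.
by apply: lee_wpmul2l; rewrite ?lee_fin.
Qed.

Lemma first_smallP s w : (exists2 k, k \in s & near k /\ Lev j k w) ->
  (forall k, near k -> Lev j k w -> eventually_small (a k) (e k) w) -> first_small s w.
Proof.
move=> + H; elim: s => [|k s IHs] /=; first by case.
move=> [k0 + [n0 L0]]; rewrite inE => /orP[/eqP k0E|k0s].
  by rewrite -k0E n0; left; split=> //; exact: H.
have Hs : first_small s w by apply: IHs; exists k0.
case: ifP => // nk; have [Lk|Lk] := pselect (Lev j k w); last by right.
by left; split=> //; exact: H.
Qed.

End FirstNode.
End OneCoefficient.

(** * Points of tau are singular *)

Section SingularSupport.
Context (R : realType) (disp : measure_display) (Omega : measurableType disp)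
  (P : probability Omega R) (d r : nat) (beta kappa p c s : R)
  (phi : 'rV[R]_d.+1 -> R) (Psi : 'I_(2 ^ d.+1 - 1) -> 'rV[R]_d.+1 -> R)
  (t : nat -> 'rV[int]_d.+1 -> {RV P >-> R})
  (X : nat -> 'rV[int]_d.+1 -> 'I_(2 ^ d.+1 - 1) -> {RV P >-> R}).
Local Notation E := 'rV[R]_d.+1.
Local Notation Zd := 'rV[int]_d.+1.
Local Notation L := 'I_(2 ^ d.+1 - 1).
Local Notation D := (d.+1%:R : R).
Local Notation mu := (@lebesgue_rV R d.+1).
Hypothesis Xindep : mutually_independent (fun n : nat * Zd * L => X n.1.1 n.1.2 n.2).
Hypothesis Xlaw : forall j k l A, measurable A ->
  distribution P (X j k l) A = (\int[lebesgue_measure]_(x in A)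
    (c * expR (- (2 * kappa `^ p)^-1 * `|x| `^ p))%:E)%E.
Hypothesis TX : independent_generated P (tree_events beta t) (X_events X).
Hypothesis CPsi : forall l, Cn r setT (Psi l).
Hypothesis sPsi : forall l, compactly_supported_in setT (Psi l).
Hypothesis p0 : 0 < p.
Hypothesis sr : s < r%:R.
Local Notation T w := (tree beta (fun j k => t j k w)).
Local Notation f w := (random_wseries s p (T w) (fun j k l => X j k l w)).

Let h (j : nat) : R := 2 `^ (- (j%:R * (s + D / 2 - D / p))).

Let h_gt0 j : 0 < h j. Proof. exact: powR_gt0. Qed.

(** The left-hand side is K times 2^j to the negative power s - d/p - r. *)
Lemma geometric_decay (K e : R) (j1 : nat) : 0 < e ->
  exists2 j, (j1 <= j)%N & K * 2 ^- (j * r) / (h j * 2 `^ (j%:R * D / 2)) <= e.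
Proof.
move=> e_gt0; pose del := r%:R - s + D / p.
have del0 : 0 < del by rewrite addr_gt0 ?subr_gt0// divr_gt0.
have z1 : `|2 `^ (- del)| < 1 :> R.
  rewrite gtr0_norm ?powR_gt0// /powR gt_eqF// expR_lt1 pmulr_llt0 ?ln_gt0 ?ltr1n//.
  by rewrite oppr_lt0.
have /cvgr0_norm_lt/(_ _ e_gt0) := @cvg_geometric R K _ z1.
move=> [j2 _ Hj2]; exists (maxn j1 j2); first exact: leq_maxl.
set j := maxn j1 j2; have := Hj2 j (leq_maxr _ _).
move=> /ltW; apply: le_trans; apply: le_trans (ler_norm _).
rewrite le_eqVlt; apply/orP; left; apply/eqP; rewrite /geometric /=.
rewrite -mulrA; congr (_ * _).
rewrite -[2 ^+ (j * r)]powR_mulrn// /h -powRN -powRD ?pnatr_eq0 ?implybT//.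
rewrite -powRN -powRD ?pnatr_eq0 ?implybT// -[RHS]powR_mulrn ?powR_ge0// -powRrM.
congr (_ `^ _); rewrite /del natrM; field.
by rewrite gt_eqF.
Qed.

Section Probed.
Variables (theta : E -> R) (l0 : L) (c0 sg : R).
Hypothesis Ctheta : forall n, Cn n setT theta.
Hypothesis theta_cont_bsupp : cont_bsupp theta.
Hypothesis theta0 : forall x, 0 <= theta x.
Hypothesis theta_gt0 : exists y, 0 < theta y.
Hypothesis c0_gt0 : 0 < c0.
Hypothesis sg1 : `|sg| = 1.
Hypothesis Hc0 : forall x, theta x != 0 -> c0 <= sg * iter r (fdiff (e0 R d)) (Psi l0) x.

Let a (j : nat) (k : Zd) (i : nat) (m : Zd) (l : L) : R :=
  h i * pairing r Psi theta j k i m l.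

Let mass_pos j k : 0 < mass theta j k. Proof. exact: mass_gt0. Qed.

(** The normalisations of the wavelet and of the coefficient come out as factors;
    Rintegral_scaled_probe bounds what is left. *)
Lemma pairing_lower_bound j k :
  h j * 2 `^ (j%:R * D / 2) * (c0 * mass theta j k) <= `|a j k j k l0|.
Proof.
rewrite /a normrM gtr0_norm// -mulrA ler_wpM2l ?(ltW (h_gt0 j))//.
have cP : cont_bsupp (Psi l0) := cont_bsupp_Psi CPsi sPsi l0.
have -> : pairing r Psi theta j k j k l0 = 2 `^ (j%:R * D / 2) *
    \int[mu]_x (Psi l0 (2 ^+ j *: x - intv R k) * probe r theta j k x).
  rewrite -RintegralZl//.
    by apply: eq_Rintegral => x _; rewrite /mother mulrA.
  apply: cont_bsupp_integrable; apply: cont_bsuppMr; last by have [] := cont_bsupp_probe r theta_cont_bsupp j k.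
  exact: cont_bsupp_affine (pow2_neq0 R j) cP.
rewrite normrM gtr0_norm ?powR_gt0// ler_wpM2l ?powR_ge0//.
exact: Rintegral_scaled_probe Hc0.
Qed.

Let a_neq0 j k : a j k j k l0 != 0.
Proof.
rewrite -normr_gt0; apply: lt_le_trans (pairing_lower_bound j k).
by rewrite !mulr_gt0// powR_gt0.
Qed.

Lemma partial_sum_random_sum w J j k :
  \sum_(i < J) \sum_(m <- nodes d.+1 i) \sum_l
    coef_mother (f w) i m l * pairing r Psi theta j k i m l =
  random_sum beta t X (a j k) J w.
Proof.
apply: eq_bigr => i _; apply: eq_bigr => m _; apply: eq_bigr => l _ /=.
have [Lm|Lm] := pselect (Lev beta t i m w).
  by rewrite asboolT// indicE mem_set// mul1r /a mulrAC.
by rewrite asboolF// indicE memNset// !mul0r mulr0.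
Qed.

(** The conclusion of smooth_point_of_tau for one choice of its parameters. *)
Definition smooth_bounds (n : nat * Zd * nat * nat) : set Omega :=
  let: (i, k', C, j1) := n in [set w | (0 < C)%N /\ forall j, (j1 <= j)%N ->
    (exists2 k, T w (j, k) & near_node R i k' j k) /\
    forall k, T w (j, k) -> near_node R i k' j k ->
      eventually_small beta t X (a j k) (C%:R * 2 ^- (j * r) * mass theta j k) w].

(** The bounds hold at every level j >= j1, and at level j they force the first
    surviving node near the point to have a pairing that is too small. The
    probability of that tends to 0 with j. *)
Lemma negligible_smooth_bounds n : P.-negligible (smooth_bounds n).
Proof.
case: n => [[[i k'] C] j1]; case: C => [|C].
  by apply: negligibleS (negligible_set0 P) => w [].
apply: negligible_small => e e_gt0.
have [j jj je] := @geometric_decay (`|c| * (3 * C.+1%:R) / c0) e j1 e_gt0.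
pose nearb : pred Zd := fun k => `[< near_node R i k' j k >].
pose ek k := C.+1%:R * 2 ^- (j * r) * mass theta j k.
have ek0 k : 0 < ek k by rewrite !mulr_gt0// invr_gt0 exprn_gt0.
have aq k : `|c| * (3 * ek k / `|a j k j k l0|) <= e.
  apply: le_trans je; have lb := pairing_lower_bound j k.
  have lb0 : 0 < h j * 2 `^ (j%:R * D / 2) * (c0 * mass theta j k).
    by rewrite !mulr_gt0// powR_gt0.
  have a_gt0 : 0 < `|a j k j k l0| by exact: lt_le_trans lb.
  apply: (@le_trans _ _ (`|c| * (3 * ek k / (h j * 2 `^ (j%:R * D / 2) * (c0 * mass theta j k))))).
    rewrite ler_wpM2l// ler_wpM2l//; first by rewrite mulr_ge0// ltW.
    by rewrite lef_pV2 ?posrE.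
  rewrite le_eqVlt; apply/orP; left; apply/eqP; rewrite /ek.
  move: (h_gt0 j) (mass_pos j k) (powR_gt0 (j%:R * D / 2) (ltr0Sn R 1)).
  move: (h j) (mass theta j k) (2 `^ (j%:R * D / 2)) => x1 x2 x3 y1 y2 y3.
  by field; rewrite !gt_eqF// exprn_gt0.
exists (first_small beta t X j nearb (a j) ek (nodes d.+1 j)); split.
- exact: measurable_first_small.
- move=> w [_ /(_ j jj) [[k Tk nk] H]]; apply: first_smallP => [|k2 /asboolP nk2 Lk2].
    exists k; first exact: level_nodes Tk.
    by split => //; exact/asboolP.
  exact: H.
have := prob_first_small Xindep Xlaw TX nearb (a_neq0 j) ek0 aq
  (fun k kj => kj) (@measurableT _ (g_sigma_algebraType (tree_events beta t))).
by rewrite setTI probability_setT mul1e.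
Qed.

End Probed.

Lemma ae_tau_subset_singsupp (l0 : L) : (exists y, Psi l0 y != 0) ->
  {ae P, forall w, tau R (T w) `<=` singsupp phi Psi r (f w)}.
Proof.
move=> Py; have cP := cont_bsupp_Psi CPsi sPsi l0.
have [y Fy] := fdiffn_neq0 r (e0_neq0 R d) cP.2 Py.
have cF : continuous (iter r (fdiff (e0 R d)) (Psi l0)) by have [] := cont_bsupp_fdiffn r (e0 R d) cP.
have [theta [c0 [sg [C1 tc t0 ty [c0_gt0 sg1 Hc0]]]]] := exists_probe cF Fy.
have tex : exists y, 0 < theta y by exists y.
pose F (n : nat) : set Omega :=
  if unpickle n is Some i then smooth_bounds theta i else set0.
have NF : P.-negligible (\bigcup_n F n).
  apply: negligible_bigcup => n; rewrite /F; case: unpickle => [i|].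
    exact: (negligible_smooth_bounds (l0 := l0) tc t0 tex c0_gt0 sg1 Hc0).
  exact: negligible_set0.
apply: negligibleS NF => w /= nsub.
have [x tx nx] : exists2 x, tau R (T w) x & ~ singsupp phi Psi r (f w) x.
  by apply: contrapT => H; apply: nsub => x tx; apply: contrapT => nx; apply: H; exists x.
have [i [k' [C [j1 [C_gt0 H]]]]] := smooth_point_of_tau CPsi sPsi C1 tc t0 tex tx nx.
exists (pickle (i, k', C, j1)); first by [].
rewrite /F pickleK; split=> // j jj; have [H1 H2] := H j jj; split=> // k Tk nk.
have [J0 HJ0] := H2 k Tk nk; exists J0; first by [].
by move=> J JJ; rewrite /small_sum /= -partial_sum_random_sum; exact: HJ0.
Qed.

End SingularSupport.

(** * The theorem *)

(** The mother wavelets have norm 1 in L^2. *)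
Lemma mother_wavelet_neq0 (R : realType) (d r : nat) (phi : 'rV[R]_d -> R)
    (Psi : 'I_(2 ^ d - 1) -> 'rV[R]_d -> R) (l : 'I_(2 ^ d - 1)) :
  wavelet_basis phi Psi r -> exists y, Psi l y != 0.
Proof.
move=> [_ _ _ _ [[_ on] _]]; apply: contrapT => H.
have := on (inr (0%N, 0, l)) (inr (0%N, 0, l)); rewrite eqxx /dotL2 /=.
set F := (X in Rintegral _ _ X = _).
have -> : F = fun=> 0; last first.
  by rewrite /Rintegral integral0_eq//= => /eqP; rewrite eq_sym oner_eq0.
apply/funext => x; rewrite /F /mother (_ : Psi l _ = 0) ?mulr0//.
by apply/eqP/negPn/negP => Hx; apply: H; exists (2 ^+ 0 *: x - intv R 0).
Qed.

Theorem theorem5 (R : realType) (d r : nat) (p kappa s gamma : R)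
    (phi : 'rV[R]_d -> R) (Psi : 'I_(2 ^ d - 1) -> 'rV[R]_d -> R)
    (disp : measure_display) (Omega : measurableType disp)
    (P : probability Omega R)
    (t : nat -> 'rV[int]_d -> {RV P >-> R})
    (X : nat -> 'rV[int]_d -> 'I_(2 ^ d - 1) -> {RV P >-> R}) :
  (1 <= d)%N -> 1 <= p -> 0 < kappa -> (1 <= r)%N -> s < r%:R ->
  0 < gamma -> gamma <= d%:R ->
  wavelet_basis phi Psi r ->
  let beta := 2 `^ (gamma - d%:R) in
  random_inputs beta kappa p t X ->
  let T := fun w => tree beta (fun j k => t j k w) in
  let f := fun w => random_wseries s p (T w) (fun j k l => X j k l w) in
  [/\ forall t0 : R, t0 < s - gamma / p ->
        {ae P, forall w, besov_space t0 p (f w)},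
      {ae P, forall w, tau R (T w) !=set0 ->
        ~ besov_space (s - gamma / p) p (f w)}
    & {ae P, forall w, singsupp phi Psi r (f w) = tau R (T w)}].
Proof.
case: d phi Psi t X => [//|d] phi Psi t X _ p1 kappa0 _ sr gamma0 gammad wb beta.
move=> [[tindep tlaw] Xindep [c Xlaw] TX] T f.
have p0 : 0 < p by exact: lt_le_trans p1.
have beta0 : 0 < beta by exact: powR_gt0.
have beta1 : beta <= 1.
  by rewrite /beta -[leRHS](powRr0 2) ler_powR ?ler1n// subr_le0.
have gE : 2 `^ gamma = (2 ^ d.+1)%:R * beta.
  rewrite natrX -powR_mulrn// /beta -powRD ?pnatr_eq0 ?implybT//.
  by congr (_ `^ _); lra.
have m1 : 1 < (2 ^ d.+1)%:R * beta.
  by rewrite -gE /powR gt_eqF// expR_gt1 pmulr_rgt0// ln_gt0// ltr1n.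
have l0 : 'I_(2 ^ d.+1 - 1).
  by apply: Ordinal (_ : 0 < _)%N; rewrite subn_gt0 -{1}(expn0 2) ltn_exp2l.
have [_ CsPsi _ _ _] := wb.
have CPsi l : Cn r setT (Psi l) by have [] := CsPsi l.
have sPsi l : compactly_supported_in setT (Psi l) by have [] := CsPsi l.
split.
- move=> t0 t0s; have beta01 : 0 <= beta <= 1 by rewrite ltW.
  exact: ae_besov tindep tlaw Xlaw TX beta01 kappa0 p1 _ _ _ gE t0s.
- exact: (ae_not_besov tindep tlaw Xindep Xlaw TX beta0 beta1 l0 m1 p0 s gE).
have := ae_tau_subset_singsupp phi Xindep Xlaw TX CPsi sPsi p0 sr (mother_wavelet_neq0 l0 wb).
apply: filterS => w sub; apply/seteqP; split => //.
exact: singsupp_subset_tau.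
Qed.
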